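(* Consider the $n\times n$ system $\frac{dY}{dz}=A(z,t)Y$, $A(z,t)=\sum_{j\ge0}A_j(t)z^{-j}$, with $A$ holomorphic for $|z|\ge N_0$, $t\in\mathcal U_{\epsilon_0}(0)\subset\mathbb C^n$, satisfying Assumption 1: there is a holomorphic invertible $G_0(t)$ on $\mathcal U_{\epsilon_0}(0)$, $G_0(0)=I$, with $G_0(t)^{-1}A_0(t)G_0(t)=\Lambda(t)=\mathrm{diag}(u_1(t),\dots,u_n(t))$. Let $\tau_\nu<\widetilde\tau<\tau_{\nu+1}$. If the eigenvalues are linear in $t$, $u_a(t)=u_a(0)+t_a$, then for any $t_0$ in a $\widetilde\tau$-cell the fundamental solution $Y_\nu(z,t)$ (initially defined for $t$ in a neighbourhood of $t_0$, see context) is holomorphic on the whole $\widetilde\tau$-cell, with asymptotics $$G_0(t)^{-1}Y_\nu(z,t)e^{-\Lambda(t)z}z^{-B_1(t)}\sim I+\sum_{k=1}^\infty F_k(t)z^{-k}$$ for $z\to\infty$ in $\mathcal S_\nu(t)$, for any $t$ in the cell. For any compact subset $K$ of the cell, the asymptotics $G_0(t)^{-1}Y_\nu(z,t)e^{-\Lambda(t)z}z^{-B_1(t)}\sim I+\sum_{k=1}^\infty F_k(t)z^{-k}$ for $z\to\infty$, $z\in\mathcal S_\nu(K)$, is uniform in $t\in K$.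
   Context: Notation. $\mathcal R$ is the universal covering of $\mathbb C\setminus\{0\}$; $S(\alpha,\beta)=\{z\in\mathcal R:\alpha<\arg z<\beta\}$. $|t|=\max_i|t_i|$, $\mathcal U_\epsilon(0)=\{|t|\le\epsilon\}$. $A_0(0)=\Lambda(0)=\lambda_1I_{p_1}\oplus\cdots\oplus\lambda_sI_{p_s}$ with $\lambda_i$ distinct; $\epsilon_0$ is small enough that $u_a(t)\neq u_b(t)$ on $\mathcal U_{\epsilon_0}(0)$ whenever $u_a(0)\ne u_b(0)$. $\Delta=\{t:u_a(t)=u_b(t)\text{ for some }a\ne b\}$. Set $\widehat A_k=G_0^{-1}A_kG_0$, $B_1(t)=\mathrm{diag}(\widehat A_1(t))$. For $t\notin\Delta$ there is a unique formal solution $G_0(t)(I+\sum_{k\ge1}F_k(t)z^{-k})z^{B_1(t)}e^{\Lambda(t)z}$; the $F_k$ are holomorphic off $\Delta$. Stokes rays of $\Lambda(t)$: rays $\{z\in\mathcal R:\Re[(u_a(t)-u_b(t))z]=0\}$, $u_a(t)\ne u_b(t)$. Those of $\Lambda(0)$ have directions labelled increasingly $\cdots<\tau_\sigma<\tau_{\sigma+1}<\cdots$ (if $s=1$ there are none and $\widetilde\tau$ is arbitrary). $X(\widetilde\tau)$ is the set of $t\in\mathcal U_{\epsilon_0}(0)$ such that $\arg(u_a(t)-u_b(t))=\frac{3\pi}2-\widetilde\tau$ mod $\pi$ for some $a\neq b$ with $u_a(t)\ne u_b(t)$. A $\widetilde\tau$-cell is a connected component of $\mathcal U_{\epsilon_0}(0)\setminus(\Delta\cup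 X(\widetilde\tau))$. For $t\notin X(\widetilde\tau)$, $\mathcal S_\nu(t)$ is the open sector containing $\overline S(\widetilde\tau-\pi,\widetilde\tau)=\{\widetilde\tau-\pi\le\arg z\le\widetilde\tau\}$ and extending up to the nearest Stokes rays of $\Lambda(t)$ outside it. For $K$ a compact subset of a cell, $\mathcal S_\nu(K)=\bigcap_{t\in K}\mathcal S_\nu(t)$. For $t_0$ in a cell, $Y_\nu(z,t)$ is, for $t$ in a small closed polydisc centred at $t_0$ contained in the cell, the unique fundamental solution, holomorphic in $(z,t)$ for $z\in\mathcal R$, $|z|\ge N$, with the asymptotics $G_0(t)^{-1}Y_\nu(z,t)e^{-\Lambda(t)z}z^{-B_1(t)}\sim I+\sum_{k=1}^\infty F_k(t)z^{-k}$ for $z\to\infty$ in $\mathcal S_\nu(t)$. Asymptotics in an open sector means in every proper closed subsector. *)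

(* Defs.v *)
From HB Require Import structures.
From mathcomp Require Export all_boot all_order all_algebra.
From mathcomp Require Export all_classical all_reals all_analysis.
From mathcomp Require Export complex.

Set Implicit Arguments.
Unset Strict Implicit.
Unset Printing Implicit Defensive.

Import Order.TTheory GRing.Theory Num.Theory.
Export numFieldNormedType.Exports.

Local Open Scope classical_set_scope.
Local Open Scope ring_scope.
Local Open Scope complex_scope.

(* MathComp-Analysis attaches the topology of a numeric field to the abstract
   structures only; it is copied here to the concrete type [R[i]].  On normed
   modules over [R[i]], [differentiable] is then complex differentiability. *)
Section ComplexTopology.
Variable R : realType.
HB.instance Definition _ := GRing.ComAlgebra.copy R[i] R[i]^o.
HB.instance Definition _ := Vector.copy R[i] R[i]^o.
HB.instance Definition _ := NormedModule.copy R[i] R[i]^o.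
End ComplexTopology.

(* The domains below are not open (closed polydiscs, |z| >= N): holomorphic
   means having a holomorphic extension to an open neighbourhood. *)
Definition holomorphic_on (R : realType) (V W : normedModType R[i])
    (D : set V) (f : V -> W) : Prop :=
  exists (O : set V) (g : V -> W),
    [/\ open O, D `<=` O, (forall x, O x -> differentiable g x)
      & (forall x, D x -> g x = f x)].

Definition polydisc (R : realType) (n : nat) (c : 'rV[R[i]]_n) (r : R) :
    set 'rV[R[i]]_n :=
  [set t | forall i, `|t 0 i - c 0 i| <= r%:C].

Definition cexp (R : realType) (w : R[i]) : R[i] :=
  (expR (complex.Re w) * cos (complex.Im w))
    +i* (expR (complex.Re w) * sin (complex.Im w)).

(* The universal covering of C \ {0} is exp : C -> C \ {0}.  Its points are
   represented by their logarithm w = log z, a global holomorphic coordinate: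
   the point w lies above [cexp w], its modulus is [cmod w], and its argument,
   a real number and not a class mod 2 pi, is [carg w]. *)
Definition cmod (R : realType) (w : R[i]) : R := expR (complex.Re w).
Definition carg (R : realType) (w : R[i]) : R := complex.Im w.

(* exp of the diagonal matrix with diagonal d; in the coordinate w above,
   z^B = expdiag (w *: d) and e^(Bz) = expdiag (cexp w *: d). *)
Definition expdiag (R : realType) (n : nat) (d : 'rV[R[i]]_n) : 'M[R[i]]_n :=
  diag_mx (map_mx (@cexp R) d).

Definition diag_part (R : realType) (n : nat) (M : 'M[R[i]]_n) : 'rV[R[i]]_n :=
  \row_a M a a.

(* A sequence a stands for the formal series sum_k a_k z^(-k). *)
Definition fs_mul (R : realType) (n : nat) (a b : nat -> 'M[R[i]]_n) :
    nat -> 'M[R[i]]_n :=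
  fun k => \sum_(j < k.+1) a j *m b (k - j)%N.

Definition fs_deriv (R : realType) (n : nat) (a : nat -> 'M[R[i]]_n) :
    nat -> 'M[R[i]]_n :=
  fun k => if k is k'.+1 then - (k'%:R *: a k') else 0.

(* Logarithmic derivative Lambda + B z^(-1) of z^B e^(Lambda z), for diagonal
   matrices Lambda and B. *)
Definition fs_exponent (R : realType) (n : nat) (lam b : 'rV[R[i]]_n) :
    nat -> 'M[R[i]]_n :=
  fun k => match k with 0%N => diag_mx lam | 1%N => diag_mx b | _ => 0 end.

(* G (I + sum_(k >= 1) F_k z^(-k)) z^B e^(Lambda z) is a formal solution of
   dY/dz = (sum_k A_k z^(-k)) Y: with H = G F, the factor z^B e^(Lambda z) is
   cancelled on the right of both sides. *)
Definition formal_solution (R : realType) (n : nat) (A : nat -> 'M[R[i]]_n)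
    (G : 'M[R[i]]_n) (lam b : 'rV[R[i]]_n) (F : nat -> 'M[R[i]]_n) : Prop :=
  let H := fun k => G *m F k in
  F 0%N = 1%:M /\
  forall k, fs_deriv H k + fs_mul H (fs_exponent lam b) k = fs_mul A H k.

(* theta is the direction of a Stokes ray of diag(lam) *)
Definition stokes_dir (R : realType) (n : nat) (lam : 'rV[R[i]]_n) (theta : R) :
    Prop :=
  exists a b, lam 0 a != lam 0 b /\
    forall w : R[i], carg w = theta ->
      complex.Re ((lam 0 a - lam 0 b) * cexp w) = 0.

(* theta is one of the arguments of x *)
Definition is_arg (R : realType) (x : R[i]) (theta : R) : Prop :=
  exists2 w : R[i], carg w = theta & cexp w = x.

Section Cells.
Variables (R : realType) (n : nat) (eps0 : R).
Variable u : 'rV[R[i]]_n -> 'rV[R[i]]_n.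
Variable ttau : R.

Definition coalescence : set 'rV[R[i]]_n :=
  [set t | polydisc 0 eps0 t /\ exists a b, a != b /\ u t 0 a = u t 0 b].

Definition crossing : set 'rV[R[i]]_n :=
  [set t | polydisc 0 eps0 t /\
    exists a b, [/\ a != b, u t 0 a != u t 0 b &
      exists k : int,
        is_arg (u t 0 a - u t 0 b) (3 * pi / 2 - ttau + k%:~R * pi)]].

Definition is_cell (c : set 'rV[R[i]]_n) : Prop :=
  let W := polydisc 0 eps0 `\` (coalescence `|` crossing) in
  exists2 t, W t & c = connected_component W t.

(* Sector S_nu(t), meant for t outside [crossing], so that the two boundary
   directions ttau - pi and ttau are not Stokes directions of Lambda(t).  It is
   not bounded on a side where there is no Stokes ray. *)
Definition stokes_sector (t : 'rV[R[i]]_n) : set R[i] :=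
  [set w | (forall theta, stokes_dir (u t) theta -> ttau < theta ->
              carg w < theta) /\
           (forall theta, stokes_dir (u t) theta -> theta < ttau - pi ->
              theta < carg w)].

Definition stokes_sector_on (K : set 'rV[R[i]]_n) : set R[i] :=
  \bigcap_(t in K) stokes_sector t.

End Cells.

(* f(z,t) ~ sum_k F_k(t) z^(-k) as z goes to infinity in the open sector S,
   i.e. in every closed subsector of S, uniformly in t in K. *)
Definition asymptotic_on (R : realType) (n : nat) (K : set 'rV[R[i]]_n)
    (S : set R[i]) (f : R[i] -> 'rV[R[i]]_n -> 'M[R[i]]_n)
    (F : nat -> 'rV[R[i]]_n -> 'M[R[i]]_n) : Prop :=
  forall al be : R, [set w : R[i] | al <= carg w <= be] `<=` S ->
  forall m : nat, exists C M : R, forall (w : R[i]) t,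
    K t -> al <= carg w <= be -> M <= cmod w ->
    `| f w t - \sum_(k < m) (cexp w) ^- k *: F k t | <= (C / cmod w ^+ m)%:C.

(* Y is a fundamental solution of dY/dz = A(z,t) Y, holomorphic in (z,t) for
   |z| >= N and t in D.  In the coordinate w = log z, dY/dw = z dY/dz; the
   equation is written at interior points |z| > N, and extends to |z| = N by
   continuity. *)
Definition fundamental_solution (R : realType) (n : nat)
    (A : R[i] -> 'rV[R[i]]_n -> 'M[R[i]]_n) (N : R) (D : set 'rV[R[i]]_n)
    (Y : R[i] -> 'rV[R[i]]_n -> 'M[R[i]]_n) : Prop :=
  [/\ holomorphic_on [set p : R[i] * 'rV[R[i]]_n | N <= cmod p.1 /\ D p.2]
        (fun p => Y p.1 p.2),
      (forall w t, N < cmod w -> D t ->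
         is_derive w (1 : R[i]) (fun w' => Y w' t)
           (cexp w *: (A (cexp w) t *m Y w t)))
    & (forall w t, N <= cmod w -> D t -> Y w t \in unitmx)].

(* G0(t)^-1 Y(z,t) e^(- Lambda(t) z) z^(- B1(t)) *)
Definition normalized (R : realType) (n : nat) (G0 : 'rV[R[i]]_n -> 'M[R[i]]_n)
    (u b1 : 'rV[R[i]]_n -> 'rV[R[i]]_n)
    (Y : R[i] -> 'rV[R[i]]_n -> 'M[R[i]]_n) :
    R[i] -> 'rV[R[i]]_n -> 'M[R[i]]_n :=
  fun w t => invmx (G0 t) *m Y w t *m expdiag (- (cexp w *: u t))
               *m expdiag (- (w *: b1 t)).

(* Main.v *)
From HB Require Import structures.
Require Import Defs.
From mathcomp Require Import ring lra.
Set Implicit Arguments.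
Unset Strict Implicit.
Unset Printing Implicit Defensive.
Import Order.TTheory GRing.Theory Num.Theory.
Local Open Scope classical_set_scope.
Local Open Scope ring_scope.
Local Open Scope complex_scope.

(* After conjugation by G0 the system has leading term diag (u_1, ..., u_n), and
   Cauchy integrals extend its coefficients holomorphically to an open
   neighbourhood of the polydisc.  Let Phi(z, t) be a fundamental matrix
   holomorphic in (z, t), normalized at a fixed point.  Off Delta and X(ttau) no
   Re ((u_a - u_b) z) vanishes on the rays arg z = ttau and arg z = ttau - pi, so
   there is at most one matrix C(t) for which the normalized Phi C tends to 1
   along both: the conjugate of a ratio of two such matrices by the exponentials
   would tend to 1, while each of its off-diagonal entries grows along one of the
   rays.

   Such a C(t) exists locally, and is holomorphic in t.  A column of the solution
   is sought as a truncated formal column plus a correction; the correction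
   solves integral equations over half-lines along which the exponentials decay,
   and these are contracting on a weighted space of functions holomorphic in a
   region that contains the logarithmic sector near infinity.  By uniqueness the
   local matrices agree, so Y = G0 Phi C is defined and holomorphic over the whole
   cell and extends the given solution.  The same construction, with the formal
   solution truncated at order m and in any closed sector without Stokes rays of
   u(t), gives the asymptotics with constants that are locally uniform in t. *)

(** Holomorphy on a closed domain supplies only some open neighbourhood, and for the system it may
    shrink as z goes to infinity. The system is therefore rebuilt: its Laurent coefficients are
    Cauchy integrals over one circle of radius below [N0], near which compactness gives a uniform
    thickness, and their sum is holomorphic for |z| large and t in one fixed open set. Linearity of
    the eigenvalues provides the leading term [u 0 + t] on that set.

    Gluing by uniqueness replaces continuation along paths, so the topology of the cell never
    enters, and the two rays used are the same for all t although the Stokes rays move. The factors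
    z^B are many-valued, but they are divided out column by column: a normalized column satisfies an
    equation with single-valued coefficients, so the integral equations live in a plane region.

    Local bounds on the F_k come from their recursion and from the gaps between eigenvalues. For the
    error bounds each t can then be treated as a constant family, since the constants of the
    construction depend only on such bounds. *)

Definition nm (R : realType) (V : normedModType R[i]) (v : V) : R :=
  complex.Re `|v|.

(** * Real-valued norms and epsilon-delta differentiability *)

Section Nm.
Variable R : realType.
Local Notation C := R[i].

Section NmV.
Variable V : normedModType C.
Implicit Types (u v w : V).

(** Norms of modules over [R[i]] are themselves elements of [R[i]]. This identity transfers every
    estimate to the ordered field [R], where [lra] and [nra] apply. *)
Lemma nmE v : (nm v)%:C = `|v|.
Proof. by rewrite /nm RRe_real // normr_real. Qed.

Lemma nm_leE v (r : R) : (`|v| <= r%:C) = (nm v <= r).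
Proof. by rewrite -nmE lecR. Qed.

Lemma nm_ltE v (r : R) : (`|v| < r%:C) = (nm v < r).
Proof. by rewrite -nmE ltcR. Qed.

Lemma nm_ge0 v : 0 <= nm v.
Proof. by rewrite -lecR nmE; exact: normr_ge0. Qed.

Lemma nm0 : nm (0 : V) = 0.
Proof. by rewrite /nm normr0. Qed.

Lemma nmN v : nm (- v) = nm v.
Proof. by rewrite /nm normrN. Qed.

Lemma nmB v w : nm (v - w) = nm (w - v).
Proof. by rewrite /nm distrC. Qed.

Lemma nmD v w : nm (v + w) <= nm v + nm w.
Proof. by rewrite -lecR rmorphD /= !nmE ler_normD. Qed.

Lemma nm_tri u v w : nm (u - w) <= nm (u - v) + nm (v - w).
Proof. by rewrite -{1}(subrK v u) -addrA nmD. Qed.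

Lemma nm_eq0 v : (nm v == 0) = (v == 0).
Proof. by rewrite -(inj_eq (@complexI R)) nmE normr_eq0. Qed.

Lemma nm_gt0 v : (0 < nm v) = (v != 0).
Proof. by rewrite lt_def nm_eq0 nm_ge0 andbT. Qed.

Lemma nm_le0 v : (nm v <= 0) = (v == 0).
Proof. by rewrite -nm_eq0 eq_le nm_ge0 andbT. Qed.

Lemma nmBD v w : nm v - nm w <= nm (v - w).
Proof. by rewrite lerBlDr -{1}(subrK w v) nmD. Qed.

Lemma nm_sum (I : Type) (r : seq I) (P : pred I) (F : I -> V) :
  nm (\sum_(i <- r | P i) F i) <= \sum_(i <- r | P i) nm (F i).
Proof.
elim/big_ind2 : _ => [|a b c d h1 h2|//]; first by rewrite nm0.
by apply: le_trans (nmD _ _) _; apply: lerD.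
Qed.
End NmV.

Lemma nmM (x y : C) : nm (x * y) = nm x * nm y.
Proof.
by apply: (@complexI R); rewrite [in RHS]rmorphM /= !nmE normrM.
Qed.

Lemma nmZ (V : normedModType C) (x : C) (v : V) : nm (x *: v) = nm x * nm v.
Proof.
by apply: (@complexI R); rewrite [in RHS]rmorphM /= !nmE normrZ.
Qed.

Lemma nm1 : nm (1 : C) = 1.
Proof. by rewrite /nm normr1. Qed.

Lemma nmX (x : C) k : nm (x ^+ k) = nm x ^+ k.
Proof. by elim: k => [|k IH]; rewrite ?expr0 ?nm1 // !exprS nmM IH. Qed.

Lemma nmV (x : C) : nm (x^-1) = (nm x)^-1.
Proof.
have [->|x0] := eqVneq x 0; first by rewrite !invr0 nm0 invr0.
have h : nm x != 0 by rewrite nm_eq0.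
by apply: (mulfI h); rewrite -nmM !divff // nm1.
Qed.

Lemma nmC (r : R) : nm (r%:C) = `|r|.
Proof.
by rewrite /nm normc_def /= expr0n /= addr0 sqrtr_sqr.
Qed.

Lemma nm_def (x : C) : nm x = Num.sqrt (complex.Re x ^+ 2 + complex.Im x ^+ 2).
Proof. by rewrite /nm normc_def. Qed.

Lemma Re_le_nm (x : C) : `|complex.Re x| <= nm x.
Proof.
rewrite nm_def -sqrtr_sqr ler_wsqrtr // lerDl sqr_ge0 //.
Qed.

Lemma Im_le_nm (x : C) : `|complex.Im x| <= nm x.
Proof.
rewrite nm_def -sqrtr_sqr ler_wsqrtr // lerDr sqr_ge0 //.
Qed.

Lemma nm_le_ReIm (x : C) : nm x <= `|complex.Re x| + `|complex.Im x|.
Proof.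
rewrite nm_def; set a := complex.Re x; set b := complex.Im x.
have h : 0 <= `|a| + `|b| by rewrite addr_ge0.
rewrite -[leRHS]ger0_norm // -sqrtr_sqr ler_wsqrtr // sqrrD.
by rewrite !real_normK ?num_real // addrAC lerDl mulrn_wge0 // mulr_ge0.
Qed.

Lemma nm_half (x : C) : nm (x / 2) = nm x / 2.
Proof.
rewrite nmM nmV; congr (_ * _^-1).
by have := nmC 2; rewrite rmorph_nat => ->; rewrite ger0_norm.
Qed.

Lemma posC (e : C) : 0 < e -> exists2 r : R, 0 < r & e = r%:C.
Proof.
move=> e0; have h : (complex.Re e)%:C = e by rewrite RRe_real // gtr0_real.
by exists (complex.Re e) => //; rewrite -ltcR h.
Qed.

Section Cvg.
Variables (V : normedModType C) (T : Type).

Lemma cvg_nmP (F : set_system T) {FF : Filter F} (f : T -> V) (l : V) :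
  f @ F --> l <-> forall e : R, 0 < e -> \forall x \near F, nm (l - f x) <= e.
Proof.
split=> [/cvgrPdist_le h e e0|h].
  have := h e%:C; rewrite ltcR => /(_ e0).
  by apply: filter_app; near=> x; rewrite nm_leE.
apply/cvgrPdist_le => e /posC[r r0 ->].
by have := h r r0; apply: filter_app; near=> x; rewrite nm_leE.
Unshelve. all: by end_near. Qed.
End Cvg.

Lemma cvgn_nmP (V : normedModType C) (f : nat -> V) (l : V) :
  f @ \oo --> l <-> forall e : R, 0 < e ->
    exists N, forall n, (N <= n)%N -> nm (f n - l) <= e.
Proof.
split=> [/cvg_nmP h e /h [N _ hN]|h].
  by exists N => n /hN; rewrite /= nmB.
apply/cvg_nmP => e /h [N hN]; exists N => // n /hN /=; by rewrite nmB.
Qed.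

Lemma nbhs_nmP (V : normedModType C) (x : V) (A : set V) :
  nbhs x A <-> exists2 e : R, 0 < e & forall y, nm (y - x) < e -> A y.
Proof.
split=> [/nbhs_ballP [e /= /posC[r r0 ->] h]|[e e0 h]].
  exists r => // y hy; apply: h; rewrite -ball_normE /ball_ /=.
  by rewrite nm_ltE nmB.
apply/nbhs_ballP; exists e%:C => /=; first by rewrite ltcR.
by move=> y; rewrite -ball_normE /ball_ /= nm_ltE nmB => /h.
Qed.

Lemma openC_nm (V : normedModType C) (A : set V) :
  open A <-> forall x, A x -> exists2 e : R, 0 < e & forall y, nm (y - x) < e -> A y.
Proof.
rewrite openE; split=> h x /h; first by move=> /nbhs_nmP.
by move=> ?; apply/nbhs_nmP.
Qed.

Lemma cont_nmP (V W : normedModType C) (f : V -> W) x :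
  {for x, continuous f} <->
  forall e : R, 0 < e -> exists2 d : R, 0 < d &
    forall y, nm (y - x) < d -> nm (f y - f x) <= e.
Proof.
split=> [/cvg_nmP h e /h /nbhs_nmP [d d0 hd]|h].
  by exists d => // y /hd; rewrite nmB.
apply/cvg_nmP => e /h [d d0 hd]; apply/nbhs_nmP; exists d => // y /hd.
by rewrite nmB.
Qed.

Lemma cvgC_ReIm (u : nat -> C) (a b : R) :
  (fun n => complex.Re (u n)) @ \oo --> a ->
  (fun n => complex.Im (u n)) @ \oo --> b -> u @ \oo --> (a +i* b).
Proof.
move=> /cvgrPdist_le ha /cvgrPdist_le hb; apply/cvg_nmP => e e0.
have e2 : 0 < e / 2 by rewrite divr_gt0.
have [N _ hN] := ha _ e2; have [M _ hM] := hb _ e2.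
exists (maxn N M) => // n /=; rewrite geq_max => /andP[/hN h1 /hM h2].
apply: le_trans (nm_le_ReIm _) _.
rewrite [e]splitr; apply: lerD; case: (u n) h1 h2 => //=.
Qed.

Lemma cauchyC_cvg (u : nat -> C) :
  (forall e : R, 0 < e -> exists N, forall n, (N <= n)%N -> nm (u n - u N) <= e) ->
  exists l : C, u @ \oo --> l.
Proof.
move=> hu.
have aux (p : C -> R) : (forall x y, `|p x - p y| <= nm (x - y)) ->
    cvgn (fun n => p (u n)).
  move=> hp; apply: cauchy_cvg; apply: cauchy_exP => e e0.
  have e2 : 0 < e / 2 by rewrite divr_gt0.
  have [N hN] := hu _ e2; exists (p (u N)).
  exists N => // n /= hn; rewrite /ball /=.
  apply: le_lt_trans (hp _ _) _; have := hN _ hn; rewrite nmB => h.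
  by apply: le_lt_trans h _; rewrite ltr_pdivrMr // ltr_pMr // ltr1n.
have h1 : cvgn (fun n => complex.Re (u n)).
  by apply: aux => x y; rewrite -raddfB; apply: Re_le_nm.
have h2 : cvgn (fun n => complex.Im (u n)).
  by apply: aux => x y; rewrite -raddfB; apply: Im_le_nm.
by eexists; apply: cvgC_ReIm h1 h2.
Qed.

Lemma cvgC_nm_le (u : nat -> C) l (B : R) :
  u @ \oo --> l -> (forall n, nm (u n) <= B) -> nm l <= B.
Proof.
move=> /cvgn_nmP h hB; apply/ler_addgt0Pr => e /h [N /(_ N (leqnn N)) hN].
have := nm_tri l (u N) 0; rewrite !subr0 nmB => h1.
have := hB N; lra.
Qed.

End Nm.

Section Dif.
Variable R : realType.
Local Notation C := R[i].
Variables V W : normedModType C.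

Lemma dif_eps (f : V -> W) x : differentiable f x ->
  forall e : R, 0 < e -> exists2 d : R, 0 < d &
    forall h, nm h < d -> nm (f (x + h) - f x - 'd f x h) <= e * nm h.
Proof.
move=> /diff_locallyP [_ hf] e e0.
have he : 0 < e%:C by rewrite ltcR.
move: hf => /eqaddoP /(_ _ he) /nbhs_nmP [d d0 hd].
exists d => // h hh; have := hd h; rewrite subr0 => /(_ hh) /=.
rewrite -lecR rmorphM /= !nmE -addrA -opprD [x + h]addrC; exact.
Qed.

Lemma dif_bound (f : V -> W) x : differentiable f x ->
  exists2 B : R, 0 <= B & forall h, nm ('d f x h) <= B * nm h.
Proof.
move=> df; have dc : continuous ('d f x) by apply: diff_continuous.
have := dc 0; move=> /cont_nmP /(_ 1 ltr01) [d d0 hd].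
exists (2 / d) => [|h]; first by rewrite divr_ge0 // ltW.
have [->|h0] := eqVneq h 0; first by rewrite linear0 !nm0 mulr0.
have hh : 0 < nm h by rewrite nm_gt0.
(* Rescaling brings h to norm d / 2, where continuity at 0 bounds the differential by 1; hence the
   constant 2 / d. *)
pose c : C := (d / 2 / nm h)%:C.
have c0 : 0 < d / 2 / nm h by rewrite !divr_gt0.
have := hd (c *: h); rewrite subr0 linear0 subr0 linearZ !nmZ nmC ger0_norm; last exact: ltW.
rewrite divfK ?gt_eqF // ltr_pdivrMr // ltr_pMr // ltr1n => /(_ isT).
rewrite -ler_pdivlMl // mulr1 invf_div => /le_trans; apply.
by rewrite [leLHS]mulrC invf_div.
Qed.

(** [L] is a bare function, packed here as a continuous linear map. This is the form needed when a
    differential is obtained pointwise, as a limit of differentials. *)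
Lemma dif_of_eps (f : V -> W) (L : V -> W) (B : R) x :
  linear L -> (forall h, nm (L h) <= B * nm h) ->
  (forall e : R, 0 < e -> exists2 d : R, 0 < d &
    forall h, nm h < d -> nm (f (x + h) - f x - L h) <= e * nm h) ->
  differentiable f x /\ 'd f x = L :> (V -> W).
Proof.
move=> Llin LB Lf.
pose glM := GRing.isLinear.Build _ _ _ _ _ Llin.
pose gL : {linear V -> W} := HB.pack L glM.
have Lc : continuous gL.
  move=> y; apply/cont_nmP => e e0.
  have B1 : 0 < `|B| + 1 by rewrite ltr_wpDl.
  exists (e / (`|B| + 1)) => [|z hz]; first by rewrite divr_gt0.
  rewrite -linearB /=; apply: le_trans (LB _) _.
  have h1 : B * nm (z - y) <= `|B| * nm (z - y).
    by rewrite ler_wpM2r ?nm_ge0 // ler_norm.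
  apply: le_trans h1 _; move: hz; rewrite ltr_pdivlMr // => hz.
  have := nm_ge0 (z - y); nra.
have hd : f \o shift x = cst (f x) + gL +o_ 0 id.
  apply/eqaddoP => _ /posC[e e0 ->]; have [d d0 hd] := Lf _ e0.
  apply/nbhs_nmP; exists d => // h; rewrite subr0 => /hd.
  rewrite -lecR rmorphM /= !nmE -addrA -opprD [x + h]addrC; exact.
have hdiff := diff_unique Lc hd.
split=> //; apply/diff_locallyP; rewrite hdiff; split=> //.
Qed.

Lemma dif_congr (f g : V -> W) x :
  (exists2 e : R, 0 < e & forall y, nm (y - x) < e -> f y = g y) ->
  differentiable f x -> differentiable g x.
Proof.
move=> [d d0 fg] df; have [B B0 hB] := dif_bound df.
have lin : linear ('d f x) by move=> a u v; rewrite linearP.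
have [|//] := @dif_of_eps g ('d f x) B x lin hB.
move=> e e0; have [d' d0' h] := dif_eps df e0.
exists (Num.min d d') => [|y]; first by rewrite lt_min d0.
rewrite lt_min => /andP[y1 y2]; rewrite -!fg ?subrr ?nm0 //; first exact: h.
by rewrite addrC addKr.
Qed.

End Dif.

Section Deriv1.
Variable R : realType.
Local Notation C := R[i].

Lemma dif_isd (g : C -> C) (x : C) : differentiable g x -> is_derive x (1 : C) g ('d g x 1).
Proof.
move=> dg; split; first exact: diff_derivable.
by rewrite deriveE.
Qed.

Lemma isd_dif (g : C -> C) (x : C) d : is_derive x (1 : C) g d -> differentiable g x.
Proof. by move=> h; apply/derivable1_diffP; apply: ex_derive. Qed.

Lemma isd_val (g : C -> C) (x : C) d : is_derive x (1 : C) g d -> forall h, 'd g x h = d * h.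
Proof.
move=> hd h; have dg := isd_dif hd.
have : 'd g x 1 = d by rewrite -deriveE //; apply: derive_val.
have -> : 'd g x h = 'd g x (h *: (1 : C)) by congr ('d g x _); rewrite -[RHS]/(h * 1) mulr1.
by rewrite linearZ => -> /=; rewrite -[LHS]/(h * d) mulrC.
Qed.

Lemma isd_eps (g : C -> C) (x : C) d : is_derive x (1 : C) g d ->
  forall e : R, 0 < e -> exists2 del : R, 0 < del &
    forall h, nm h < del -> nm (g (x + h) - g x - d * h) <= e * nm h.
Proof.
move=> hd e e0; have [del d0 H] := dif_eps (isd_dif hd) e0.
by exists del => // h /H; rewrite (isd_val hd).
Qed.

Lemma isd_of_eps (g : C -> C) (x : C) d :
  (forall e : R, 0 < e -> exists2 del : R, 0 < del &
    forall h, nm h < del -> nm (g (x + h) - g x - d * h) <= e * nm h) ->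
  is_derive x (1 : C) g d.
Proof.
move=> H; have lin : linear ( *%R d : C -> C).
  by move=> a u v; rewrite mulrDr; congr (_ + _); rewrite mulrCA.
have [|df dE] := @dif_of_eps R C C g _ (nm d) x lin _ H.
  by move=> h; rewrite nmM.
have := dif_isd df; by rewrite dE mulr1.
Qed.

Lemma isd_congr (f g : C -> C) (x : C) d :
  (exists2 e : R, 0 < e & forall y, nm (y - x) < e -> f y = g y) ->
  is_derive x (1 : C) f d -> is_derive x (1 : C) g d.
Proof.
move=> [d1 d10 fg] df; apply: isd_of_eps => e e0.
have [d' d0' h] := isd_eps df e0.
exists (Num.min d1 d') => [|y]; first by rewrite lt_min d10.
rewrite lt_min => /andP[y1 y2]; rewrite -!fg ?subrr ?nm0 //; first exact: h.
by rewrite addrC addKr.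
Qed.

Lemma isd_eq (g : C -> C) (x : C) d d' : is_derive x (1 : C) g d -> d = d' -> is_derive x (1 : C) g d'.
Proof. by move=> h <-. Qed.

Lemma isdM (f g : C -> C) (x : C) a b : is_derive x (1 : C) f a -> is_derive x (1 : C) g b ->
  is_derive x (1 : C) (fun z => f z * g z) (a * g x + f x * b).
Proof.
move=> hf hg; have := is_deriveM hf hg => /isd_eq; apply.
by rewrite addrC; congr (_ + _); rewrite mulrC.
Qed.

Lemma isdD (f g : C -> C) (x : C) a b : is_derive x (1 : C) f a -> is_derive x (1 : C) g b ->
  is_derive x (1 : C) (fun z => f z + g z) (a + b).
Proof. by move=> hf hg; have := is_deriveD hf hg. Qed.

Lemma isdB (f g : C -> C) (x : C) a b : is_derive x (1 : C) f a -> is_derive x (1 : C) g b ->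
  is_derive x (1 : C) (fun z => f z - g z) (a - b).
Proof. by move=> hf hg; have := is_deriveB hf hg. Qed.

Lemma isdN (f : C -> C) (x : C) a : is_derive x (1 : C) f a ->
  is_derive x (1 : C) (fun z => - f z) (- a).
Proof. by move=> hf; have := is_deriveN hf. Qed.

Lemma isd_id (x : C) : is_derive x (1 : C) (fun z : C => z) 1.
Proof. exact: is_derive_id. Qed.

Lemma isd_cst (c x : C) : is_derive x (1 : C) (fun z : C => c) 0.
Proof. exact: is_derive_cst. Qed.

Lemma isdZ (f : C -> C) (x : C) a c : is_derive x (1 : C) f a ->
  is_derive x (1 : C) (fun z => c * f z) (c * a).
Proof.
by move=> hf; have /isd_eq := isdM (isd_cst c x) hf; apply; rewrite mul0r add0r.
Qed.

Lemma isd_comp (f g : C -> C) (x : C) a b : is_derive x (1 : C) g a -> is_derive (g x) (1 : C) f b ->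
  is_derive x (1 : C) (fun z => f (g z)) (b * a).
Proof.
move=> hg hf; have h := differentiable_comp (isd_dif hg) (isd_dif hf).
have := dif_isd h => /isd_eq; apply.
rewrite diff_comp; [|exact: isd_dif hg|exact: isd_dif hf].
by rewrite /= (isd_val hf) (isd_val hg) mulr1.
Qed.

Lemma isd_sum (I : Type) (r : seq I) (f : I -> C -> C) (x : C) (a : I -> C) :
  (forall i, is_derive x (1 : C) (f i) (a i)) ->
  is_derive x (1 : C) (fun z => \sum_(i <- r) f i z) (\sum_(i <- r) a i).
Proof.
move=> H; elim: r => [|i r IH].
  rewrite big_nil (_ : (fun _ => _) = fun=> 0); first exact: isd_cst.
  by apply/funext => z; rewrite big_nil.
rewrite big_cons (_ : (fun _ => _) = fun z => f i z + \sum_(i <- r) f i z).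
  exact: isdD.
by apply/funext => z; rewrite big_cons.
Qed.

Lemma isd_V (x : C) : x != 0 -> is_derive x (1 : C) (fun z : C => z^-1) (- x ^- 2).
Proof.
move=> x0; have hid := isd_id x; split; first exact: (@derivableV _ _ (fun z : C => z)).
rewrite (@deriveV _ _ (fun z : C => z)) // derive_val.
by rewrite /= -[LHS]/(- x ^- 2 * 1) mulr1.
Qed.

Lemma isd_cont (g : C -> C) (x : C) d : is_derive x (1 : C) g d -> {for x, continuous g}.
Proof. by move=> /isd_dif /differentiable_continuous. Qed.

End Deriv1.

(** * The complex exponential *)

Section Cexp.
Variable R : realType.
Local Notation C := R[i].

Lemma real_eps (f : R -> R) (x : R) d : is_derive x (1 : R) f d ->
  forall e : R, 0 < e -> exists2 del : R, 0 < del &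
    forall h, `|h| < del -> `|f (x + h) - f x - d * h| <= e * `|h|.
Proof.
move=> hd e e0; have [hx hv] := hd.
have /derivable_nbhs /eqaddoP /(_ _ e0) /nbhs_ballP [del d0 H] := hx.
exists del => // h hh; have := H h.
rewrite /ball /= sub0r normrN => /(_ hh); rewrite hv /= -addrA -opprD.
move=> HH; have {HH} : `|f (h * 1 + x) - (f x + h * d)| <= e * `|h| := HH.
by rewrite mulr1 [h + x]addrC [h * d]mulrC.
Qed.

Lemma cexp0 : cexp (0 : C) = 1.
Proof. by rewrite /cexp /= expR0 cos0 sin0 mulr1 mulr0. Qed.

Lemma cexpD (a b : C) : cexp (a + b) = cexp a * cexp b.
Proof.
case: a => a1 a2; case: b => b1 b2; rewrite /cexp /= expRD cosD sinD.
by apply/eqP; rewrite eq_complex /=; apply/andP; split; apply/eqP; ring.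
Qed.

Lemma nm_cexp (a : C) : nm (cexp a) = expR (complex.Re a).
Proof.
rewrite nm_def /cexp /= !exprMn -mulrDr cos2Dsin2 mulr1 sqrtr_sqr.
by rewrite ger0_norm // expR_ge0.
Qed.

Lemma cexp_neq0 (a : C) : cexp a != 0.
Proof. by rewrite -nm_gt0 nm_cexp expR_gt0. Qed.

Lemma cexpN (a : C) : cexp (- a) = (cexp a)^-1.
Proof.
by apply: (mulfI (cexp_neq0 a)); rewrite -cexpD subrr cexp0 divff // cexp_neq0.
Qed.

Lemma cexp_real (r : R) : cexp (r%:C) = (expR r)%:C.
Proof. by rewrite /cexp /= cos0 sin0 mulr1 mulr0. Qed.

Lemma cexp_2pi (a : C) : cexp (a + (0 +i* (pi *+ 2))) = cexp a.
Proof.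
rewrite cexpD [X in _ * X](_ : _ = 1) ?mulr1 // /cexp /= expR0 cos2pi sin2pi.
by rewrite mulr1 mulr0.
Qed.

(** The functional equation reduces the claim to the derivative at 0 ([h0]). There the first-order
    expansions of [expR], [cos] and [sin] are multiplied out, and products of small terms are
    absorbed by also requiring |h| below 1 and e / 8. *)
Lemma isd_cexp (x : C) : is_derive x (1 : C) (@cexp R) (cexp x).
Proof.
have h0 : forall e : R, 0 < e -> exists2 del : R, 0 < del &
    forall h : C, nm h < del -> nm (cexp h - 1 - h) <= e * nm h.
  move=> e e0; have e4 : 0 < e / 8 by rewrite divr_gt0.
  have [d1 d10 H1] := real_eps (is_derive_expR (0 : R)) e4.
  have [d2 d20 H2] := real_eps (is_derive_cos (0 : R)) e4.
  have [d3 d30 H3] := real_eps (is_derive_sin (0 : R)) e4.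
  exists (Num.min (Num.min d1 d2) (Num.min d3 (Num.min 1 (e / 8)))) => [|h].
    by rewrite !lt_min d10 d20 d30 ltr01 e4.
  rewrite !lt_min => /andP[/andP[h1 h2] /andP[h3 /andP[h4 h5]]].
  have rh := Re_le_nm h; have ih := Im_le_nm h.
  case: h h1 h2 h3 h4 h5 rh ih => a b /= h1 h2 h3 h4 h5 rh ih.
  have {H1} := H1 a (le_lt_trans rh h1); rewrite add0r expR0 mul1r => H1.
  have {H2} := H2 b (le_lt_trans ih h2); rewrite add0r cos0 sin0 oppr0 mul0r subr0 => H2.
  have {H3} := H3 b (le_lt_trans ih h3); rewrite add0r cos0 sin0 subr0 mul1r => H3.
  set n := nm (a +i* b) in h1 h2 h3 h4 h5 rh ih *.
  apply: le_trans (nm_le_ReIm _) _; rewrite /cexp /= subr0.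
  have n0 : 0 <= n := nm_ge0 _.
  clearbody n.
  have E1 : expR a * cos b - 1 - a =
     (expR a - 1 - a) * cos b + (1 + a) * (cos b - 1) by ring.
  have E2 : expR a * sin b - b =
     (expR a - 1 - a) * sin b + a * sin b + (sin b - b) by ring.
  have cb : `|cos b| <= 1 by rewrite ler_norml cos_geN1 cos_le1.
  have sb : `|sin b| <= 1 by rewrite ler_norml sin_geN1 sin_le1.
  have A1 : `|expR a * cos b - 1 - a| <= e / 8 * n + 2 * (e / 8 * n).
    rewrite E1; apply: le_trans (ler_normD _ _) _; rewrite !normrM.
    have a2 : `|1 + a| <= 2.
      by apply: le_trans (ler_normD _ _) _; rewrite normr1; lra.
    have := ler_pM (normr_ge0 _) (normr_ge0 _) H1 cb.
    have := ler_pM (normr_ge0 _) (normr_ge0 _) a2 H2.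
    have := ler_wpM2l (ltW e4) rh; have := ler_wpM2l (ltW e4) ih; lra.
  have A2 : `|expR a * sin b - b| <= e / 8 * n + 2 * (e / 8 * n) + e / 8 * n.
    rewrite E2; apply: le_trans (ler_normD _ _) _; rewrite lerD //; last first.
      by apply: le_trans H3 _; rewrite ler_wpM2l // ltW.
    apply: le_trans (ler_normD _ _) _; rewrite lerD // normrM.
      rewrite -[leRHS]mulr1 ler_pM //; apply: le_trans H1 _.
      by rewrite ler_wpM2l // ltW.
    have S : `|sin b| <= n + e / 8 * n.
      rewrite -[sin b](subrK b) addrC; apply: le_trans (ler_normD _ _) _.
      rewrite lerD //; apply: le_trans H3 _.
      by rewrite ler_wpM2l // ltW.
    have := ler_pM (normr_ge0 _) (normr_ge0 _) rh S.
    have en : 0 <= e / 8 * n by rewrite mulr_ge0 // ltW.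
    have := ler_wpM2r n0 (ltW h5); have := ler_wpM2r en (ltW h4); lra.
  nra.
apply: isd_of_eps => e e0.
have e1 : 0 < e / nm (cexp x) by rewrite divr_gt0 // nm_cexp expR_gt0.
have [d d0 H] := h0 _ e1; exists d => // h /H hh.
rewrite cexpD -[X in nm (_ - X - _)]mulr1 -!mulrBr nmM.
by rewrite mulrC -ler_pdivlMr ?nm_cexp ?expR_gt0 // -nm_cexp mulrAC.
Qed.

End Cexp.

(** * Path integrals and Goursat's lemma *)

Section Dyadic.
Variable R : realType.
Local Notation C := R[i].

Definition half (k : nat) : R := 2^-1 ^+ k.

Lemma half_gt0 k : 0 < half k.
Proof. by rewrite exprn_gt0 // invr_gt0. Qed.

Lemma halfS k : half k = half k.+1 + half k.+1.
Proof. by rewrite /half exprS; lra. Qed.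

Lemma half_small (d : R) : 0 < d -> exists k, half k < d.
Proof.
move=> d0; have [N _ /(_ N (leqnn N)) h] := near_infty_natSinv_expn_lt (PosNum d0).
by exists N; move: h; rewrite /= div1r /half exprVn.
Qed.

Let inside (p : R * R) (k : nat) : Prop :=
  [/\ 0 <= p.1, p.1 + half k <= 1, 0 <= p.2 & p.2 + half k <= 1].

(** Bisection: [Q x y k] concerns the square with lower left corner (x, y) and side [half k]. If the
    unit square were bad, each bad square would contain a bad quarter; the corners of the nested
    squares increase to a point, and the local hypothesis at that point is contradicted. This takes
    the place of uniform continuity below. *)
Lemma dyadic_induction (Q : R -> R -> nat -> Prop) :
  (forall x y k, Q x y k.+1 -> Q (x + half k.+1) y k.+1 ->
     Q x (y + half k.+1) k.+1 -> Q (x + half k.+1) (y + half k.+1) k.+1 ->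
     Q x y k) ->
  (forall x y, 0 <= x <= 1 -> 0 <= y <= 1 -> exists2 d : R, 0 < d &
     forall x' y' k, inside (x', y') k -> x' <= x <= x' + half k ->
       y' <= y <= y' + half k -> half k < d -> Q x' y' k) ->
  Q 0 0 0%N.
Proof.
move=> Qadd Qloc; apply: contrapT => nQ.
pose bad (p : R * R) k := inside p k /\ ~ Q p.1 p.2 k.
pose nxt (p p' : R * R) k := [/\ p.1 <= p'.1, p'.1 + half k.+1 <= p.1 + half k,
   p.2 <= p'.2 & p'.2 + half k.+1 <= p.2 + half k].
have step : forall pk : (R * R) * nat, exists p', bad pk.1 pk.2 ->
    bad p' pk.2.+1 /\ nxt pk.1 p' pk.2.
  move=> [[x y] k]; rewrite /=.
  case: (pselect (bad (x, y) k)) => [[[/= x0 x1 y0 y1] /= hb]|hb]; last by exists (0, 0).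
  have h1 := half_gt0 k.+1; have h2 := halfS k.
  apply: contrapT => hn; apply: hb; apply: Qadd; apply: contrapT => hq; apply: hn.
  - by exists (x, y) => _; split; split=> //=; [split=> /=; lra|lra|lra].
  - by exists (x + half k.+1, y) => _; split; split=> //=; [split=> /=; lra|lra|lra|lra].
  - by exists (x, y + half k.+1) => _; split; split=> //=; [split=> /=; lra|lra|lra|lra].
  - by exists (x + half k.+1, y + half k.+1) => _; split; split=> //=; [split=> /=; lra|lra|lra|lra|lra].
have [F hF] := choice step.
pose p := fix p k := if k is k'.+1 then F (p k', k') else (0, 0) : R * R.
have bp : forall k, bad (p k) k.
  elim=> [|k IH]; last by have [] := hF (p k, k) IH.
  by split=> //; split=> /=; rewrite /half ?expr0 ?add0r.
have np k : nxt (p k) (p k.+1) k by have [] := hF (p k, k) (bp k).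
have aux (c : R * R -> R) : (forall k, c (p k) <= c (p k.+1)) ->
   (forall k, c (p k.+1) + half k.+1 <= c (p k) + half k) ->
   (forall k, 0 <= c (p k)) -> (forall k, c (p k) + half k <= 1) ->
   exists s, (0 <= s <= 1) /\ forall k, c (p k) <= s <= c (p k) + half k.
  move=> c1 c2 c3 c4.
  have mon j k : (j <= k)%N -> c (p j) <= c (p k) /\ c (p k) + half k <= c (p j) + half j.
    elim: k => [|k IH]; first by rewrite leqn0 => /eqP ->.
    rewrite leq_eqVlt => /orP[/eqP -> //|/IH [i1 i2]].
    by split; [apply: le_trans (c1 k)|apply: le_trans (c2 k) i2].
  have ub j k : c (p k) <= c (p j) + half j.
    have := half_gt0 j; have := half_gt0 k.
    by case: (leqP j k) => [/mon|/ltnW/mon] [? ?]; lra.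
  pose E := [set c (p k) | k in setT].
  have hE : has_sup E by split; [exists (c (p 0%N)), 0%N|exists (c (p 0%N) + half 0) => _ [k _ <-]].
  exists (sup E).
  have h1 k : c (p k) <= sup E by apply: ub_le_sup; [case: hE|exists k].
  have h2 k : sup E <= c (p k) + half k.
    by apply: ge_sup; [case: hE|move=> _ [j _ <-]].
  split=> [|k]; last by rewrite h1 h2.
  by rewrite (le_trans (c3 0%N) (h1 0%N)) (le_trans (h2 0%N) (c4 0%N)).
have [k|k|k|k|sx [sx1 sx2]] := aux fst; [by case: (np k)|by case: (np k)|by case: (bp k) => [[]]|by case: (bp k) => [[]]|].
have [k|k|k|k|sy [sy1 sy2]] := aux snd; [by case: (np k)|by case: (np k)|by case: (bp k) => [[]]|by case: (bp k) => [[]]|].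
have [d d0 hd] := Qloc sx sy sx1 sy1.
have [k hk] := half_small d0.
have [ik nk] := bp k; apply: nk; apply: hd => //.
Qed.

Lemma dyadic_induction1 (Q : R -> nat -> Prop) :
  (forall x k, Q x k.+1 -> Q (x + half k.+1) k.+1 -> Q x k) ->
  (forall x, 0 <= x <= 1 -> exists2 d : R, 0 < d &
     forall x' k, 0 <= x' -> x' + half k <= 1 -> x' <= x <= x' + half k ->
       half k < d -> Q x' k) ->
  Q 0 0%N.
Proof.
move=> Qadd Qloc; apply: (@dyadic_induction (fun x _ k => Q x k)) => [x _ k h1 h2 _ _|x y hx _].
  exact: Qadd.
by have [d d0 H] := Qloc x hx; exists d => // x' y' k [/= *]; apply: H.
Qed.

End Dyadic.

Section Segment.
Variable R : realType.
Local Notation C := R[i].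
Implicit Types (a h p : C) (f g : C -> C).

(* Left Riemann sums with [2 ^ n] points over the oriented segment from [a] to [a + h]. *)
Fixpoint rs n a h f : C :=
  if n is n'.+1 then rs n' a (h / 2) f + rs n' (a + h / 2) (h / 2) f
  else h * f a.

Definition seg a h : set C :=
  [set z | exists2 s : R, 0 <= s <= 1 & z = a + s%:C * h].

Lemma seg_start a h : seg a h a.
Proof. by exists 0; rewrite ?lexx ?ler01 //= mul0r addr0. Qed.

Lemma seg_end a h : seg a h (a + h).
Proof. by exists 1; rewrite ?lexx ?ler01 //= mul1r. Qed.

Lemma two_neq0 : (2 : C) != 0.
Proof. by rewrite pnatr_eq0. Qed.

Lemma seg_left a h : seg a (h / 2) `<=` seg a h.
Proof.
move=> z [s /andP[s0 s1] ->]; exists (s / 2); first by apply/andP; split; lra.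
by rewrite rmorphM /= fmorphV rmorph_nat; ring.
Qed.

Lemma seg_right a h : seg (a + h / 2) (h / 2) `<=` seg a h.
Proof.
move=> z [s /andP[s0 s1] ->]; exists ((s + 1) / 2); first by apply/andP; split; lra.
rewrite rmorphM rmorphD /= fmorphV rmorph_nat.
by have := two_neq0 => ?; field.
Qed.

Lemma rs_cst n a h c : rs n a h (fun=> c) = h * c.
Proof.
elim: n a h => //= n IH a h; rewrite !IH; have := two_neq0 => ?; by field.
Qed.

Lemma rsD n a h f g : rs n a h (fun z => f z + g z) = rs n a h f + rs n a h g.
Proof. by elim: n a h => [|n IH] a h /=; rewrite ?mulrDr // !IH addrACA. Qed.

Lemma rsZ n a h c f : rs n a h (fun z => c * f z) = c * rs n a h f.
Proof. by elim: n a h => [|n IH] a h /=; [ring|rewrite !IH mulrDr]. Qed.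

Lemma rs_ext n a h f g : (forall z, seg a h z -> f z = g z) ->
  rs n a h f = rs n a h g.
Proof.
elim: n a h => [|n IH] a h H /=; first by rewrite H //; exact: seg_start.
by congr (_ + _); apply: IH => z hz; apply: H; [apply: seg_left|apply: seg_right].
Qed.

Lemma rs_shift n a h b f : rs n (a + b) h f = rs n a h (fun z => f (z + b)).
Proof. by elim: n a h => [|n IH] a h //=; rewrite -!IH addrAC. Qed.

Lemma rs_le n a h f (B : R) : (forall z, seg a h z -> nm (f z) <= B) ->
  nm (rs n a h f) <= B * nm h.
Proof.
elim: n a h => [|n IH] a h H /=.
  by rewrite nmM mulrC ler_wpM2r ?nm_ge0 // H //; exact: seg_start.
apply: le_trans (nmD _ _) _.
have h1 := IH a (h / 2) (fun z hz => H z (seg_left hz)).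
have h2 := IH _ (h / 2) (fun z hz => H z (seg_right hz)).
by move: h1 h2; rewrite nm_half; lra.
Qed.

Lemma rs_osc n a h f c (e : R) : (forall z, seg a h z -> nm (f z - c) <= e) ->
  nm (rs n a h f - h * c) <= e * nm h.
Proof.
move=> H; have := rs_le n H.
rewrite (_ : (fun z => f z - c) = fun z => f z + (fun=> - c) z) //.
by rewrite rsD rs_cst mulrN.
Qed.

(** The limit exists under [seg_cont]; otherwise [lim] returns a default value. *)
Definition pint a h f : C := lim ((fun n => rs n a h f) @ \oo).

Definition seg_cont a h f := forall z, seg a h z -> {for z, continuous f}.

Lemma sub_seg a h (x : R) n : 0 <= x -> x + half R n <= 1 ->
  seg (a + x%:C * h) ((half R n)%:C * h) `<=` seg a h.
Proof.
move=> x0 x1 z [s /andP[s0 s1] ->]; exists (x + s * half R n).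
  have := half_gt0 R n => h0; apply/andP; split; nra.
by rewrite rmorphD rmorphM /=; ring.
Qed.

Lemma seg_dist a h z z' : seg a h z -> seg a h z' -> nm (z - z') <= nm h.
Proof.
move=> [s /andP[s0 s1] ->] [t /andP[t0 t1] ->].
have -> : a + s%:C * h - (a + t%:C * h) = (s - t)%:C * h.
  by rewrite rmorphB /=; ring.
rewrite nmM nmC -[leRHS]mul1r ler_wpM2r ?nm_ge0 // ler_norml; lra.
Qed.

Lemma halfC n : (half R n)%:C / 2 = (half R n.+1)%:C :> C.
Proof. by rewrite /half exprS rmorphM /= fmorphV rmorph_nat mulrC. Qed.

(** The number e is an error budget shared out in proportion to length: local estimates proportional
    to the length of the segment add up to a global one. *)
Lemma seg_induction a h (Q : C -> C -> R -> Prop) (e : R) :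
  (forall a h e, Q a (h / 2) (e / 2) -> Q (a + h / 2) (h / 2) (e / 2) -> Q a h e) ->
  (forall p, seg a h p -> exists2 d : R, 0 < d &
     forall a' (x : R), 0 <= x -> nm (x%:C * h) < d -> seg a' (x%:C * h) p ->
       seg a' (x%:C * h) `<=` seg a h -> Q a' (x%:C * h) (x * e)) ->
  Q a h e.
Proof.
move=> Qadd Qloc.
pose Q' x k := Q (a + x%:C * h) ((half R k)%:C * h) (half R k * e).
suff : Q' 0 0%N by rewrite /Q' /half !expr0 mul0r addr0 !mul1r.
apply: dyadic_induction1.
- move=> x k; have E : half R k.+1 = half R k / 2 by rewrite (halfS R k); lra.
  rewrite /Q' rmorphD /= -halfC E => h1 h2; apply: Qadd.
    by move: h1; congr (Q _ _ _); ring.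
  by move: h2; congr (Q _ _ _); ring.
- move=> x x01; have [|d d0 H] := Qloc (a + x%:C * h); first by exists x.
  exists (d / (nm h + 1)) => [|x' k x0 x1 xx hk].
    by rewrite divr_gt0 // ltr_wpDl // nm_ge0.
  have hk0 := half_gt0 R k.
  apply: H => //; first exact: ltW; last exact: sub_seg.
    rewrite nmM nmC ger0_norm; last exact: ltW.
    move: hk; rewrite ltr_pdivlMr ?ltr_wpDl ?nm_ge0 //; apply: le_lt_trans.
    by rewrite ler_wpM2l ?lerDl // ltW.
  exists ((x - x') / half R k).
    by rewrite divr_ge0 ?ler_pdivrMr //=; lra.
  rewrite mulrA -rmorphM /= divfK ?gt_eqF // rmorphB /=; ring.
Qed.

Lemma rs_cauchy a h f : seg_cont a h f -> forall e : R, 0 < e ->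
  exists N, forall n m, (N <= n)%N -> (N <= m)%N ->
    nm (rs n a h f - rs m a h f) <= e.
Proof.
move=> cf e e0.
pose Q a' h' e' := exists N, forall n m, (N <= n)%N -> (N <= m)%N ->
    nm (rs n a' h' f - rs m a' h' f) <= e'.
apply: (@seg_induction a h Q) => [a' h' e' [N HN] [M HM]|p hp].
  exists (maxn N M).+1 => -[//|n] [//|m]; rewrite !ltnS !geq_max.
  move=> /andP[n1 n2] /andP[m1 m2] /=.
  rewrite opprD addrACA [e']splitr.
  by apply: le_trans (nmD _ _) _; rewrite lerD // ?HN ?HM.
have k1 : 0 < 2 * (nm h + 1) by rewrite mulr_gt0 // ltr_wpDl // nm_ge0.
(* Two Riemann sums over a piece of length x |h| differ by at most twice the oscillation B times
   that length, which must stay within the share x e. *)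
have [B B0 eB] : exists2 B, 0 < B & e = B * (2 * (nm h + 1)).
  by exists (e / (2 * (nm h + 1))); rewrite ?divfK ?gt_eqF // divr_gt0.
have /cont_nmP /(_ _ B0) [d d0 hd] := cf p hp.
exists d => // a' x x0 xd hp' sub; exists 0%N => n m _ _.
have osc z : seg a' (x%:C * h) z -> nm (f z - f p) <= B.
  by move=> hz; apply: hd; apply: le_lt_trans (seg_dist hz hp') xd.
have := rs_osc n osc; have := rs_osc m osc; rewrite nmB => h1 h2.
apply: le_trans (nm_tri _ (x%:C * h * f p) _) _.
apply: le_trans (lerD h2 h1) _; rewrite nmM nmC ger0_norm //.
have := nm_ge0 h; have : 0 <= x * B by rewrite mulr_ge0 // ltW.
rewrite eB; nra.
Qed.

Lemma pint_cvg a h f : seg_cont a h f -> (fun n => rs n a h f) @ \oo --> pint a h f.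
Proof.
move=> cf; have [|l hl] := @cauchyC_cvg R (fun n => rs n a h f).
  by move=> e /(rs_cauchy cf) [N HN]; exists N => n hn; apply: HN.
by rewrite /pint; move/cvgP: (hl).
Qed.

End Segment.

Section Pint.
Variable R : realType.
Local Notation C := R[i].
Implicit Types (a h p : C) (f g : C -> C).

Lemma pint_unique a h f l : (fun n => rs n a h f) @ \oo --> l -> pint a h f = l.
Proof. by move=> hl; apply: cvg_lim. Qed.

Lemma pint_le a h f (B : R) : seg_cont a h f ->
  (forall z, seg a h z -> nm (f z) <= B) -> nm (pint a h f) <= B * nm h.
Proof.
by move=> cf H; apply: (cvgC_nm_le (pint_cvg cf)) => n; apply: rs_le.
Qed.

Lemma pint_osc a h f c (e : R) : seg_cont a h f ->
  (forall z, seg a h z -> nm (f z - c) <= e) ->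
  nm (pint a h f - h * c) <= e * nm h.
Proof.
move=> cf H; apply: (@cvgC_nm_le _ (fun n => rs n a h f - h * c)) => [|n].
  by apply: cvgB (pint_cvg cf) (cvg_cst _).
exact: rs_osc.
Qed.

Lemma seg_contD a h f g : seg_cont a h f -> seg_cont a h g ->
  seg_cont a h (fun z => f z + g z).
Proof. by move=> cf cg z hz; exact: cvgD (cf z hz) (cg z hz). Qed.

Lemma seg_contZ a h f c : seg_cont a h f -> seg_cont a h (fun z => c * f z).
Proof. by move=> cf z hz; exact: cvgM (cvg_cst c) (cf z hz). Qed.

Lemma pintD a h f g : seg_cont a h f -> seg_cont a h g ->
  pint a h (fun z => f z + g z) = pint a h f + pint a h g.
Proof.
move=> cf cg; apply: pint_unique.
under eq_fun do rewrite rsD.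
exact: cvgD (pint_cvg cf) (pint_cvg cg).
Qed.

Lemma pintZ a h f c : seg_cont a h f ->
  pint a h (fun z => c * f z) = c * pint a h f.
Proof.
move=> cf; apply: pint_unique.
under eq_fun do rewrite rsZ.
exact: cvgM (cvg_cst c) (pint_cvg cf).
Qed.

Lemma pint_ext a h f g : (forall z, seg a h z -> f z = g z) ->
  pint a h f = pint a h g.
Proof.
by move=> H; rewrite /pint; under eq_fun do rewrite (rs_ext _ H).
Qed.

Lemma pint_shift a h b f : pint (a + b) h f = pint a h (fun z => f (z + b)).
Proof. by rewrite /pint; under eq_fun do rewrite rs_shift. Qed.

Lemma pint_half a h f : seg_cont a h f ->
  pint a h f = pint a (h / 2) f + pint (a + h / 2) (h / 2) f.
Proof.
move=> cf; apply: pint_unique; rewrite -(cvg_shiftS _).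
have c1 : seg_cont a (h / 2) f by move=> z /seg_left; apply: cf.
have c2 : seg_cont (a + h / 2) (h / 2) f by move=> z /seg_right; apply: cf.
exact: cvgD (pint_cvg c1) (pint_cvg c2).
Qed.

(** The point of differentiability may lie anywhere on the segment; the increment is split there,
    and the two halves cost the factor 2. *)
Lemma straddle g (p d : C) (e del : R) : 0 <= e ->
  (forall h, nm h < del -> nm (g (p + h) - g p - d * h) <= e * nm h) ->
  forall a h, seg a h p -> nm h < del ->
  nm (g (a + h) - g a - d * h) <= 2 * e * nm h.
Proof.
move=> e0 H a h hp hh.
have h1 := seg_dist (seg_end a h) hp; have h2 := seg_dist (seg_start a h) hp.
have := H _ (le_lt_trans h1 hh); have := H _ (le_lt_trans h2 hh).
rewrite !(addrC p) !subrK => H2 H1.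
have -> : g (a + h) - g a - d * h = (g (a + h) - g p - d * (a + h - p)) -
    (g a - g p - d * (a - p)) by ring.
apply: le_trans (nmD _ _) _; rewrite nmN.
have := ler_wpM2l e0 h1; have := ler_wpM2l e0 h2; lra.
Qed.

Lemma small_le (x : R) K : 0 <= K -> (forall e : R, 0 < e -> x <= e * K) -> x <= 0.
Proof.
move=> K0 H; rewrite leNgt; apply/negP => x0.
have K1 : 0 < K + 1 by rewrite ltr_wpDl.
have := H (x / (2 * (K + 1))); rewrite divr_gt0 ?mulr_gt0 // => /(_ isT).
rewrite mulrAC ler_pdivlMr ?mulr_gt0 //; nra.
Qed.

Lemma nm_small_eq0 (V : normedModType C) (v : V) K : 0 <= K ->
  (forall e : R, 0 < e -> nm v <= e * K) -> v = 0.
Proof. by move=> K0 /(small_le K0); rewrite nm_le0 => /eqP. Qed.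

(** Both sides are additive under bisection, and on a short segment both are within a multiple of e
    times its length of g'(p) times the increment: e from the oscillation of g', 2 e from
    [straddle]. *)
Lemma pint_deriv g g' a h : (forall z, seg a h z -> is_derive z (1 : C) g (g' z)) ->
  seg_cont a h g' -> pint a h g' = g (a + h) - g a.
Proof.
move=> dg cg; apply/subr0_eq; apply: (@nm_small_eq0 _ _ (3 * nm h)).
  by rewrite mulr_ge0 // nm_ge0.
move=> e e0.
pose Q a' h' e' := seg a' h' `<=` seg a h ->
  nm (pint a' h' g' - (g (a' + h') - g a')) <= e'.
suff : Q a h (e * (3 * nm h)) by apply.
apply: seg_induction => [a' h' e' H1 H2 sub|p hp].
  rewrite pint_half; last by move=> z /sub; apply: cg.
  have -> : g (a' + h') - g a' = (g (a' + h' / 2) - g a') +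
      (g (a' + h' / 2 + h' / 2) - g (a' + h' / 2)).
    have -> : a' + h' / 2 + h' / 2 = a' + h'.
      by have := two_neq0 R => ?; field.
    by ring.
  rewrite opprD addrACA; apply: le_trans (nmD _ _) _; rewrite [leRHS]splitr.
  by apply: lerD; [apply: H1 => z /seg_left /sub|apply: H2 => z /seg_right /sub].
have /cont_nmP /(_ _ e0) [d1 d10 H1] := cg p hp.
have [d2 d20 H2] := isd_eps (dg p hp) e0.
exists (Num.min d1 d2) => [|a' x x0]; first by rewrite lt_min d10.
rewrite lt_min => /andP[x1 x2] hp' _ sub.
have A1 : nm (pint a' (x%:C * h) g' - x%:C * h * g' p) <= e * nm (x%:C * h).
  apply: pint_osc => z hz; first by apply: cg; apply: sub.
  by apply: H1; apply: le_lt_trans (seg_dist hz hp') x1.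
have A2 := straddle (ltW e0) H2 hp' x2.
apply: le_trans (nm_tri _ (x%:C * h * g' p) _) _.
rewrite [X in _ + X]nmB [x%:C * h * g' p]mulrC.
rewrite [x%:C * h * g' p]mulrC in A1.
apply: le_trans (lerD A1 A2) _; rewrite nmM nmC ger0_norm //.
by rewrite le_eqVlt; apply/orP; left; apply/eqP; ring.
Qed.

(** Proved by bisection and not by integrating g', because continuity of the derivative is obtained
    later, as a consequence of this bound. *)
Lemma mean_value g g' a h (B : R) :
  (forall z, seg a h z -> is_derive z (1 : C) g (g' z)) ->
  (forall z, seg a h z -> nm (g' z) <= B) -> nm (g (a + h) - g a) <= B * nm h.
Proof.
move=> dg Bg; suff : nm (g (a + h) - g a) - B * nm h <= 0 by rewrite subr_le0.
apply: (@small_le _ (2 * nm h)) => [|e e0]; first by rewrite mulr_ge0 // nm_ge0.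
rewrite lerBlDl.
pose Q a' h' e' := seg a' h' `<=` seg a h ->
  nm (g (a' + h') - g a') <= e'.
suff : Q a h (B * nm h + e * (2 * nm h)) by apply.
apply: seg_induction => [a' h' e' H1 H2 sub|p hp].
  have -> : g (a' + h') - g a' = (g (a' + h' / 2) - g a') +
      (g (a' + h' / 2 + h' / 2) - g (a' + h' / 2)).
    have -> : a' + h' / 2 + h' / 2 = a' + h'.
      by have := two_neq0 R => ?; field.
    by ring.
  apply: le_trans (nmD _ _) _; rewrite [leRHS]splitr.
  by apply: lerD; [apply: H1 => z /seg_left /sub|apply: H2 => z /seg_right /sub].
have [d2 d20 H2] := isd_eps (dg p hp) e0.
exists d2 => // a' x x0 x2 hp' _ sub.
have A2 := straddle (ltW e0) H2 hp' x2.
have A3 := Bg p hp.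
rewrite -[g _ - g _](subrK (g' p * (x%:C * h))).
apply: le_trans (nmD _ _) _; apply: le_trans (lerD A2 (lexx _)) _.
rewrite !nmM nmC ger0_norm //.
have := ler_wpM2r (mulr_ge0 x0 (nm_ge0 h)) A3; lra.
Qed.

Definition loop a h (k : C) f :=
  pint a h f + pint (a + h) k f - pint (a + k) h f - pint a k f.

Definition para a h (k : C) : set C :=
  [set z | exists s t : R, [/\ 0 <= s <= 1, 0 <= t <= 1 & z = a + s%:C * h + t%:C * k]].

Lemma para_seg a h k (s0 s1 t0 t1 : R) : 0 <= s0 -> 0 <= t0 ->
  0 <= s1 -> 0 <= t1 -> s0 + s1 <= 1 -> t0 + t1 <= 1 ->
  seg (a + s0%:C * h + t0%:C * k) (s1%:C * h + t1%:C * k) `<=` para a h k.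
Proof.
move=> a1 b1 c0 d0 c2 d2 z [s /andP[s0' s1'] ->].
exists (s0 + s * s1), (t0 + s * t1).
have h1 : 0 <= s * s1 <= s1 by rewrite mulr_ge0 //= ler_piMl.
have h2 : 0 <= s * t1 <= t1 by rewrite mulr_ge0 //= ler_piMl.
split; last by rewrite !rmorphD !rmorphM /=; ring.
  by clear -a1 h1 c2; lra.
by clear -b1 h2 d2; lra.
Qed.

Lemma para_seg1 a h k (x y s : R) : 0 <= x -> 0 <= y -> 0 <= s -> x + s <= 1 ->
  y <= 1 -> seg (a + x%:C * h + y%:C * k) (s%:C * h) `<=` para a h k.
Proof.
move=> *; rewrite -[s%:C * h]addr0 -(mul0r k).
by apply: para_seg => //; rewrite addr0.
Qed.

Lemma para_seg2 a h k (x y s : R) : 0 <= x -> 0 <= y -> 0 <= s -> y + s <= 1 ->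
  x <= 1 -> seg (a + x%:C * h + y%:C * k) (s%:C * k) `<=` para a h k.
Proof.
move=> *; rewrite -[s%:C * k]add0r -(mul0r h).
by apply: para_seg => //; rewrite addr0.
Qed.

Lemma pint_affine a h (c d : C) :
  pint a h (fun z => c + d * z) = c * h + d * (a * h + h * h / 2).
Proof.
have H1 z : seg a h z -> is_derive z (1 : C) (fun z => c * z + d / 2 * (z * z)) (c + d * z).
  move=> _; have := isdD (isdZ c (isd_id z)) (isdZ (d / 2) (isdM (isd_id z) (isd_id z))).
  by move=> /isd_eq; apply; have := two_neq0 R => ?; field.
have H2 : seg_cont a h (fun z => c + d * z).
  move=> z _; exact: (isd_cont (isdD (isd_cst c z) (isdZ d (isd_id z)))).
by rewrite (pint_deriv H1 H2); have := two_neq0 R => ?; field.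
Qed.

Lemma loop_affine a h k (c d : C) : loop a h k (fun z => c + d * z) = 0.
Proof. by rewrite /loop !pint_affine; have := two_neq0 R => ?; field. Qed.

Lemma loop_split a h k f : (forall z, para a h k z -> {for z, continuous f}) ->
  loop a h k f = loop a (h / 2) (k / 2) f + loop (a + h / 2) (h / 2) (k / 2) f +
   loop (a + k / 2) (h / 2) (k / 2) f + loop (a + h / 2 + k / 2) (h / 2) (k / 2) f.
Proof.
move=> cf; rewrite /loop.
have E (b q : C) : seg b q `<=` para a h k ->
    pint b q f = pint b (q / 2) f + pint (b + q / 2) (q / 2) f.
  by move=> sub; apply: pint_half => z /sub; apply: cf.
have e2 (z : C) : z / 2 + z / 2 = z by have := two_neq0 R => ?; field.
have c0 : 0 <= (0 : R) by [].
have c1 : (1 : R) <= 1 by [].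
have s1 : seg a h `<=` para a h k.
  by move: (@para_seg1 a h k 0 0 1); rewrite !mul0r !addr0 mul1r add0r; apply.
have s2 : seg (a + h) k `<=` para a h k.
  by move: (@para_seg2 a h k 1 0 1); rewrite !mul0r !addr0 !mul1r add0r; apply.
have s3 : seg (a + k) h `<=` para a h k.
  by move: (@para_seg1 a h k 0 1 1); rewrite !mul0r !addr0 !mul1r add0r; apply.
have s4 : seg a k `<=` para a h k.
  by move: (@para_seg2 a h k 0 0 1); rewrite !mul0r !addr0 mul1r add0r; apply.
rewrite (E _ _ s1) (E _ _ s2) (E _ _ s3) (E _ _ s4).
have -> : a + h / 2 + k / 2 + h / 2 = a + h + k / 2 by clear; have := two_neq0 R => ?; field.
have -> : a + h / 2 + k / 2 + k / 2 = a + k + h / 2 by clear; have := two_neq0 R => ?; field.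
have -> : a + h / 2 + h / 2 = a + h by clear; have := two_neq0 R => ?; field.
have -> : a + k / 2 + k / 2 = a + k by clear; have := two_neq0 R => ?; field.
rewrite (addrAC a (k / 2) (h / 2)); ring.
Qed.

Lemma para_edge_dist a h k (z p : C) : para a h k z -> para a h k p ->
  nm (z - p) <= nm h + nm k.
Proof.
move=> [s [t [/andP[s0 s1] /andP[t0 t1] ->]]] [s' [t' [/andP[s0' s1'] /andP[t0' t1'] ->]]].
have -> : a + s%:C * h + t%:C * k - (a + s'%:C * h + t'%:C * k) =
  (s - s')%:C * h + (t - t')%:C * k by rewrite !rmorphB /=; ring.
apply: le_trans (nmD _ _) _; rewrite !nmM !nmC.
apply: lerD; rewrite -[leRHS]mul1r; apply: ler_wpM2r; rewrite ?nm_ge0 // ler_norml.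
  by clear -s0 s1 s0' s1'; lra.
by clear -t0 t1 t0' t1'; lra.
Qed.

(** The affine part integrates to 0 around the parallelogram, so only the deviation from it counts,
    multiplied by the perimeter 2 (|h| + |k|). *)
Lemma loop_small a h k f (p d : C) (e : R) :
  (forall z, para a h k z -> {for z, continuous f}) -> 0 <= e ->
  (forall z, para a h k z -> nm (f z - (f p + d * (z - p))) <= e * (nm h + nm k)) ->
  nm (loop a h k f) <= 2 * e * (nm h + nm k) ^+ 2.
Proof.
move=> cf e0 H; pose c := f p - d * p; pose r z := f z - (c + d * z).
have caff (b q : C) : seg_cont b q (fun z => c + d * z).
  move=> z _; exact: (isd_cont (isdD (isd_cst c z) (isdZ d (isd_id z)))).
have edge (b q : C) : seg b q `<=` para a h k ->
    exists2 E, pint b q f = pint b q (fun z => c + d * z) + E &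
      nm E <= e * (nm h + nm k) * nm q.
  move=> sub.
  have cr : seg_cont b q r.
    by move=> z hz; exact: cvgB (cf _ (sub z hz)) (caff b q z hz).
  exists (pint b q r).
    rewrite -(pintD (caff b q) cr); apply: pint_ext => z _.
    by rewrite /r addrC subrK.
  apply: pint_le => // z /sub /H; congr (nm _ <= _).
  by rewrite /r /c; ring.
have c0 : 0 <= (0 : R) by [].
have c1 : (1 : R) <= 1 by [].
have s1 : seg a h `<=` para a h k.
  by move: (@para_seg1 a h k 0 0 1); rewrite !mul0r !addr0 mul1r add0r; apply.
have s2 : seg (a + h) k `<=` para a h k.
  by move: (@para_seg2 a h k 1 0 1); rewrite !mul0r !addr0 !mul1r add0r; apply.
have s3 : seg (a + k) h `<=` para a h k.
  by move: (@para_seg1 a h k 0 1 1); rewrite !mul0r !addr0 !mul1r add0r; apply.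
have s4 : seg a k `<=` para a h k.
  by move: (@para_seg2 a h k 0 0 1); rewrite !mul0r !addr0 mul1r add0r; apply.
have [E1 P1 N1] := edge _ _ s1; have [E2 P2 N2] := edge _ _ s2.
have [E3 P3 N3] := edge _ _ s3; have [E4 P4 N4] := edge _ _ s4.
have := loop_affine a h k c d; rewrite /loop P1 P2 P3 P4.
clear -N1 N2 N3 N4.
set p1 := pint _ _ _; set p2 := pint _ _ _; set p3 := pint _ _ _; set p4 := pint _ _ _.
move=> L.
have -> : p1 + E1 + (p2 + E2) - (p3 + E3) - (p4 + E4) = E1 + E2 - E3 - E4.
  by rewrite -[RHS]add0r -L; ring.
apply: le_trans (nmD _ _) _; apply: le_trans (lerD (nmD _ _) (lexx _)) _.
apply: le_trans (lerD (lerD (nmD _ _) (lexx _)) (lexx _)) _; rewrite !nmN.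
apply: le_trans (lerD (lerD (lerD N1 N2) N3) N4) _.
rewrite le_eqVlt; apply/orP; left; apply/eqP; ring.
Qed.

Lemma sub_para a h k (x y : R) n : 0 <= x -> 0 <= y ->
  x + half R n <= 1 -> y + half R n <= 1 ->
  para (a + x%:C * h + y%:C * k) ((half R n)%:C * h) ((half R n)%:C * k) `<=` para a h k.
Proof.
move=> x0 y0 x1 y1 z [s [t [/andP[s0 s1] /andP[t0 t1] ->]]].
exists (x + s * half R n), (y + t * half R n).
have n0 := half_gt0 R n.
have h1 : 0 <= s * half R n <= half R n by rewrite mulr_ge0 ?(ltW n0) //= ler_piMl // ltW.
have h2 : 0 <= t * half R n <= half R n by rewrite mulr_ge0 ?(ltW n0) //= ler_piMl // ltW.
split; last by rewrite !rmorphD !rmorphM /=; ring.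
  by clear -x0 x1 h1; lra.
by clear -y0 y1 h2; lra.
Qed.

Lemma goursat a h k f : (forall z, para a h k z -> differentiable f z) ->
  loop a h k f = 0.
Proof.
move=> df.
have [S SE] : exists S, S = nm h + nm k by exists (nm h + nm k).
have S0 : 0 <= S by rewrite SE addr_ge0 // nm_ge0.
have cf z : para a h k z -> {for z, continuous f}.
  by move=> /df /differentiable_continuous.
apply: (@nm_small_eq0 _ _ (2 * S ^+ 2)) => [|e e0].
  by rewrite mulr_ge0 // sqr_ge0.
(* The budget is proportional to the area: four quarters share it exactly, while differentiability
   at a point gives an error e times the squared size. *)
pose Q (x y : R) n := 0 <= x -> 0 <= y -> x + half R n <= 1 -> y + half R n <= 1 ->
  nm (loop (a + x%:C * h + y%:C * k) ((half R n)%:C * h) ((half R n)%:C * k) f) <=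
  e * (2 * S ^+ 2) * half R n ^+ 2.
suff : Q 0 0 0%N.
  by rewrite /Q /half !expr0 !mul0r !addr0 !mul1r expr1n mulr1; apply; rewrite ?add0r.
apply: dyadic_induction => [x y n|x y hx hy].
  have n0 := half_gt0 R n.+1; have n2 := halfS R n.
  rewrite /Q => Q1 Q2 Q3 Q4 x0 y0 x1 y1.
  have l1 : 0 <= x + half R n.+1 by clear -x0 n0; lra.
  have l2 : 0 <= y + half R n.+1 by clear -y0 n0; lra.
  have l3 : x + half R n.+1 <= 1 by clear -x1 n0 n2; lra.
  have l4 : y + half R n.+1 <= 1 by clear -y1 n0 n2; lra.
  have l5 : x + half R n.+1 + half R n.+1 <= 1 by clear -x1 n0 n2; lra.
  have l6 : y + half R n.+1 + half R n.+1 <= 1 by clear -y1 n0 n2; lra.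
  have {}Q1 := Q1 x0 y0 l3 l4; have {}Q2 := Q2 l1 y0 l5 l4.
  have {}Q3 := Q3 x0 l2 l3 l6; have {}Q4 := Q4 l1 l2 l5 l6.
  rewrite loop_split; last by move=> z /(sub_para x0 y0 x1 y1); exact: cf.
  have eH (z : C) : (half R n)%:C * z / 2 = (half R n.+1)%:C * z.
    by rewrite -halfC mulrAC.
  rewrite !eH.
  have E2 : a + (x + half R n.+1)%:C * h + y%:C * k =
      a + x%:C * h + y%:C * k + (half R n.+1)%:C * h.
    by clear; rewrite rmorphD /=; ring.
  have E3 : a + x%:C * h + (y + half R n.+1)%:C * k =
      a + x%:C * h + y%:C * k + (half R n.+1)%:C * k.
    by clear; rewrite rmorphD /=; ring.
  have E4 : a + (x + half R n.+1)%:C * h + (y + half R n.+1)%:C * k =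
      a + x%:C * h + y%:C * k + (half R n.+1)%:C * h + (half R n.+1)%:C * k.
    by clear; rewrite !rmorphD /=; ring.
  rewrite E2 in Q2; rewrite E3 in Q3; rewrite E4 in Q4.
  apply: le_trans (nmD _ _) _; apply: le_trans (lerD (nmD _ _) Q4) _.
  apply: le_trans (lerD (lerD (nmD _ _) Q3) (lexx _)) _.
  apply: le_trans (lerD (lerD (lerD Q1 Q2) (lexx _)) (lexx _)) _.
  by rewrite n2 le_eqVlt; apply/orP; left; apply/eqP; clear; ring.
pose p := a + x%:C * h + y%:C * k.
have pp : para a h k p by exists x, y.
have [d d0 Hd] := isd_eps (dif_isd (df p pp)) e0.
exists (d / (S + 1)) => [|x' y' n [/= x0 x1 y0 y1] xx yy hn _ _ _ _].
  by rewrite divr_gt0 // ltr_wpDl.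
have n0 := half_gt0 R n.
have sub := sub_para x0 y0 x1 y1.
have nmS : nm ((half R n)%:C * h) + nm ((half R n)%:C * k) = half R n * S.
  by rewrite !nmM nmC ger0_norm ?(ltW n0) // SE mulrDr.
have -> : e * (2 * S ^+ 2) * half R n ^+ 2 =
  2 * e * (nm ((half R n)%:C * h) + nm ((half R n)%:C * k)) ^+ 2.
  by rewrite nmS; clear; ring.
apply: (loop_small (p := p) (d := 'd f p 1)) => [z /sub /cf //| |z hz].
  exact: ltW.
have hp : para (a + x'%:C * h + y'%:C * k) ((half R n)%:C * h) ((half R n)%:C * k) p.
  exists ((x - x') / half R n), ((y - y') / half R n); split.
  - by rewrite divr_ge0 ?ler_pdivrMr ?(ltW n0) //=; clear -xx; lra.
  - by rewrite divr_ge0 ?ler_pdivrMr ?(ltW n0) //=; clear -yy; lra.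
  rewrite !mulrA -!rmorphM /= !divfK ?gt_eqF // /p !rmorphB /=; clear; ring.
have zp := para_edge_dist hz hp.
have Hz := Hd (z - p); rewrite addrCA subrr addr0 in Hz.
have -> : f z - (f p + 'd f p 1 * (z - p)) = f z - f p - 'd f p 1 * (z - p) by clear; ring.
apply: le_trans (Hz _) _; last by rewrite ler_wpM2l // ltW.
apply: le_lt_trans zp _; rewrite nmS; move: hn; rewrite ltr_pdivlMr ?ltr_wpDl //.
by apply: le_lt_trans; rewrite ler_wpM2l ?lerDl // ltW.
Qed.

End Pint.

(** * Cauchy estimates and limits of holomorphic functions *)

Section Cauchy.
Variable R : realType.
Local Notation C := R[i].

Lemma cvgC_unique (u : nat -> C) (l l' : C) :
  u @ \oo --> l -> u @ \oo --> l' -> l = l'.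
Proof. exact: cvg_unique. Qed.

(** The period 2 pi i of [cexp]: the segment from x to x + [tpi] is the circle of radius [expR x],
    run once, in the logarithmic coordinate. *)
Definition tpi : C := 0 +i* (pi *+ 2).

Lemma tpi_neq0 : tpi != 0.
Proof.
rewrite eq_complex /= eqxx /= mulrn_eq0 /= gt_eqF //; exact: pi_gt0.
Qed.

Lemma Re_add (x y : C) : complex.Re (x + y) = complex.Re x + complex.Re y.
Proof. by case: x y => [a b] [c d]. Qed.

Lemma Re_rM (r : R) (x : C) : complex.Re (r%:C * x) = r * complex.Re x.
Proof. by case: x => a b /=; rewrite mul0r subr0. Qed.

Lemma Re_tpi (r : R) : complex.Re (r%:C * tpi) = 0.
Proof. by rewrite Re_rM /= mulr0. Qed.

Lemma Re_seg_tpi (x : R) (z : C) : seg x%:C tpi z -> complex.Re z = x.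
Proof. by move=> [s _ ->]; rewrite Re_add Re_tpi addr0. Qed.

(* By periodicity, the sides of the rectangle parallel to the real axis cancel:
   in the coordinate [cexp w], circle means do not depend on the radius. *)
Lemma circle_indep (G : C -> C) (x1 x2 : R) : x1 <= x2 ->
  (forall w, x1 <= complex.Re w <= x2 -> differentiable G w) ->
  (forall w, G (w + tpi) = G w) ->
  pint x1%:C tpi G = pint x2%:C tpi G.
Proof.
move=> x12 dG pG; have := @goursat R x1%:C (x2 - x1)%:C tpi G.
rewrite /loop (pint_shift _ _ tpi).
have -> : (fun z : C => G (z + tpi)) = G by apply/funext => z; rewrite pG.
have -> : x1%:C + (x2 - x1)%:C = x2%:C :> C by rewrite -rmorphD addrC subrK.
move=> H; have {H} : pint x1%:C (x2 - x1)%:C G + pint x2%:C tpi G -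
    pint x1%:C (x2 - x1)%:C G - pint x1%:C tpi G = 0.
  apply: H => z [s [t [/andP[s0 s1] _ ->]]]; apply: dG.
  rewrite !Re_add Re_tpi Re_rM addr0 /=; clear -s0 s1 x12; nra.
by rewrite (addrC (pint _ (x2 - x1)%:C _)) addrK => /subr0_eq.
Qed.

Lemma seg_cont_tpi (G : C -> C) (x : R) :
  (forall w, complex.Re w = x -> differentiable G w) -> seg_cont x%:C tpi G.
Proof.
by move=> dG z /Re_seg_tpi /dG /differentiable_continuous.
Qed.

Lemma cexp_small (d : R) : 0 < d -> exists x0 : R, forall w : C,
  complex.Re w <= x0 -> nm (cexp w) < d.
Proof.
move=> d0; exists (ln (d / 2)) => w hw; rewrite nm_cexp.
have d2 : 0 < d / 2 by rewrite divr_gt0.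
apply: (@le_lt_trans _ _ (d / 2)); first by rewrite -[leRHS]lnK ?ler_expR.
by rewrite ltr_pdivrMr // ltr_pMr // ltr1n.
Qed.

Section Estimates.
Variables (g dg : C -> C) (x : C) (r M : R).
Hypotheses (r0 : 0 < r).
Hypothesis Hd : forall z, nm (z - x) < r -> is_derive z (1 : C) g (dg z).
Hypothesis HM : forall z, nm (z - x) < r -> nm (g z) <= M.

(** The circle means of the difference quotient of g at x do not depend on the radius. They tend to
    g'(x) as the radius shrinks, and on the circle of radius r / 2 the quotient is at most 2 M / (r
    / 2). *)
Lemma cauchy_est : nm (dg x) <= 4 * M / r.
Proof.
pose q l := (g (x + l) - g x) / l.
pose G w := q (cexp w).
have nx : nm (x - x) < r by rewrite subrr nm0.
have inb l : nm l < r -> nm (x + l - x) < r by rewrite addrAC subrr add0r.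
pose x2 := ln (r / 2).
have r2 : 0 < r / 2 by rewrite divr_gt0.
have r2r : r / 2 < r by rewrite ltr_pdivrMr // ltr_pMr // ltr1n.
have x2r w : complex.Re w <= x2 -> nm (cexp w) < r.
  move=> hw; rewrite nm_cexp; apply: le_lt_trans r2r.
  by rewrite -[leRHS]lnK ?ler_expR.
have dG w : complex.Re w <= x2 -> differentiable G w.
  move=> hw.
  have h1 : is_derive w (1 : C) (fun z => g (x + cexp z) - g x)
      (dg (x + cexp w) * (0 + cexp w) - 0).
    apply: isdB (isd_cst _ _).
    apply: (isd_comp (isdD (isd_cst x w) (isd_cexp w))).
    exact/Hd/inb/x2r.
  apply: (isd_dif (isdM h1 (isd_comp (isd_cexp w) (isd_V (cexp_neq0 w))))).
have pG w : G (w + tpi) = G w by rewrite /G cexp_2pi.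
have M0 : 0 <= M := le_trans (nm_ge0 _) (HM nx).
have bd : nm (pint x2%:C tpi G) <= (4 * M / r) * nm tpi.
  apply: pint_le => [|z /Re_seg_tpi hz].
    by apply: seg_cont_tpi => w hw; apply: dG; rewrite hw.
  rewrite /G /q nmM nmV nm_cexp hz lnK ?posrE // invf_div.
  have -> : 4 * M / r = (M + M) * (2 / r) by field; rewrite gt_eqF.
  rewrite ler_wpM2r ?divr_ge0 // ?(ltW r0) //.
  apply: le_trans (nmD _ _) _; rewrite nmN; apply: lerD; apply: HM => //.
  by apply/inb/x2r; rewrite hz.
rewrite -subr_le0; apply: (@small_le _ _ 1) => // e e0.
have [d d0 Hdd] := isd_eps (Hd nx) e0.
have [x0 Hx0] := cexp_small d0.
pose x1 := Num.min x0 x2.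
have x12 : x1 <= x2 by rewrite ge_min lexx orbT.
have E : pint x1%:C tpi G = pint x2%:C tpi G.
  by apply: circle_indep x12 _ pG => w /andP[_]; exact: dG.
have o : nm (pint x1%:C tpi G - tpi * dg x) <= e * nm tpi.
  apply: pint_osc => [|z /Re_seg_tpi hz].
    by apply: seg_cont_tpi => w hw; apply: dG; rewrite hw.
  have cz := cexp_neq0 z.
  have -> : G z - dg x = (g (x + cexp z) - g x - dg x * cexp z) / cexp z.
    by rewrite /G /q; field.
  rewrite nmM nmV ler_pdivrMr ?nm_gt0 //; apply: Hdd; apply: Hx0.
  by rewrite hz ge_min lexx.
have t0 : 0 < nm tpi by rewrite nm_gt0 tpi_neq0.
rewrite mulr1 lerBlDr -(ler_pM2r t0) mulrDl -nmM mulrC.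
apply: le_trans (lerD o bd); rewrite E nmB.
by rewrite -{1}[tpi * _](subrK (pint x2%:C tpi G)) nmD.
Qed.

End Estimates.

Lemma ballD (V : normedModType C) (x y z : V) (r s : R) :
  nm (y - x) < r -> nm (z - y) < s -> nm (z - x) < r + s.
Proof.
by move=> h1 h2; apply: le_lt_trans (nm_tri _ y _) _; rewrite addrC ltrD.
Qed.

Lemma seg_ball (x z h : C) (y : C) : seg x h y -> nm (y - x) <= nm h.
Proof. by move=> hy; apply: seg_dist hy (seg_start _ _). Qed.

Lemma cauchy_lip (g dg : C -> C) (x : C) (r M : R) : 0 < r ->
  (forall z, nm (z - x) < r -> is_derive z (1 : C) g (dg z)) ->
  (forall z, nm (z - x) < r -> nm (g z) <= M) ->
  forall h, nm h < r / 4 -> nm (dg (x + h) - dg x) <= 128 * M / r ^+ 2 * nm h.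
Proof.
move=> r0 Hd HM h hh.
have d1 z : nm (z - x) < r / 2 -> nm (dg z) <= 8 * M / r.
  move=> hz; have -> : 8 * M / r = 4 * M / (r / 2) by field; rewrite gt_eqF.
  have h1 y : nm (y - z) < r / 2 -> nm (y - x) < r.
    by move=> hy; have := ballD hz hy; rewrite -splitr.
  have rr : 0 < r / 2 by rewrite divr_gt0.
  exact: (@cauchy_est g dg z (r / 2) M rr (fun y hy => Hd y (h1 y hy)) (fun y hy => HM y (h1 y hy))).
have r4 : 0 < r / 4 by rewrite divr_gt0.
have r42 : r / 4 + r / 4 = r / 2 by clear; field.
have r24 : r / 2 <= r by rewrite ler_pdivrMr // ler_peMr ?ler1n // ltW.
have -> : 128 * M / r ^+ 2 * nm h = 4 * (8 * M / r * nm h) / (r / 4).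
  by clear -r0; field; rewrite gt_eqF.
apply: (@cauchy_est (fun z => g (z + h) - g z) (fun z => dg (z + h) - dg z) x
  (r / 4) (8 * M / r * nm h) r4).
- move=> z hz; have zh : nm (z + h - x) < r / 2.
    by rewrite addrAC -r42; apply: le_lt_trans (nmD _ _) _; rewrite ltrD.
  have zr : nm (z - x) < r.
    by apply: lt_le_trans r24; apply: lt_trans hz _; rewrite -r42 ltrDl.
  have H1 := isd_comp (isdD (isd_id z) (isd_cst h z)) (Hd _ (lt_le_trans zh r24)).
  by have := isdB H1 (Hd z zr) => /isd_eq; apply; rewrite addr0 mulr1.
- move=> z hz; apply: (@mean_value R g dg z h (8 * M / r)) => y hy.
    apply: Hd; apply: lt_le_trans r24; rewrite -r42.
    by apply: (ballD hz); apply: le_lt_trans (seg_ball 0 hy) hh.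
  apply: d1; rewrite -r42.
  by apply: (ballD hz); apply: le_lt_trans (seg_ball 0 hy) hh.
Qed.

Lemma cauchy_quad (g dg : C -> C) (x : C) (r M : R) : 0 < r ->
  (forall z, nm (z - x) < r -> is_derive z (1 : C) g (dg z)) ->
  (forall z, nm (z - x) < r -> nm (g z) <= M) ->
  forall h, nm h < r / 4 ->
    nm (g (x + h) - g x - dg x * h) <= 128 * M / r ^+ 2 * nm h ^+ 2.
Proof.
move=> r0 Hd HM h hh.
have r24 : r / 4 <= r by rewrite ler_pdivrMr // ler_peMr ?ler1n // ltW.
have M0 : 0 <= M by apply: le_trans (nm_ge0 _) (HM x _); rewrite subrr nm0.
have := @mean_value R (fun z => g z - dg x * z) (fun z => dg z - dg x * 1) x h
  (128 * M / r ^+ 2 * nm h).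
have -> : g (x + h) - dg x * (x + h) - (g x - dg x * x) = g (x + h) - g x - dg x * h.
  by clear; ring.
have -> : 128 * M / r ^+ 2 * nm h ^+ 2 = 128 * M / r ^+ 2 * nm h * nm h.
  by rewrite expr2 mulrA.
apply => z hz.
  have zr : nm (z - x) < r by apply: lt_le_trans r24; apply: le_lt_trans (seg_ball 0 hz) hh.
  exact: (isdB (Hd z zr) (isdZ (dg x) (isd_id z))).
rewrite mulr1; have zE : x + (z - x) = z by rewrite addrC subrK.
have := cauchy_lip r0 Hd HM (le_lt_trans (seg_ball 0 hz) hh).
rewrite zE => /le_trans; apply; rewrite ler_wpM2l ?(seg_ball 0 hz) //.
by rewrite divr_ge0 ?sqr_ge0 // mulr_ge0.
Qed.

Lemma isd_deriv_cont (g dg : C -> C) (x : C) (r : R) : 0 < r ->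
  (forall z, nm (z - x) < r -> is_derive z (1 : C) g (dg z)) ->
  {for x, continuous dg}.
Proof.
move=> r0 Hd.
have nx : nm (x - x) < r by rewrite subrr nm0.
have /cont_nmP /(_ 1 ltr01) [d d0 H] := isd_cont (Hd x nx).
pose s := Num.min r d; have s0 : 0 < s by rewrite lt_min r0.
pose M := nm (g x) + 1.
have M0 : 0 <= M by rewrite addr_ge0 // nm_ge0.
have bd z : nm (z - x) < s -> nm (g z) <= M.
  rewrite lt_min => /andP[_ /H h1]; have := nmBD (g z) (g x).
  by rewrite /M; clear -h1; lra.
have Hs z : nm (z - x) < s -> is_derive z (1 : C) g (dg z).
  by rewrite lt_min => /andP[/Hd].
have L := cauchy_lip s0 Hs bd.
apply/cont_nmP => e e0.
pose K := 128 * M / s ^+ 2.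
have K0 : 0 <= K by rewrite divr_ge0 ?sqr_ge0 // mulr_ge0.
have K1 : 0 < K + 1 by rewrite ltr_wpDl.
exists (Num.min (s / 4) (e / (K + 1))) => [|y].
  by rewrite lt_min !divr_gt0.
rewrite lt_min => /andP[y1 y2]; have yE : x + (y - x) = y by rewrite addrC subrK.
have := L _ y1; rewrite yE => /le_trans; apply.
move: y2; rewrite ltr_pdivlMr //; rewrite -/K; have := nm_ge0 (y - x).
clear -K0; nra.
Qed.

Lemma dif_line (V : normedModType C) (f : V -> C) (x h : V) (l : C) :
  differentiable f (x + l *: h) ->
  is_derive l (1 : C) (fun l => f (x + l *: h)) ('d f (x + l *: h) h).
Proof.
move=> df; apply: isd_of_eps => e e0.
have n1 : 0 < nm h + 1 by rewrite ltr_wpDl // nm_ge0.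
have [d d0 H] := dif_eps df (divr_gt0 e0 n1).
exists (d / (nm h + 1)) => [|k hk]; first by rewrite divr_gt0.
have h1 : nm (k *: h) <= nm k * (nm h + 1).
  by rewrite nmZ ler_wpM2l ?nm_ge0 // lerDl.
have -> : x + (l + k) *: h = x + l *: h + k *: h by rewrite scalerDl addrA.
have := H (k *: h); rewrite linearZ /= => H1.
rewrite mulrC; apply: le_trans (H1 _) _.
  by apply: le_lt_trans h1 _; rewrite -ltr_pdivlMr.
rewrite mulrAC ler_pdivrMr // -mulrA ler_wpM2l //; exact: ltW.
Qed.

(** On the complex line x + l h, f is a function of one variable l, holomorphic and bounded for |l|
    < r / |h|; the increment to bound is the one from l = 0 to l = 1. *)
Lemma dif_quad (V : normedModType C) (f : V -> C) (x : V) (r M : R) : 0 < r ->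
  (forall z, nm (z - x) < r -> differentiable f z) ->
  (forall z, nm (z - x) < r -> nm (f z) <= M) ->
  forall h, nm h < r / 4 ->
    nm (f (x + h) - f x - 'd f x h) <= 128 * M / r ^+ 2 * nm h ^+ 2.
Proof.
move=> r0 df HM h hh.
have [->|h0] := eqVneq h 0.
  by rewrite addr0 linear0 subrr subr0 !nm0 expr0n mulr0.
have n0 : 0 < nm h by rewrite nm_gt0.
have inb (l : C) : nm (l - 0) < r / nm h -> nm (x + l *: h - x) < r.
  by rewrite subr0 addrAC subrr add0r nmZ ltr_pdivlMr.
have := @cauchy_quad (fun l => f (x + l *: h)) (fun l => 'd f (x + l *: h) h) 0
  (r / nm h) M (divr_gt0 r0 n0) _ _ 1.
rewrite add0r scale1r scale0r addr0 mulr1 nm1 => H.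
have -> : 128 * M / r ^+ 2 * nm h ^+ 2 = 128 * M / (r / nm h) ^+ 2 * 1 ^+ 2.
  by clear -r0 n0; field; rewrite !gt_eqF.
apply: H => [l /inb hl|l /inb hl|]; [exact/dif_line/df|exact: HM|].
by rewrite mulrAC ltr_pdivlMr // mul1r.
Qed.

Let dif_lim_alg (a b c d l p q : C) :
  l * p - l * q = (a - b) - (c - d) - ((a - c - l * p) - (b - d - l * q)).
Proof. by ring. Qed.

(* The second-order Cauchy estimate passes to the limit. *)
Lemma dif_lim (V : normedModType C) (U : set V) (f : nat -> V -> C) (g : V -> C) :
  open U -> (forall n x, U x -> differentiable (f n) x) ->
  (forall x, U x -> exists2 r : R, 0 < r & exists M : R,
     forall n y, nm (y - x) < r -> nm (f n y) <= M) ->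
  (forall x, U x -> (fun n => f n x) @ \oo --> g x) ->
  forall x, U x -> differentiable g x /\
    forall h, (fun n => 'd (f n) x h) @ \oo --> 'd g x h.
Proof.
move=> oU df bf cf x Ux.
have [r1 r10 [M0 HM0]] := bf x Ux.
have [r2 r20 HU] := (openC_nm U).1 oU x Ux.
pose r := Num.min r1 r2; have r0 : 0 < r by rewrite lt_min r10.
pose M := `|M0|; have Mp : 0 <= M by exact: normr_ge0.
have HM n y : nm (y - x) < r -> nm (f n y) <= M.
  by rewrite lt_min => /andP[h1 _]; apply: le_trans (HM0 n y h1) (ler_norm _).
have Hd n y : nm (y - x) < r -> differentiable (f n) y.
  by rewrite lt_min => /andP[_ /HU /df]; apply.
have [K K0 quad] : exists2 K : R, 0 <= K & forall n h, nm h < r / 4 ->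
    nm (f n (x + h) - f n x - 'd (f n) x h) <= K * nm h ^+ 2.
  exists (128 * M / r ^+ 2); first by rewrite divr_ge0 ?sqr_ge0 // mulr_ge0.
  by move=> n; apply: dif_quad r0 (Hd n) (HM n).
have r4 : 0 < r / 4 by rewrite divr_gt0.
have inU y : nm (y - x) < r / 4 -> U y.
  move=> hy; apply: HU; apply: lt_le_trans hy _.
  have : r <= r2 by rewrite ge_min lexx orbT.
  by clear -r0; lra.
have cau h : exists l : C, (fun n => 'd (f n) x h) @ \oo --> l.
  apply: cauchyC_cvg => e e0.
  have n1 : 0 < nm h + 1 by rewrite ltr_wpDl // nm_ge0.
  have Kn : 0 < 4 * (K + 1) * (nm h + 1) ^+ 2.
    by rewrite !mulr_gt0 ?exprn_gt0 // ltr_wpDl.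
  (* The derivatives in direction h are compared through difference quotients with step l, whose
     error is at most l K |h|^2 for every n. The first bound keeps l h in the ball, the second makes
     two such errors at most e / 2. *)
  pose l := Num.min (r / 8 / (nm h + 1)) (e / (4 * (K + 1) * (nm h + 1) ^+ 2)).
  have l0 : 0 < l by rewrite lt_min !divr_gt0.
  have lh : nm (l%:C *: h) < r / 4.
    rewrite nmZ nmC ger0_norm ?(ltW l0) //.
    have : l <= r / 8 / (nm h + 1) by rewrite ge_min lexx.
    rewrite ler_pdivlMr // => h1; have := nm_ge0 h.
    by clear -h1 r0 l0; nra.
  have le2 : l * (2 * K * nm h ^+ 2) <= e / 2.
    have : l <= e / (4 * (K + 1) * (nm h + 1) ^+ 2) by rewrite ge_min lexx orbT.
    rewrite ler_pdivlMr // => h1.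
    have h2 : K * nm h ^+ 2 <= (K + 1) * (nm h + 1) ^+ 2.
      apply: ler_pM => //; first exact: sqr_ge0.
        by rewrite lerDl.
      by rewrite ler_pXn2r ?nnegrE ?nm_ge0 ?(ltW n1) // lerDl.
    have := ler_wpM2l (ltW l0) h2; clear -h1; lra.
  have hx2 : U (x + l%:C *: h) by apply: inU; rewrite addrAC subrr add0r.
  have e8 : 0 < l * e / 8 by rewrite divr_gt0 // mulr_gt0.
  have /cvgn_nmP /(_ _ e8) [N1 H1] := cf _ hx2.
  have /cvgn_nmP /(_ _ e8) [N2 H2] := cf _ Ux.
  exists (maxn N1 N2) => n; rewrite geq_max => /andP[n1' n2'].
  set N := maxn N1 N2.
  have N1' : (N1 <= N)%N by rewrite leq_maxl.
  have N2' : (N2 <= N)%N by rewrite leq_maxr.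
  have q k : nm (f k (x + l%:C *: h) - f k x - l%:C * 'd (f k) x h) <=
      l * (l * (K * nm h ^+ 2)).
    have := quad k _ lh; rewrite linearZ nmZ nmC ger0_norm ?(ltW l0) //.
    by move=> /le_trans; apply; rewrite le_eqVlt; apply/orP; left; apply/eqP; clear; ring.
  have q1 := q n; have q2 := q N.
  rewrite -(ler_pM2l l0) -[X in X * _](ger0_norm (ltW l0)) -nmC -nmM mulrBr.
  set a := f n (x + _) in q1; set b := f N (x + _) in q2.
  have A1 : nm (a - b) <= l * e / 8 + l * e / 8.
    apply: le_trans (nm_tri _ (g (x + l%:C *: h)) _) _.
    by apply: lerD; [exact: H1|rewrite nmB; exact: H1].
  have A2 : nm (f n x - f N x) <= l * e / 8 + l * e / 8.
    apply: le_trans (nm_tri _ (g x) _) _.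
    by apply: lerD; [exact: H2|rewrite nmB; exact: H2].
  rewrite (dif_lim_alg a b (f n x) (f N x)).
  apply: le_trans (nmD _ _) _; rewrite nmN.
  apply: le_trans (lerD (nmD _ _) (nmD _ _)) _; rewrite !nmN.
  apply: le_trans (lerD (lerD A1 A2) (lerD q1 q2)) _.
  have := ler_wpM2l (ltW l0) le2; clear; lra.
have [L HL] := choice cau.
have Llin : linear L.
  move=> a u v.
  have E : (fun n => 'd (f n) x (a *: u + v)) =
      fun n => a * 'd (f n) x u + 'd (f n) x v.
    by apply/funext => n; rewrite linearP.
  have H := HL (a *: u + v); rewrite E in H.
  apply: (cvgC_unique H).
  exact: cvgD (cvgM (cvg_cst a) (HL u)) (HL v).
have Lquad h : nm h < r / 4 -> nm (g (x + h) - g x - L h) <= K * nm h ^+ 2.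
  move=> hh.
  have hx2 : U (x + h) by apply: inU; rewrite addrAC subrr add0r.
  apply: (@cvgC_nm_le _ (fun n => f n (x + h) - f n x - 'd (f n) x h)) => [|n].
    by apply: cvgB (HL h); apply: cvgB (cf _ hx2) (cf _ Ux).
  exact: quad.
have Lb h : nm (L h) <= 4 * M / r * nm h.
  apply: (cvgC_nm_le (HL h)) => n.
  have [->|h0] := eqVneq h 0; first by rewrite linear0 !nm0 mulr0.
  have n0 : 0 < nm h by rewrite nm_gt0.
  have inb (l : C) : nm (l - 0) < r / nm h -> nm (x + l *: h - x) < r.
    by rewrite subr0 addrAC subrr add0r nmZ ltr_pdivlMr.
  have := @cauchy_est (fun l => f n (x + l *: h)) (fun l => 'd (f n) (x + l *: h) h) 0
    (r / nm h) M (divr_gt0 r0 n0) _ _.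
  rewrite scale0r addr0 => H.
  have -> : 4 * M / r * nm h = 4 * M / (r / nm h).
    by clear -r0 n0; field; rewrite !gt_eqF.
  by apply: H => l /inb hl; [exact/dif_line/Hd|exact: HM].
have [|dgx dE] := @dif_of_eps R V C g L (4 * M / r) x Llin Lb.
  move=> e e0; have K1 : 0 < K + 1 by rewrite ltr_wpDl.
  exists (Num.min (r / 4) (e / (K + 1))) => [|h]; first by rewrite lt_min !divr_gt0.
  rewrite lt_min => /andP[h1 h2]; apply: le_trans (Lquad h h1) _.
  rewrite expr2 mulrA ler_wpM2r ?nm_ge0 //.
  by move: h2; rewrite ltr_pdivlMr //; have := nm_ge0 h; clear -K0; nra.
split=> [|h]; first exact: dgx.
have e : 'd g x h = L h := congr1 (fun F => F h) dE.
by have HLh := HL h; rewrite -e in HLh; exact: HLh.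
Qed.

End Cauchy.

(** * Differentiation of limits and integrals with respect to parameters *)

Section Param.
Variable R : realType.
Local Notation C := R[i].
Variable V : normedModType C.
Implicit Types (U : set V) (p v : V).

Definition loc_bounded (U : set V) (phi : V -> R) : Prop :=
  forall x, U x -> exists2 r : R, 0 < r &
    exists M : R, forall y, nm (y - x) < r -> U y -> phi y <= M.

Lemma dif_limw U (phi : V -> R) (f : nat -> V -> C) (g : V -> C) :
  open U -> loc_bounded U phi ->
  (forall n x, U x -> differentiable (f n) x) ->
  (forall n x, U x -> nm (f n x) <= phi x) ->
  (forall x, U x -> (fun n => f n x) @ \oo --> g x) ->
  forall x, U x -> differentiable g x /\
    forall h, (fun n => 'd (f n) x h) @ \oo --> 'd g x h.
Proof.
move=> oU lb df bf cf; apply: (dif_lim oU df) => // x Ux.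
have [r r0 [M HM]] := lb x Ux.
have [r2 r20 HU] := (openC_nm U).1 oU x Ux.
exists (Num.min r r2); first by rewrite lt_min r0.
exists M => n y; rewrite lt_min => /andP[y1 y2].
have Uy := HU y y2.
by apply: le_trans (bf n y Uy) _; apply: HM.
Qed.

Lemma cvgC_ext (u u' : nat -> C) (l : C) : (forall n, u n = u' n) ->
  u @ \oo --> l -> u' @ \oo --> l.
Proof. by move=> /funext ->. Qed.

Lemma difZ (c : C) (f : V -> C) p : differentiable f p ->
  differentiable (fun q => c * f q) p /\
  forall v, 'd (fun q => c * f q) p v = c * 'd f p v.
Proof.
move=> df; split; first exact: (@differentiableZ _ _ _ f c p df).
by move=> v; have h := diffZ c df; exact: (congr1 (fun F => F v) h).
Qed.

Lemma difD (f g : V -> C) p : differentiable f p -> differentiable g p ->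
  differentiable (fun q => f q + g q) p /\
  forall v, 'd (fun q => f q + g q) p v = 'd f p v + 'd g p v.
Proof.
move=> df dg; split; first exact: differentiableD.
by move=> v; have h := diffD df dg; exact: (congr1 (fun F => F v) h).
Qed.

Lemma rs_dif n (a h : C) (F : C -> V -> C) p :
  (forall s, seg a h s -> differentiable (F s) p) ->
  differentiable (fun q => rs n a h (F^~ q)) p /\
  forall v, 'd (fun q => rs n a h (F^~ q)) p v = rs n a h (fun s => 'd (F s) p v).
Proof.
elim: n a h => [|n IH] a h dF /=.
  exact/difZ/dF/seg_start.
have [d1 e1] := IH a (h / 2) (fun s hs => dF s (seg_left hs)).
have [d2 e2] := IH (a + h / 2) (h / 2) (fun s hs => dF s (seg_right hs)).
have [d3 e3] := difD d1 d2.
by split=> [|v]; [exact: d3|exact: etrans (e3 v) (congr2 +%R (e1 v) (e2 v))].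
Qed.

(** Riemann sums are finite combinations of holomorphic functions of p, bounded by [phi p] times
    |h|; holomorphy and the differentials pass to the limit. *)
Lemma pint_dif U (phi : V -> R) (a h : C) (F : C -> V -> C) :
  open U -> loc_bounded U phi ->
  (forall s p, seg a h s -> U p -> differentiable (F s) p) ->
  (forall p, U p -> seg_cont a h (F^~ p)) ->
  (forall s p, seg a h s -> U p -> nm (F s p) <= phi p) ->
  forall p, U p -> differentiable (fun q => pint a h (F^~ q)) p /\
    forall v, (fun n => rs n a h (fun s => 'd (F s) p v)) @ \oo -->
      'd (fun q => pint a h (F^~ q)) p v.
Proof.
move=> oU lb dF cF bF p Up.
have lb' : loc_bounded U (fun q => phi q * nm h).
  move=> x /lb [r r0 [M HM]]; exists r => //; exists (M * nm h) => y y1 y2.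
  by rewrite ler_wpM2r ?nm_ge0 //; apply: HM.
have [|||d1 e1] := @dif_limw U _ (fun n q => rs n a h (F^~ q)) (fun q => pint a h (F^~ q))
  oU lb' _ _ _ p Up.
- by move=> n x Ux; have [] := @rs_dif n a h F x (fun s hs => dF s x hs Ux).
- by move=> n x Ux; apply: rs_le => z hz; apply: bF.
- by move=> x Ux; apply/pint_cvg/cF.
split=> [|v]; first exact: d1.
apply: (cvgC_ext _ (e1 v)) => n.
by have [_ h1] := @rs_dif n a h F p (fun s hs => dF s p hs Up); exact: h1.
Qed.

(** When the derivative of the integrand in direction v is a total derivative in s plus k times the
    integrand, only boundary terms and k times the integral remain. This is how solutions of
    integral equations are seen to satisfy differential equations. *)
Lemma pint_dif_eq U (phi : V -> R) (a h : C) (F : C -> V -> C) (p v : V)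
   (Psi dPsi : C -> C) (k : C) :
  open U -> loc_bounded U phi ->
  (forall s p, seg a h s -> U p -> differentiable (F s) p) ->
  (forall p, U p -> seg_cont a h (F^~ p)) ->
  (forall s p, seg a h s -> U p -> nm (F s p) <= phi p) ->
  U p -> (forall s, seg a h s -> is_derive s (1 : C) Psi (dPsi s)) ->
  seg_cont a h dPsi ->
  (forall s, seg a h s -> 'd (F s) p v = dPsi s + k * F s p) ->
  'd (fun q => pint a h (F^~ q)) p v =
     Psi (a + h) - Psi a + k * pint a h (F^~ p).
Proof.
move=> oU lb dF cF bF Up dP cP rel.
have [_ /(_ v) H] := pint_dif oU lb dF cF bF Up.
apply: (cvgC_unique H); rewrite -(pint_deriv dP cP).
apply: (@cvgC_ext (fun n => rs n a h dPsi + k * rs n a h (F^~ p))) => [n|].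
  by rewrite -rsZ -rsD; apply: rs_ext => s /rel e; rewrite [RHS]e.
exact: cvgD (pint_cvg cP) (cvgM (cvg_cst k) (pint_cvg (cF p Up))).
Qed.

End Param.

Section Geometric.
Variable R : realType.
Local Notation C := R[i].

Lemma geo_sum_le (r : R) n : 0 <= r < 1 -> \sum_(i < n) r ^+ i <= (1 - r)^-1.
Proof.
move=> /andP[r0 r1]; have h : 0 < 1 - r by rewrite subr_gt0.
rewrite -[leRHS]mul1r ler_pdivlMr // mulrC.
rewrite -opprB mulNr -subrX1 opprB lerBlDr lerDl; exact: exprn_ge0.
Qed.

Lemma geo_cvg (u : nat -> C) (B r : R) : 0 <= B -> 0 <= r < 1 ->
  (forall n, nm (u n.+1 - u n) <= B * r ^+ n) ->
  exists2 l, u @ \oo --> l & forall n, nm (l - u n) <= B / (1 - r) * r ^+ n.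
Proof.
move=> B0 r01 H; have /andP[r0 r1] := r01.
have d n k : nm (u (k + n)%N - u n) <= B / (1 - r) * r ^+ n.
  have h : nm (u (k + n)%N - u n) <= B * r ^+ n * \sum_(i < k) r ^+ i.
    elim: k => [|k IH]; first by rewrite add0n subrr nm0 big_ord0 mulr0.
    rewrite big_ord_recr /= mulrDr [leRHS]addrC.
    apply: le_trans (nm_tri _ (u (k + n)%N) _) _; apply: lerD => //.
    by rewrite addSn; apply: le_trans (H _) _; rewrite exprD mulrA mulrAC.
  apply: le_trans h _; rewrite mulrAC ler_wpM2r ?exprn_ge0 //.
  by rewrite ler_wpM2l // geo_sum_le.
have K0 : 0 <= B / (1 - r) by rewrite divr_ge0 // subr_ge0 ltW.
have [|l hl] := @cauchyC_cvg R u.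
  move=> e e0.
  have [N hN] : exists N, B / (1 - r) * r ^+ N <= e.
    have := @cvg_expr R r; rewrite ger0_norm // => /(_ r1) /cvgrPdist_le.
    have K1 : 0 < B / (1 - r) + 1 by rewrite ltr_wpDl.
    move=> /(_ (e / (B / (1 - r) + 1)) (divr_gt0 e0 K1)) [N _ /(_ N (leqnn N))] /=.
    rewrite sub0r normrN ger0_norm ?exprn_ge0 // ler_pdivlMr // => hN.
    exists N; apply: le_trans hN; rewrite mulrC ler_wpM2l ?exprn_ge0 //.
    by rewrite lerDl.
  exists N => n /subnK <-; apply: le_trans (d _ _) hN.
exists l => // n.
apply: (@cvgC_nm_le _ (fun k => u (k + n)%N - u n)); last by move=> k.
apply: cvgB; last exact: cvg_cst.
apply/cvgn_nmP => e e0; have /cvgn_nmP /(_ e e0) [N hN] := hl.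
by exists N => k hk; apply: hN; apply: leq_trans hk (leq_addr _ _).
Qed.

End Geometric.

(** * Integrals over half-lines depending on parameters *)

Section HalfLine.
Variable R : realType.
Local Notation C := R[i].
Variable V : normedModType C.

Definition hint (F : C -> V -> C) (p : V) : C :=
  lim ((fun n => \sum_(j < n) pint (j%:R)%:C 1 (F^~ p)) @ \oo).

Lemma seg_real (j : nat) z : seg (R := R) (j%:R)%:C 1 z ->
  exists2 s : R, j%:R <= s <= j.+1%:R & z = s%:C.
Proof.
move=> [s /andP[s0 s1] ->]; exists (j%:R + s).
  by rewrite lerDl s0 -natr1 lerD2l.
by rewrite rmorphD /= mulr1.
Qed.

(** The geometric decay over unit intervals makes the series of pieces converge at a rate controlled
    by the weight [phi]. Holomorphy in a complex neighbourhood of each real s makes the s-derivative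
    continuous. *)
Record half_line (U : set V) (phi : V -> R) (B r : R) (F : C -> V -> C) : Prop := HalfLine {
  hl_dif : forall (s : R) p, 0 <= s -> U p -> differentiable (F s%:C) p;
  hl_hol : forall (s : R) p, 0 <= s -> U p -> exists2 d : R, 0 < d &
     forall z, nm (z - s%:C) < d -> differentiable (F^~ p) z;
  hl_bound : forall (j : nat) (s : R) p, j%:R <= s <= j.+1%:R -> U p ->
     nm (F s%:C p) <= B * r ^+ j * phi p }.

Section Facts.
Variables (U : set V) (phi : V -> R) (B r : R).
Hypotheses (oU : open U) (lU : loc_bounded U phi) (B0 : 0 <= B) (r01 : 0 <= r < 1).
Hypothesis phi0 : forall p, U p -> 0 <= phi p.

Section One.
Variable F : C -> V -> C.
Hypothesis HF : half_line U phi B r F.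

Lemma hl_cont j p : U p -> seg_cont (j%:R)%:C 1 (F^~ p).
Proof.
move=> Up z /seg_real [s /andP[s0 _] ->].
have s0' : 0 <= s by apply: le_trans s0.
have [d d0 H] := hl_hol HF s0' Up.
by apply: differentiable_continuous; apply: H; rewrite subrr nm0.
Qed.

Lemma hl_pint_le j p : U p -> nm (pint (j%:R)%:C 1 (F^~ p)) <= B * r ^+ j * phi p.
Proof.
move=> Up; have h := @pint_le R (j%:R)%:C 1 (F^~ p) (B * r ^+ j * phi p) (hl_cont Up).
rewrite nm1 mulr1 in h; apply: h.
by move=> z /seg_real [s hs ->]; apply: (hl_bound HF).
Qed.

Lemma hint_cvg p : U p ->
  (fun n => \sum_(j < n) pint (j%:R)%:C 1 (F^~ p)) @ \oo --> hint F p.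
Proof.
move=> Up; have [|n|l hl _] := @geo_cvg R
   (fun n => \sum_(j < n) pint (j%:R)%:C 1 (F^~ p)) (B * phi p) r _ r01.
- by rewrite mulr_ge0 // phi0.
- rewrite big_ord_recr /= addrAC subrr add0r mulrAC.
  exact: hl_pint_le.
by rewrite /hint; move/cvgP: (hl).
Qed.

Lemma hint_part_le n p : U p ->
  nm (\sum_(j < n) pint (j%:R)%:C 1 (F^~ p)) <= B / (1 - r) * phi p.
Proof.
move=> Up; apply: le_trans (nm_sum _ _ _) _.
apply: (@le_trans _ _ (\sum_(j < n) B * phi p * r ^+ j)).
  by apply: ler_sum => j _; rewrite mulrAC; exact: hl_pint_le.
rewrite -mulr_sumr [leRHS]mulrAC ler_wpM2l ?geo_sum_le //.
by rewrite mulr_ge0 // phi0.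
Qed.

Lemma hint_le p : U p -> nm (hint F p) <= B / (1 - r) * phi p.
Proof.
by move=> Up; apply: (cvgC_nm_le (hint_cvg Up)) => n; apply: hint_part_le.
Qed.

Lemma lbK (K : R) : 0 <= K -> loc_bounded U (fun p => K * phi p).
Proof.
move=> K0 x /lU [d d0 [M HM]]; exists d => //; exists (K * M) => y y1 y2.
by rewrite ler_wpM2l //; apply: HM.
Qed.

Lemma lb_j j : loc_bounded U (fun p => B * r ^+ j * phi p).
Proof. by apply: lbK; rewrite mulr_ge0 // exprn_ge0 //; case/andP: r01. Qed.

Lemma seg_ge0 j z : seg (R := R) (j%:R)%:C 1 z -> exists2 s : R, 0 <= s & z = s%:C.
Proof. by move=> /seg_real [s /andP[s0 _] ->]; exists s => //; apply: le_trans s0. Qed.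

Lemma part_dif n p : U p ->
  differentiable (fun q => \sum_(j < n) pint (j%:R)%:C 1 (F^~ q)) p /\
  forall v, 'd (fun q => \sum_(j < n) pint (j%:R)%:C 1 (F^~ q)) p v =
    \sum_(j < n) 'd (fun q => pint (j%:R)%:C 1 (F^~ q)) p v.
Proof.
move=> Up; elim: n => [|n [IH1 IH2]].
  rewrite (_ : (fun q => _) = cst 0); last by apply/funext => q; rewrite big_ord0.
  split=> [|v]; first exact: differentiable_cst.
  by rewrite big_ord0; exact: (congr1 (fun G => G v) (diff_cst (0 : C) p)).
rewrite (_ : (fun q => _) = fun q => \sum_(j < n) pint (j%:R)%:C 1 (F^~ q) +
   pint (n%:R)%:C 1 (F^~ q)); last by apply/funext => q; rewrite big_ord_recr.
have [|||d1 _] := @pint_dif R V U _ (n%:R)%:C 1 F oU (lb_j n) _ _ _ p Up.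
- by move=> s q /seg_ge0 [t t0 ->]; apply: (hl_dif HF).
- by move=> q Uq; apply: hl_cont.
- by move=> s q /seg_real [t ht ->]; apply: (hl_bound HF).
have [d2 e2] := difD IH1 d1; split=> [|v]; first exact: d2.
by rewrite big_ord_recr; exact: etrans (e2 v) (congr1 (+%R^~ _) (IH2 v)).
Qed.

Lemma hint_dif p : U p -> differentiable (hint F) p /\
  forall v, (fun n => \sum_(j < n) 'd (fun q => pint (j%:R)%:C 1 (F^~ q)) p v)
     @ \oo --> 'd (hint F) p v.
Proof.
move=> Up.
have K0 : 0 <= B / (1 - r).
  by rewrite divr_ge0 // subr_ge0; case/andP: r01 => _ /ltW.
have [|||d1 e1] := @dif_limw R V U _ (fun n q => \sum_(j < n) pint (j%:R)%:C 1 (F^~ q))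
  (hint F) oU (lbK K0) _ _ _ p Up.
- by move=> n x /(part_dif n) [].
- by move=> n x; apply: hint_part_le.
- by move=> x; apply: hint_cvg.
split=> [|v]; first exact: d1.
apply: (cvgC_ext _ (e1 v)) => n.
by have [_ h1] := part_dif n Up; exact: h1.
Qed.

(** The total derivatives telescope over the unit intervals and the term at infinity vanishes by
    decay, which leaves the boundary term at s = 0. *)
Lemma hint_deriv p v (b k : C) : U p ->
  (forall s : R, 0 <= s ->
     'd (F s%:C) p v = b * 'd (fun z : C => F z p) (s%:C : C) 1 + k * F s%:C p) ->
  'd (hint F) p v = - (b * F 0 p) + k * hint F p.
Proof.
move=> Up rel; have [_ /(_ v) H] := hint_dif Up.
apply: (cvgC_unique H).
have E j : 'd (fun q => pint (j%:R)%:C 1 (F^~ q)) p v =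
    b * F (j.+1%:R)%:C p - b * F (j%:R)%:C p + k * pint (j%:R)%:C 1 (F^~ p).
  have -> : (j.+1%:R)%:C = (j%:R)%:C + 1 :> C by rewrite -natr1 rmorphD.
  apply: (@pint_dif_eq R V U _ (j%:R)%:C 1 F p v (fun s => b * F s p)
    (fun s => b * 'd (fun z : C => F z p) s 1) k oU (lb_j j) _ _ _ Up).
  - by move=> s q /seg_ge0 [t t0 ->]; apply: (hl_dif HF).
  - by move=> q Uq; apply: hl_cont.
  - by move=> s q /seg_real [t ht ->]; apply: (hl_bound HF).
  - move=> s /seg_ge0 [t t0 ->]; apply: isdZ; apply: dif_isd.
    have [d d0 HH] := hl_hol HF t0 Up.
    by apply: HH; rewrite subrr nm0.
  - move=> z /seg_ge0 [t t0 ->].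
    have [d d0 HH] := hl_hol HF t0 Up.
    have cc := @isd_deriv_cont R (fun z => F z p) (fun s => 'd (fun z : C => F z p) s 1)
      t%:C d d0 (fun y hy => dif_isd (HH y hy)).
    exact: cvgM (cvg_cst b) cc.
  by move=> s /seg_ge0 [t t0 ->]; apply: rel.
apply: (@cvgC_ext _ (fun n => b * F (n%:R)%:C p - b * F 0 p +
    k * \sum_(j < n) pint (j%:R)%:C 1 (F^~ p))) => [n|].
  rewrite (eq_bigr _ (fun (j : 'I_n) _ => E j)).
  elim: n => [|n IH]; first by rewrite !big_ord0 subrr mulr0 addr0.
  by rewrite !big_ord_recr /= -IH; clear; ring.
have b0 : (fun n => b * F (n%:R)%:C p) @ \oo --> (0 : C).
  apply/cvgn_nmP => e e0.
  have /andP[r0 r1] := r01.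
  have K1 : 0 < nm b * (B * phi p) + 1.
    by rewrite ltr_wpDl // !mulr_ge0 ?nm_ge0 // phi0.
  have := @cvg_expr R r; rewrite ger0_norm // => /(_ r1) /cvgrPdist_le.
  move=> /(_ _ (divr_gt0 e0 K1)) [N _ HN]; exists N => n /HN /=.
  rewrite sub0r normrN ger0_norm ?exprn_ge0 // ler_pdivlMr // subr0 nmM => h.
  apply: le_trans h.
  have h1 := hl_bound HF (j := n) (s := n%:R) _ Up.
  apply: le_trans (ler_wpM2l (nm_ge0 b) (h1 _)) _.
    by rewrite lexx /= ler_nat.
  have -> : nm b * (B * r ^+ n * phi p) = r ^+ n * (nm b * (B * phi p)).
    by clear; ring.
  by rewrite ler_wpM2l ?exprn_ge0 // lerDl.
rewrite -[X in _ --> X + _]add0r.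
apply: cvgD; last exact: cvgM (cvg_cst k) (hint_cvg Up).
exact: cvgB b0 (cvg_cst _).
Qed.

End One.

Lemma hintB (F G : C -> V -> C) p : half_line U phi B r F -> half_line U phi B r G ->
  U p -> hint F p - hint G p = hint (fun s q => F s q - G s q) p.
Proof.
move=> HF HG Up; symmetry; apply: cvg_lim; first exact: norm_hausdorff.
have -> : (fun n => \sum_(j < n) pint (j%:R)%:C 1 (fun s => F s p - G s p)) =
   fun n => \sum_(j < n) pint (j%:R)%:C 1 (F^~ p) - \sum_(j < n) pint (j%:R)%:C 1 (G^~ p).
  apply/funext => n; rewrite -sumrB; apply: eq_bigr => j _.
  have cF := hl_cont HF (j := j) Up; have cG := hl_cont HG (j := j) Up.
  have := pintD cF (seg_contZ (c := -1) cG); rewrite pintZ // mulN1r => <-.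
  by apply: pint_ext => z _; rewrite mulN1r.
exact: cvgB (hint_cvg HF Up) (hint_cvg HG Up).
Qed.

End Facts.
End HalfLine.

(** * A contraction principle in weighted spaces of holomorphic functions *)

Section FixedPoint.
Variable R : realType.
Local Notation C := R[i].
Variables (V : normedModType C) (I : Type) (U : set V) (phi : I -> V -> R).
Hypotheses (oU : open U) (lU : forall i, loc_bounded U (phi i)).
Hypothesis phi0 : forall i p, U p -> 0 <= phi i p.

Definition adm (f : I -> V -> C) : Prop :=
  (forall i p, U p -> differentiable (f i) p) /\
  exists2 B : R, 0 <= B & forall i p, U p -> nm (f i p) <= B * phi i p.

(** Iteration from 0 with contraction factor 1/2 in the norm weighted by [phi]. The increments are
    at most B0 2^-n, which both keeps the iterates admissible and gives the bound 2 B0; the limit is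
    holomorphic because the iterates are locally uniformly bounded. *)
Lemma fixed_point (T : (I -> V -> C) -> I -> V -> C) (B0 : R) : 0 <= B0 ->
  (forall f, adm f -> forall i p, U p -> differentiable (T f i) p) ->
  (forall f g, adm f -> adm g -> forall c : R, 0 <= c ->
     (forall i p, U p -> nm (f i p - g i p) <= c * phi i p) ->
     forall i p, U p -> nm (T f i p - T g i p) <= c / 2 * phi i p) ->
  (forall i p, U p -> nm (T (fun _ _ => 0) i p) <= B0 * phi i p) ->
  exists f, [/\ forall i p, U p -> differentiable (f i) p,
     forall i p, U p -> nm (f i p) <= 2 * B0 * phi i p
   & forall i p, U p -> f i p = T f i p].
Proof.
move=> B00 Tdif Tcon T0.
pose f n := iter n T (fun _ _ => 0).
have h2 : 0 <= (2^-1 : R) < 1 by rewrite invr_ge0 ler0n invf_lt1 ?ltr1n.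
have h12 : (1 - 2^-1 : R)^-1 = 2 by field.
have main n : adm (f n) /\ forall i p, U p ->
    nm (f n i p) <= B0 * (\sum_(j < n) 2^-1 ^+ j) * phi i p /\
    nm (f n.+1 i p - f n i p) <= B0 * 2^-1 ^+ n * phi i p.
  elim: n => [|n [[IHd [B Bp IHB]] IH]].
    split=> [|i p Up].
      split=> [i p _|]; first exact: differentiable_cst.
      by exists 0 => // i p _; rewrite nm0 mul0r.
    rewrite big_ord0 mulr0 mul0r nm0 lexx expr0 mulr1 /= subr0; split=> //.
    exact: T0.
  have bn i p : U p -> nm (f n.+1 i p) <= B0 * (\sum_(j < n.+1) 2^-1 ^+ j) * phi i p.
    move=> Up; have [i1 i2] := IH i p Up.
    rewrite -(subrK (f n i p) (f n.+1 i p)); apply: le_trans (nmD _ _) _.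
    apply: le_trans (lerD i2 i1) _.
    by rewrite big_ord_recr /= -mulrDl -mulrDr addrC.
  have an : adm (f n.+1).
    split=> [i p Up|].
      by rewrite /f iterS; apply: Tdif => //; split=> //; exists B.
    exists (B0 * (\sum_(j < n.+1) 2^-1 ^+ j)) => //.
    by rewrite mulr_ge0 // sumr_ge0 // => j _; rewrite exprn_ge0 // invr_ge0.
  split=> // i p Up; split; first exact: bn.
  have := Tcon (f n.+1) (f n) an _ (B0 * 2^-1 ^+ n).
  rewrite exprSr mulrA; apply => //.
  - by split=> //; exists B.
  - by rewrite mulr_ge0 // exprn_ge0 // invr_ge0.
  - by move=> j q Uq; have [] := IH j q Uq.
have step i p : U p -> forall n, nm (f n.+1 i p - f n i p) <= B0 * phi i p * 2^-1 ^+ n.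
  by move=> Up n; have [_ /(_ i p Up) [_]] := main n; rewrite mulrAC.
have lims : forall ip : I * V, exists l : C, U ip.2 ->
   (fun n => f n ip.1 ip.2) @ \oo --> l /\
   forall n, nm (l - f n ip.1 ip.2) <= 2 * B0 * phi ip.1 ip.2 * 2^-1 ^+ n.
  move=> [i p] /=; case: (pselect (U p)) => [Up|nU]; last by exists 0.
  have [|l l1 l2] := @geo_cvg R (fun n => f n i p) (B0 * phi i p) 2^-1 _ h2 (step i p Up).
    by rewrite mulr_ge0 // phi0.
  by exists l => _; split=> // n; apply: le_trans (l2 n) _; rewrite h12 [_ * 2]mulrC mulrA.
have [F HF] := choice lims.
pose g i p := F (i, p).
have gc i p : U p -> (fun n => f n i p) @ \oo --> g i p.
  by move=> Up; have [] := HF (i, p) Up.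
have ge i p : U p -> forall n, nm (g i p - f n i p) <= 2 * B0 * phi i p * 2^-1 ^+ n.
  by move=> Up; have [] := HF (i, p) Up.
have fb n i p : U p -> nm (f n i p) <= 2 * B0 * phi i p.
  move=> Up; have [_ /(_ i p Up) [h _]] := main n.
  apply: le_trans h _; rewrite ler_wpM2r ?phi0 // mulrC ler_wpM2r //.
  by apply: le_trans (geo_sum_le n h2) _; rewrite h12.
have gb i p : U p -> nm (g i p) <= 2 * B0 * phi i p.
  by move=> Up; apply: (cvgC_nm_le (gc i p Up)) => n; apply: fb.
have gd i p : U p -> differentiable (g i) p.
  move=> Up.
  have [||||h _] := @dif_limw R V U (fun q => 2 * B0 * phi i q) (fun n => f n i) (g i) oU _ _ _ _ p Up; last exact: h.
  - move=> x /(@lU i) [d d0 [M HM]]; exists d => //; exists (2 * B0 * M) => y y1 y2.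
    by rewrite ler_wpM2l ?mulr_ge0 //; apply: HM.
  - by move=> n x Ux; have [[h _] _] := main n; apply: h.
  - by move=> n x; apply: fb.
  - by move=> x; apply: gc.
have ag : adm g by split=> //; exists (2 * B0) => //; rewrite mulr_ge0.
exists g; split=> // i p Up.
apply: (@cvgC_unique _ (fun n => f n.+1 i p)).
  by rewrite (cvg_shiftS (fun n => f n i p)); apply: gc.
apply/cvgn_nmP => e e0.
have K0 : 0 < B0 * phi i p + 1 by rewrite ltr_wpDl // mulr_ge0 // phi0.
have [N hN] := half_small (divr_gt0 e0 K0).
exists N => n nN.
have := Tcon (f n) g _ ag (2 * B0 * 2^-1 ^+ n) _ _ i p Up.
have [an _] := main n.
move=> H; apply: le_trans (H an _ _) _.
- by rewrite !mulr_ge0 // exprn_ge0 // invr_ge0.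
- by move=> j q Uq; rewrite nmB mulrAC; apply: ge.
move: hN; rewrite ltr_pdivlMr // => /ltW; apply: le_trans.
have -> : 2 * B0 * 2^-1 ^+ n / 2 * phi i p = 2^-1 ^+ n * (B0 * phi i p).
  by field.
apply: ler_pM; rewrite ?exprn_ge0 ?invr_ge0 ?mulr_ge0 ?phi0 ?lerDl //.
by apply: ler_wiXn2l => //; case/andP: h2 => // _ /ltW.
Qed.

End FixedPoint.

Section Slices.
Variable R : realType.
Local Notation C := R[i].

Lemma isd_unique (g : C -> C) (x d d' : C) :
  is_derive x (1 : C) g d -> is_derive x (1 : C) g d' -> d = d'.
Proof. by move=> [_ h1] [_ h2]; exact: etrans (esym h1) h2. Qed.

Lemma lin_dif (V W : normedModType C) (L : V -> W) (B : R) (x : V) :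
  linear L -> (forall h, nm (L h) <= B * nm h) -> differentiable L x.
Proof.
move=> lin bd; have [|h _] := @dif_of_eps R V W L L B x lin bd; last exact: h.
move=> e e0; exists 1 => // h _.
have -> : L (x + h) = L x + L h.
  by rewrite -[x in LHS](scale1r x) lin scale1r.
by rewrite (addrC (L x)) addrK subrr nm0 mulr_ge0 ?nm_ge0 // ltW.
Qed.

Variable X : normedModType C.
Local Notation V := (C * X)%type.

Lemma nm_pair (p : V) : nm p = Num.max (nm p.1) (nm p.2).
Proof.
apply: (@complexI R); rewrite nmE prod_normE -!nmE /Order.max ltcR.
by case: ifP.
Qed.

Lemma nm_fst (p : V) : nm p.1 <= nm p.
Proof. by rewrite nm_pair le_max lexx. Qed.

Lemma nm_snd (p : V) : nm p.2 <= nm p.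
Proof. by rewrite nm_pair le_max lexx orbT. Qed.

Lemma nm_pair0 (z : C) : nm ((z, 0) : V) = nm z.
Proof. by rewrite nm_pair /= nm0; apply/max_idPl; exact: nm_ge0. Qed.

Lemma dif_fst (p : V) : differentiable (fst : V -> C) p.
Proof.
apply: (@lin_dif V C fst 1) => [a u v //|h].
by rewrite mul1r nm_fst.
Qed.

Lemma dif_snd (p : V) : differentiable (snd : V -> X) p.
Proof.
apply: (@lin_dif V X snd 1) => [a u v //|h].
by rewrite mul1r nm_snd.
Qed.

(** Derivatives in z are written ['d f p (1, 0)] in what follows, so that one joint differential
    carries both the differential equation and holomorphy in the parameter. *)
Lemma dif_slice (f : V -> C) z t : differentiable f (z, t) ->
  is_derive z (1 : C) (fun y => f (y, t)) ('d f (z, t) (1, 0)).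
Proof.
move=> df; apply: isd_of_eps => e e0.
have [d d0 H] := dif_eps df e0; exists d => // h hh.
have := H (h, 0); rewrite nm_pair0 => /(_ hh).
have -> : (z, t) + (h, 0) = (z + h, t) :> V by rewrite -[LHS]/(z + h, t + 0) addr0.
have -> : ((h, 0) : V) = h *: (1, 0) :> V.
  by rewrite -[RHS]/(h *: 1, h *: 0) scaler0; congr pair; exact: esym (mulr1 h).
have e1 : 'd f (z, t) (h *: ((1, 0) : V)) = h * 'd f (z, t) (1, 0) := linearZ _ _.
by move=> h1; move: h1; rewrite [X in _ - X]e1 mulrC.
Qed.

Lemma slice_val (f : V -> C) z t D : differentiable f (z, t) ->
  is_derive z (1 : C) (fun y => f (y, t)) D -> 'd f (z, t) (1, 0) = D.
Proof. by move=> /dif_slice h1 h2; exact: isd_unique h1 h2. Qed.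

End Slices.

(** * Integral operators for the sectorial problem *)

Section Ops.
Variable R : realType.
Local Notation C := R[i].
Variable X : normedModType C.
Local Notation V := (C * X)%type.

Lemma Re_opp (x : C) : complex.Re (- x) = - complex.Re x.
Proof. by case: x. Qed.

Lemma difM (W : normedModType C) (f g : W -> C) p : differentiable f p ->
  differentiable g p -> differentiable (fun q => f q * g q) p.
Proof. exact: differentiableM. Qed.

Lemma dif_cst (W W' : normedModType C) (c : W') (p : W) :
  differentiable (fun _ : W => c) p.
Proof. exact: differentiable_cst. Qed.

Lemma dif_comp1 (W : normedModType C) (g : C -> C) (d : C) (f : W -> C) p :
  differentiable f p -> is_derive (f p) (1 : C) g d ->
  differentiable (fun q => g (f q)) p.
Proof. by move=> df dg; apply: differentiable_comp df (isd_dif dg). Qed.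

Lemma dif_comp (W W' W'' : normedModType C) (f : W -> W') (g : W' -> W'') p :
  differentiable f p -> differentiable g (f p) ->
  differentiable (fun q => g (f q)) p.
Proof. exact: differentiable_comp. Qed.

(** Half of the exponential absorbs the polynomial factor, which arises when the weight |z|^(-m) is
    compared at two points of a ray. With a = del / (2 (m + 1)), the bound j + 2 <= exp(a (j + 2)) /
    a is raised to the power m + 1. *)
Lemma poly_exp (m : nat) (del : R) : 0 < del -> exists2 K : R, 0 <= K &
  forall j : nat, (j%:R + 2) ^+ m * expR (- (del * j%:R)) <= K * expR (- (del / 2)) ^+ j.
Proof.
move=> d0; pose a : R := del / (2 * m.+1%:R).
have a0 : 0 < a by rewrite divr_gt0 // mulr_gt0.
exists (a^-1 ^+ m.+1 * expR del) => [|j].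
  by rewrite mulr_ge0 ?expR_ge0 // exprn_ge0 // invr_ge0 ltW.
have j2 : 1 <= j%:R + 2 :> R by have := ler0n R j; clear; lra.
have j0 : 0 <= j%:R + 2 :> R by apply: le_trans j2.
have h1 : (j%:R + 2) ^+ m <= (j%:R + 2 : R) ^+ m.+1.
  by rewrite exprS ler_peMl // exprn_ge0.
have h2 : ((j%:R + 2) : R) <= a^-1 * expR (a * (j%:R + 2)).
  rewrite mulrC ler_pdivlMr // mulrC; apply: le_trans (expR_ge1Dx _).
  by rewrite lerDr.
have h3 : (j%:R + 2 : R) ^+ m.+1 <= a^-1 ^+ m.+1 * expR (del / 2 * (j%:R + 2)).
  apply: le_trans (_ : (a^-1 * expR (a * (j%:R + 2))) ^+ m.+1 <= _).
    by rewrite ler_pXn2r ?nnegrE // mulr_ge0 ?expR_ge0 // invr_ge0 ltW.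
  rewrite exprMn -expRM_natr.
  have -> // : a * (j%:R + 2) * m.+1%:R = del / 2 * (j%:R + 2).
  by rewrite /a; have : (m.+1%:R : R) != 0 by []; move: (m.+1%:R : R) => q q0; field.
apply: le_trans (ler_wpM2r (expR_ge0 _) (le_trans h1 h3)) _.
rewrite -[leLHS]mulrA -[leRHS]mulrA -expRM_natr -!expRD.
by rewrite le_eqVlt; apply/orP; left; apply/eqP; congr (_ * expR _); field.
Qed.

Variables (D : set C) (TV : set X) (M : R) (m : nat).
Hypotheses (oD : open D) (oTV : open TV) (M1 : 1 <= M) (m0 : (0 < m)%N).
Hypothesis DM : forall z, D z -> M <= nm z.
Hypothesis Drad : forall z (s : R), D z -> 0 <= s -> D (z * (expR s)%:C).

Definition dom : set V := [set p | D p.1 /\ TV p.2].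
Definition wt (p : V) : R := (nm p.1)^-1 ^+ m.

Lemma open_dom : open dom.
Proof.
apply/openC_nm => p [/= p1 p2].
have [d d0 H1] := (openC_nm D).1 oD _ p1.
have [e e0 H2] := (openC_nm TV).1 oTV _ p2.
exists (Num.min d e) => [|q]; first by rewrite lt_min d0.
rewrite lt_min => /andP[q1 q2]; split; [apply: H1|apply: H2].
  by apply: le_lt_trans (nm_fst (q - p)) q1.
by apply: le_lt_trans (nm_snd (q - p)) q2.
Qed.

Lemma dom_gt0 p : dom p -> 0 < nm p.1.
Proof. by move=> [/DM h _]; apply: lt_le_trans (le_trans M1 h). Qed.

Lemma dom_neq0 p : dom p -> p.1 != 0.
Proof. by move=> /dom_gt0; rewrite nm_gt0. Qed.

Lemma wt_ge0 p : 0 <= wt p.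
Proof. by rewrite exprn_ge0 // invr_ge0 nm_ge0. Qed.

Lemma wt_le1 p : dom p -> wt p <= 1.
Proof.
move=> dp; have := dom_gt0 dp; case: dp => /DM h _ p0.
rewrite exprn_ile1 ?invr_ge0 ?nm_ge0 // invf_le1 //; exact: le_trans h.
Qed.

Lemma lb_wt : loc_bounded dom wt.
Proof. by move=> x dx; exists 1 => //; exists 1 => y _; exact: wt_le1. Qed.

Section Radial.
Variables (h : V -> C) (b : R).
Hypotheses (b0 : 0 <= b) (hd : forall p, dom p -> differentiable h p).
Hypothesis hb : forall p, dom p -> nm (h p) <= b * (wt p * (nm p.1)^-1).

(** Integrand of the radial integral of h from z to infinity, after the substitution zeta = z
    e^s. *)
Definition FA (s : C) (p : V) : C := h (p.1 * cexp s, p.2) * (p.1 * cexp s).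

Lemma FA_ds s z t : dom (z * cexp s, t) ->
  is_derive s (1 : C) (FA^~ (z, t))
   ('d h (z * cexp s, t) (1, 0) * (z * cexp s) * (z * cexp s) +
     h (z * cexp s, t) * (z * cexp s)).
Proof.
move=> dz; have h1 := isdZ z (isd_cexp s).
have h2 := isd_comp h1 (dif_slice (hd dz)).
by have := isdM h2 h1 => /isd_eq; apply.
Qed.

Lemma FA_dz s z t : dom (z * cexp s, t) ->
  is_derive z (1 : C) (fun y => FA s (y, t))
   ('d h (z * cexp s, t) (1, 0) * cexp s * (z * cexp s) +
     h (z * cexp s, t) * cexp s).
Proof.
move=> dz; have h1 := isdM (isd_id z) (isd_cst (cexp s) z).
have h2 := isd_comp h1 (dif_slice (hd dz)).
by have := isdM h2 h1 => /isd_eq; apply; rewrite /=; ring.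
Qed.

Lemma dom_rad (s : R) p : 0 <= s -> dom p -> dom (p.1 * cexp s%:C, p.2).
Proof. by move=> s0 [p1 p2]; split=> //=; rewrite cexp_real; exact: Drad. Qed.

Lemma FA_half : half_line dom wt b (expR (-1)) FA.
Proof.
split=> [s p s0 dp|s [z t] s0 dp|j s p js dp].
- have h1 : differentiable (fun q : V => q.1 * cexp s%:C) p.
    by apply: difM (dif_fst p) (dif_cst _ _).
  have hp : differentiable (fun q : V => (q.1 * cexp s%:C, q.2)) p.
    exact: differentiable_pair h1 (dif_snd p).
  exact: difM (dif_comp hp (hd (dom_rad s0 dp))) h1.
- have dz := dom_rad s0 dp.
  have [d d0 Hd] := (openC_nm dom).1 open_dom _ dz.
  have /cont_nmP /(_ _ _) H := isd_cont (isdZ z (isd_cexp s%:C)).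
  have [|e e0 He] := H (d / 2); first by rewrite divr_gt0.
  exists e; first exact: e0.
  move=> y hy; apply: (isd_dif (FA_ds _)); apply: Hd.
  rewrite -[X in nm X]/(z * cexp y - z * cexp s%:C, t - t) subrr nm_pair0.
  by apply: le_lt_trans (He _ hy) _; rewrite ltr_pdivrMr // ltr_pMr // ltr1n.
have s0 : 0 <= s by apply: le_trans (ler0n _ _) _; case/andP: js => js _; exact: js.
have dz := dom_rad s0 dp; have p0 := dom_gt0 dp.
have := hb dz; rewrite /FA nmM /= => h1.
have n0 : 0 < nm (p.1 * cexp s%:C) by exact: (dom_gt0 dz).
apply: le_trans (ler_wpM2r (ltW n0) h1) _.
rewrite (mulrA b) divfK ?gt_eqF // -mulrA ler_wpM2l //.
rewrite /wt /= nmM invfM exprMn mulrC ler_wpM2r ?exprn_ge0 ?invr_ge0 ?nm_ge0 //.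
rewrite nm_cexp /= -expRN -!expRM_natr ler_expR mulNr -mulNr.
have m1 : (1 : R) <= m%:R by rewrite ler1n.
have : j%:R <= s * m%:R.
  by case/andP: js => j1 _; apply: le_trans j1 _; rewrite ler_peMr.
by rewrite !mulNr mul1r lerN2.
Qed.

(** [FA] depends on s and z only through z e^s, so z times its z-derivative is its s-derivative;
    this is the relation required by [hint_deriv]. *)
Lemma FA_rel p : dom p -> forall s : R, 0 <= s ->
  'd (FA s%:C) p (1, 0) = p.1^-1 * 'd (fun z : C => FA z p) (s%:C : C) 1 + 0 * FA s%:C p.
Proof.
case: p => z t dp s s0; have dz := dom_rad s0 dp.
have h1 := FA_ds dz; have h2 := FA_dz dz.
have h3 := slice_val (hl_dif FA_half s0 dp) h2.
have h4 : 'd (fun y : C => FA y (z, t)) (s%:C : C) 1 = _ := isd_val h1 1.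
apply: (etrans h3); rewrite mul0r addr0; apply: esym.
apply: etrans (congr1 (fun u => z^-1 * u) h4) _.
have z0 := dom_neq0 dp; rewrite /= in z0 *.
by move: ('d h _ _) => d1; field.
Qed.

End Radial.

Section Ray.
Variables (kap : X -> C) (d : C) (del : R).
Hypotheses (del0 : 0 < del) (nd : nm d = 1).
Hypothesis kd : forall t, TV t -> differentiable kap t.
Hypothesis kdel : forall t, TV t -> del <= complex.Re (kap t * d).
Hypothesis Dray : forall z (s : R), D z -> 0 <= s -> D (z + s%:C * d).
Variables (h : V -> C) (b : R).
Hypotheses (b0 : 0 <= b) (hd : forall p, dom p -> differentiable h p).
Hypothesis hb : forall p, dom p -> nm (h p) <= b * wt p.

(** Minus the integral of this function over s >= 0 solves g' = kap g + h by variation of constants,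
    integrating from infinity along the ray z + s d, where the exponential decays. *)
Definition FC (s : C) (p : V) : C :=
  cexp (- (kap p.2 * d * s)) * h (p.1 + s * d, p.2) * d.

Lemma FC_ds s z t : dom (z + s * d, t) ->
  is_derive s (1 : C) (FC^~ (z, t))
   (- (kap t * d) * FC s (z, t) +
    cexp (- (kap t * d * s)) * 'd h (z + s * d, t) (1, 0) * d * d).
Proof.
move=> dz.
have h1 := isd_comp (isdN (isdZ (kap t * d) (isd_id s))) (isd_cexp _).
have h2 := isdD (isd_cst z s) (isdM (isd_id s) (isd_cst d s)).
have h3 := isd_comp h2 (dif_slice (hd dz)).
have := isdM (isdM h1 h3) (isd_cst d s) => /isd_eq; apply.
by rewrite /FC /=; move: ('d h _ _) => d1; ring.
Qed.

Lemma FC_dz s z t : dom (z + s * d, t) ->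
  is_derive z (1 : C) (fun y => FC s (y, t))
    (cexp (- (kap t * d * s)) * 'd h (z + s * d, t) (1, 0) * d).
Proof.
move=> dz.
have h2 := isdD (isd_id z) (isd_cst (s * d) z).
have h3 := isd_comp h2 (dif_slice (hd dz)).
have := isdM (isdZ (cexp (- (kap t * d * s))) h3) (isd_cst d z) => /isd_eq; apply.
by move: ('d h _ _) => d1; ring.
Qed.

Lemma dom_ray (s : R) p : 0 <= s -> dom p -> dom (p.1 + s%:C * d, p.2).
Proof. by move=> s0 [p1 p2]; split=> //=; exact: Dray. Qed.

Lemma FC_half K : 0 <= K ->
  (forall j : nat, (j%:R + 2) ^+ m * expR (- (del * j%:R)) <= K * expR (- (del / 2)) ^+ j) ->
  half_line dom wt (b * K) (expR (- (del / 2))) FC.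
Proof.
move=> K0 HK; split=> [s p s0 dp|s [z t] s0 dp|j s p /andP[js1 js2] dp].
- have dq := dom_ray s0 dp; have [_ tp] := dp.
  have h1 : differentiable (fun q : V => kap q.2) p.
    exact: dif_comp (dif_snd p) (kd tp).
  have h2 : differentiable (fun q : V => kap q.2 * d * s%:C) p.
    by apply: difM (difM h1 (dif_cst _ _)) (dif_cst _ _).
  have h3 : differentiable (fun q : V => cexp (- (kap q.2 * d * s%:C))) p.
    apply: (@dif_comp1 _ (fun u => cexp (- u)) _ _ p h2).
    exact: (isd_comp (isdN (isd_id _)) (isd_cexp _)).
  have h4 : differentiable (fun q : V => q.1 + s%:C * d) p.
    by apply: differentiableD (dif_fst p) (dif_cst _ _).
  have hp : differentiable (fun q : V => (q.1 + s%:C * d, q.2)) p.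
    exact: differentiable_pair h4 (dif_snd p).
  exact: difM (difM h3 (dif_comp hp (hd dq))) (dif_cst _ _).
- have dz := dom_ray s0 dp.
  have [e e0 He] := (openC_nm dom).1 open_dom _ dz.
  exists e; first exact: e0.
  move=> y hy; apply: (isd_dif (FC_ds _)); apply: He.
  rewrite -[X in nm X]/(z + y * d - (z + s%:C * d), t - t) subrr nm_pair0.
  have -> : z + y * d - (z + s%:C * d) = (y - s%:C) * d by ring.
  by rewrite nmM nd mulr1.
have s0 : 0 <= s by apply: le_trans js1.
have dq := dom_ray s0 dp; have p0 := dom_gt0 dp; have [_ tp] := dp.
rewrite /FC !nmM nd mulr1 nm_cexp.
have e1 : complex.Re (- (kap p.2 * d * s%:C)) <= - (del * j%:R).
  rewrite [X in - X]mulrC Re_opp Re_rM lerN2.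
  by apply: le_trans (_ : s * del <= _); [rewrite mulrC ler_wpM2r // ltW|rewrite ler_wpM2l // kdel].
(* The ray may first come closer to the origin, but it stays in |z| >= 1, and |z| <= |z + s d| + s
   with s <= j + 1. *)
have q1 : nm p.1 <= (j%:R + 2) * nm (p.1 + s%:C * d).
  have := nmD (p.1 + s%:C * d) (- (s%:C * d)); rewrite addrK nmN nmM nmC nd mulr1 ger0_norm // => h1.
  have h2 : 1 <= nm (p.1 + s%:C * d) by case: dq => /= /DM h2 _; apply: le_trans h2.
  have h3 : s <= j%:R + 1 by rewrite natr1.
  have := ler0n R j; nra.
have q0 : 0 < nm (p.1 + s%:C * d) by exact: (dom_gt0 dq).
have e2 : nm (h (p.1 + s%:C * d, p.2)) <= b * ((j%:R + 2) ^+ m * wt p).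
  apply: le_trans (hb dq) _; rewrite ler_wpM2l // /wt /= -exprMn.
  have j2 : 0 <= j%:R + 2 :> R by rewrite addr_ge0.
  rewrite ler_pXn2r ?nnegrE ?mulr_ge0 ?invr_ge0 ?nm_ge0 //.
  by rewrite ler_pdivlMr // mulrC ler_pdivrMr.
have e1' : expR (complex.Re (- (kap p.2 * d * s%:C))) <= expR (- (del * j%:R)).
  by rewrite ler_expR.
apply: le_trans (ler_pM (expR_ge0 _) (nm_ge0 _) e1' e2) _.
have := ler_wpM2r (wt_ge0 p) (ler_wpM2l b0 (HK j)).
by lra.
Qed.

Lemma FC_rel p K : dom p -> 0 <= K ->
  (forall j : nat, (j%:R + 2) ^+ m * expR (- (del * j%:R)) <= K * expR (- (del / 2)) ^+ j) ->
  forall s : R, 0 <= s ->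
  'd (FC s%:C) p (1, 0) = d^-1 * 'd (fun z : C => FC z p) (s%:C : C) 1 + kap p.2 * FC s%:C p.
Proof.
case: p => z t dp K0 HK s s0; have dz := dom_ray s0 dp.
have h1 := FC_ds dz; have h2 := FC_dz dz.
have h3 := slice_val (hl_dif (FC_half K0 HK) s0 dp) h2.
have h4 : 'd (fun y : C => FC y (z, t)) (s%:C : C) 1 = _ := isd_val h1 1.
apply: (etrans h3); apply: esym.
apply: etrans (congr1 (fun u => d^-1 * u + kap t * FC s%:C (z, t)) h4) _.
have d0 : d != 0 by rewrite -nm_gt0 nd.
by rewrite /=; move: ('d h _ _) (FC _ _) => d1 f1; field.
Qed.

End Ray.

Lemma FA_sub h g s p : FA h s p - FA g s p = FA (fun q => h q - g q) s p.
Proof. by rewrite /FA mulrBl. Qed.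

Lemma FC_sub kap d h g s p :
  FC kap d h s p - FC kap d g s p = FC kap d (fun q => h q - g q) s p.
Proof. by rewrite /FC; ring. Qed.

End Ops.

(** * The integral equations for one column *)

Section Columns.
Variable R : realType.
Local Notation C := R[i].

Lemma dif_sum (W : normedModType C) (I : Type) (r : seq I) (f : I -> W -> C) p :
  (forall i, differentiable (f i) p) ->
  differentiable (fun q => \sum_(i <- r) f i q) p.
Proof.
move=> df; elim: r => [|i r IH].
  rewrite (_ : (fun q => _) = fun=> 0); first exact: dif_cst.
  by apply/funext => q; rewrite big_nil.
rewrite (_ : (fun q => _) = fun q => f i q + \sum_(i <- r) f i q).
  exact: differentiableD (df i) IH.
by apply/funext => q; rewrite big_cons.
Qed.

(** Component a has no exponential to make its integral converge, and radial integration loses one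
    power of z. Hence the extra order required of the diagonal entry in [cd_Ra] and of the
    inhomogeneity in [cd_Ea]. *)
Record column_data (n : nat) (K del : R) (m : nat) (X : normedModType C)
    (D : set C) (TV : set X) (M : R) (a : 'I_n) (kap : 'I_n -> X -> C) (d : 'I_n -> C)
    (Rm : 'I_n -> 'I_n -> C * X -> C) (E : 'I_n -> C * X -> C) : Prop := ColumnData {
  cd_D : open D;
  cd_TV : open TV;
  cd_M : forall z, D z -> M <= nm z;
  cd_rad : forall z (s : R), D z -> 0 <= s -> D (z * (expR s)%:C);
  cd_d : forall c, c != a -> nm (d c) = 1;
  cd_kap : forall c t, c != a -> TV t -> differentiable (kap c) t;
  cd_del : forall c t, c != a -> TV t -> del <= complex.Re (kap c t * d c);
  cd_ray : forall c z (s : R), c != a -> D z -> 0 <= s -> D (z + s%:C * d c);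
  cd_Rd : forall c c' p, dom D TV p -> differentiable (Rm c c') p;
  cd_Ed : forall c p, dom D TV p -> differentiable (E c) p;
  cd_R : forall c c' p, dom D TV p -> nm (Rm c c' p) <= K * (nm p.1)^-1;
  cd_Ra : forall p, dom D TV p -> nm (Rm a a p) <= K * (nm p.1)^-1 ^+ 2;
  cd_E : forall c p, dom D TV p -> nm (E c p) <= K * (nm p.1)^-1 ^+ m;
  cd_Ea : forall p, dom D TV p -> nm (E a p) <= K * (nm p.1)^-1 ^+ m.+1 }.

(* The system g' = kap g + Rm g + E is turned into integral equations: component
   c != a is integrated from infinity along the ray of direction [d c], component
   a along the radius.  The weight L on component a makes the two-step coupling
   contracting. *)
Lemma ex_column (n : nat) (K del : R) (m : nat) : 0 <= K -> 0 < del -> (0 < m)%N ->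
  exists M0 Cc : R, [/\ 1 <= M0, 0 <= Cc &
  forall (X : normedModType C) (D : set C) (TV : set X) (M : R) (a : 'I_n)
    (kap : 'I_n -> X -> C) (d : 'I_n -> C)
    (Rm : 'I_n -> 'I_n -> C * X -> C) (E : 'I_n -> C * X -> C),
  M0 <= M -> column_data K del m D TV M a kap d Rm E ->
  exists g : 'I_n -> C * X -> C,
   [/\ forall c p, dom D TV p -> differentiable (g c) p,
       forall c p, dom D TV p -> nm (g c p) <= Cc * (nm p.1)^-1 ^+ m
     & forall c p, dom D TV p -> 'd (g c) p (1, 0) =
         (if c == a then 0 else kap c p.2) * g c p +
         (\sum_c' Rm c c' p * g c' p + E c p)]].
Proof.
move=> K0 del0 m0.
have [K1 K10 HK1] := poly_exp m del0.
pose r1 := expR (- (del / 2)); pose r2 := expR (- 1) : R.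
have r101 : 0 <= r1 < 1.
  by rewrite expR_ge0 /r1 expR_lt1 oppr_lt0 divr_gt0.
have r201 : 0 <= r2 < 1.
  by rewrite expR_ge0 /r2 expR_lt1 ltrN10.
have [A1 A1E] : exists A1, A1 = K1 / (1 - r1) by eexists.
have [A2 A2E] : exists A2, A2 = (1 - r2)^-1 by eexists.
have A10 : 0 <= A1 by rewrite A1E divr_ge0 // subr_ge0; case/andP: r101 => _ /ltW.
have A20 : 0 <= A2 by rewrite A2E invr_ge0 subr_ge0; case/andP: r201 => _ /ltW.
have [N NE] : exists N : R, N = n%:R by eexists.
have N0 : 0 <= N by rewrite NE ler0n.
(* The effect of the other components on component a does not become small for large z; it is
   divided by L in the weighted norm, which makes it at most a quarter. *)
have [L LE] : exists L, L = 4 * A2 * K * N + 1 by eexists.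
have L1 : 1 <= L by rewrite LE lerDr !mulr_ge0.
have L0 : 0 <= L by apply: le_trans L1.
(* The remaining terms carry a factor 1/|z|: with L fixed, the second summand makes the components c
   != a contract, the third the action of component a on itself. *)
have [M0 M0E] : exists M0, M0 = 1 + 2 * A1 * K * N * L + 4 * A2 * K by eexists.
have [B0 B0E] : exists B0, B0 = (A1 + A2) * K by eexists.
have B00 : 0 <= B0 by rewrite B0E mulr_ge0 // addr_ge0.
exists M0, (2 * B0 * L); split.
- by rewrite M0E -addrA lerDl addr_ge0 // !mulr_ge0.
- by rewrite !mulr_ge0.
move=> X D TV M a kap d Rm E M0M [oD oTV DM Drad nd kd kdel Dray Rd Ed bR bRa bE bEa].
have M1 : 1 <= M.
  by apply: le_trans M0M; rewrite M0E -addrA lerDl addr_ge0 // !mulr_ge0.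
pose V := (C * X)%type.
pose U : set V := dom D TV.
have oU : open U := open_dom oD oTV.
pose w : V -> R := wt m.
pose phi (c : 'I_n) (p : V) := (if c == a then L else 1) * w p.
have w0 p : 0 <= w p := wt_ge0 m p.
have phi0 c p : U p -> 0 <= phi c p by move=> _; rewrite mulr_ge0 //; case: ifP.
have phiL c p : phi c p <= L * w p by rewrite /phi; case: ifP => _; rewrite ?lexx // ler_wpM2r.
have lw : loc_bounded U w := lb_wt m M1 DM.
have lphi c : loc_bounded U (phi c).
  move=> x /lw [e e0 [b Hb]]; exists e => //; exists (L * b) => y y1 y2.
  by apply: le_trans (phiL _ _) _; rewrite ler_wpM2l // Hb.
pose H (f : 'I_n -> V -> C) (c : 'I_n) (p : V) := \sum_c' Rm c c' p * f c' p + E c p.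
pose T (f : 'I_n -> V -> C) (c : 'I_n) (p : V) : C :=
  if c == a then - hint (FA (H f c)) p else - hint (FC (kap c) (d c) (H f c)) p.
have Hd f c p : (forall c' p, U p -> differentiable (f c') p) -> U p -> differentiable (H f c) p.
  move=> df Up; apply: differentiableD (Ed c p Up).
  by apply: dif_sum => i; apply: difM; [exact: Rd|exact: df].
pose S (f : 'I_n -> V -> C) (c : 'I_n) (p : V) := \sum_c' Rm c c' p * f c' p.
have pinv p : U p -> 0 <= (nm p.1)^-1 by move=> _; rewrite invr_ge0 nm_ge0.
have pM p : U p -> M * (nm p.1)^-1 <= 1.
  move=> Up; have p0 := dom_gt0 M1 DM Up; rewrite ler_pdivrMr // mul1r.
  by apply: DM; case: Up.
have Sb f b c p : 0 <= b -> (forall c p, U p -> nm (f c p) <= b * phi c p) -> U p ->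
    nm (S f c p) <= b * (K * N * L) * (w p * (nm p.1)^-1).
  move=> b0 Hf Up; apply: le_trans (nm_sum _ _ _) _.
  apply: (@le_trans _ _ (\sum_(c' < n) b * (K * L) * (w p * (nm p.1)^-1))).
    apply: ler_sum => c' _; rewrite nmM.
    apply: le_trans (ler_pM (nm_ge0 _) (nm_ge0 _) (bR c c' p Up) (Hf c' p Up)) _.
    have := ler_wpM2l (mulr_ge0 (mulr_ge0 K0 (pinv p Up)) b0) (phiL c' p).
    by clear; lra.
  rewrite sumr_const card_ord -mulr_natr -NE.
  by rewrite le_eqVlt; apply/orP; left; apply/eqP; clear; ring.
(* In row a the large weight L occurs only with the diagonal entry, which is of order |z|^(-2). *)
have Sba f b p : 0 <= b -> (forall c p, U p -> nm (f c p) <= b * phi c p) -> U p ->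
    nm (S f a p) <= b * (K * N + K * L * (nm p.1)^-1) * (w p * (nm p.1)^-1).
  move=> b0 Hf Up; rewrite /S (bigD1 a) //= mulrDr mulrDl addrC.
  apply: le_trans (nmD _ _) _; apply: lerD.
    apply: le_trans (nm_sum _ _ _) _.
    apply: (@le_trans _ _ (\sum_(c' < n | c' != a) b * K * (w p * (nm p.1)^-1))).
      apply: ler_sum => c' ca; rewrite nmM.
      apply: le_trans (ler_pM (nm_ge0 _) (nm_ge0 _) (bR a c' p Up) (Hf c' p Up)) _.
      by rewrite /phi (negbTE ca) mul1r; clear; lra.
    apply: (@le_trans _ _ (\sum_(c' < n) b * K * (w p * (nm p.1)^-1))).
      rewrite [leRHS](bigD1 a) //= lerDr.
      by rewrite !mulr_ge0 // pinv.
    rewrite sumr_const card_ord -mulr_natr -NE.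
    by rewrite le_eqVlt; apply/orP; left; apply/eqP; clear; ring.
  rewrite nmM.
  apply: le_trans (ler_pM (nm_ge0 _) (nm_ge0 _) (bRa p Up) (Hf a p Up)) _.
  by rewrite /phi eqxx; clear; lra.
have Hb f b c p : 0 <= b -> (forall c p, U p -> nm (f c p) <= b * phi c p) -> U p ->
    nm (H f c p) <= (b * (K * N * L) + K) * w p.
  move=> b0 Hf Up; apply: le_trans (nmD _ _) _; rewrite mulrDl.
  apply: lerD (bE c p Up); apply: le_trans (Sb f b c p b0 Hf Up) _.
  rewrite mulrA ler_piMr ?mulr_ge0 //.
  have := pM p Up; apply: le_trans; rewrite ler_peMl // pinv //.
have Hba f b p : 0 <= b -> (forall c p, U p -> nm (f c p) <= b * phi c p) -> U p ->
    nm (H f a p) <= (b * (K * N * L) + K) * (w p * (nm p.1)^-1).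
  move=> b0 Hf Up; apply: le_trans (nmD _ _) _; rewrite mulrDl.
  apply: lerD (Sb f b a p b0 Hf Up) _.
  by have := bEa p Up; rewrite exprSr.
have hlA f b : 0 <= b -> (forall c p, U p -> differentiable (f c) p) ->
   (forall p, U p -> nm (f a p) <= b * (w p * (nm p.1)^-1)) ->
   half_line U w b r2 (FA (f a)).
  move=> b0 fd fb; apply: (FA_half oD oTV M1 m0 DM Drad b0 _ fb) => p Up; exact: fd.
have hlC f b c : c != a -> 0 <= b -> (forall c p, U p -> differentiable (f c) p) ->
   (forall p, U p -> nm (f c p) <= b * w p) ->
   half_line U w (b * K1) r1 (FC (kap c) (d c) (f c)).
  move=> ca b0 fd fb; apply: (FC_half oD oTV M1 m0 DM del0 (nd c ca) _ _ _ b0 _ fb K10 HK1).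
  - by move=> t; apply: kd.
  - by move=> t; apply: kdel.
  - by move=> z s; apply: Dray.
  - by move=> p; apply: fd.
have hA1 f b p : 0 <= b -> (forall c p, U p -> differentiable (f c) p) ->
   (forall p, U p -> nm (f a p) <= b * (w p * (nm p.1)^-1)) -> U p ->
   nm (hint (FA (f a)) p) <= b * A2 * w p.
  by move=> b0 fd fb; rewrite A2E; apply: (hint_le b0 r201 _ (hlA f b b0 fd fb)).
have hC1 f b c p : c != a -> 0 <= b -> (forall c p, U p -> differentiable (f c) p) ->
   (forall p, U p -> nm (f c p) <= b * w p) -> U p ->
   nm (hint (FC (kap c) (d c) (f c)) p) <= b * A1 * w p.
  move=> ca b0 fd fb Up; rewrite A1E mulrA.
  exact: (hint_le (mulr_ge0 b0 K10) r101 _ (hlC f b c ca b0 fd fb) Up).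
have Hall f : adm U phi f -> exists b, [/\ 0 <= b,
   forall c p, U p -> differentiable (H f c) p,
   forall c p, U p -> nm (H f c p) <= b * w p &
   forall p, U p -> nm (H f a p) <= b * (w p * (nm p.1)^-1)].
  move=> [fd [b b0 fb]]; exists (b * (K * N * L) + K); split.
  - by rewrite addr_ge0 // !mulr_ge0.
  - by move=> c p; apply: Hd.
  - by move=> c p; apply: Hb.
  - by move=> p; apply: Hba.
have [|||g [gd gb gT]] := @fixed_point R V 'I_n U phi oU lphi phi0 T B0 B00.
- move=> f /Hall [b [b0 h1 h2 h3]] c p Up; rewrite /T; have [->|ca] := eqVneq c a.
    apply: differentiableN.
    by have [] := hint_dif oU lw b0 r201 (fun p _ => w0 p) (hlA _ b b0 h1 h3) Up.
  apply: differentiableN.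
  by have [] := hint_dif oU lw (mulr_ge0 b0 K10) r101 (fun p _ => w0 p) (hlC _ b c ca b0 h1 (h2 c)) Up.
- move=> f g af ag c0 c00 fg c p Up.
  have [b [b0 f1 f2 f3]] := Hall f af; have [b' [b0' g1 g2 g3]] := Hall g ag.
  pose bb := b + b'; have bb0 : 0 <= bb by rewrite addr_ge0.
  have mono (x : R) : 0 <= x -> b * x <= bb * x /\ b' * x <= bb * x.
    by move=> x0; split; rewrite ler_wpM2r // ?lerDl ?lerDr.
  have wi0 q : U q -> 0 <= w q * (nm q.1)^-1 by move=> Uq; rewrite mulr_ge0 // pinv.
  have f2' c' q : U q -> nm (H f c' q) <= bb * w q.
    by move=> Uq; apply: le_trans (f2 c' q Uq) _; have [] := mono _ (w0 q).
  have g2' c' q : U q -> nm (H g c' q) <= bb * w q.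
    by move=> Uq; apply: le_trans (g2 c' q Uq) _; have [] := mono _ (w0 q).
  have f3' q : U q -> nm (H f a q) <= bb * (w q * (nm q.1)^-1).
    by move=> Uq; apply: le_trans (f3 q Uq) _; have [] := mono _ (wi0 q Uq).
  have g3' q : U q -> nm (H g a q) <= bb * (w q * (nm q.1)^-1).
    by move=> Uq; apply: le_trans (g3 q Uq) _; have [] := mono _ (wi0 q Uq).
  pose dl c' q := f c' q - g c' q; pose Dl c' q := H f c' q - H g c' q.
  have DlE c' q : Dl c' q = S dl c' q.
    rewrite /Dl /H /S opprD addrACA subrr addr0 -sumrB.
    by apply: eq_bigr => i _; rewrite mulrBr.
  have Dld c' q : U q -> differentiable (Dl c') q.
    by move=> Uq; apply: differentiableB; [exact: f1|exact: g1].
  rewrite /T; have [->|ca] := eqVneq c a.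
    rewrite -opprD nmN (hintB bb0 r201 (fun p _ => w0 p) (hlA _ _ bb0 f1 f3') (hlA _ _ bb0 g1 g3') Up).
    have -> : (fun s q => FA (H f a) s q - FA (H g a) s q) = FA (Dl a).
      by apply/funext => s; apply/funext => q; rewrite FA_sub.
    have h0 : 0 <= c0 * (K * N + K * L / M).
      by rewrite mulr_ge0 // addr_ge0 ?mulr_ge0 // invr_ge0 (le_trans ler01).
    apply: le_trans (hA1 Dl _ p h0 Dld _ Up) _ => [q Uq|].
      rewrite DlE; apply: le_trans (Sba dl c0 q c00 fg Uq) _.
      apply: ler_wpM2r; first exact: wi0.
      apply: ler_wpM2l => //; rewrite lerD2l ler_wpM2l ?mulr_ge0 //.
      have M00 : 0 < M by apply: lt_le_trans M1.
      by have := pM q Uq; rewrite mulrC -ler_pdivlMr // div1r.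
    rewrite /phi eqxx mulrA; apply: ler_wpM2r => //.
    have M00 : 0 < M by apply: lt_le_trans M1.
    have e1 : 4 * A2 * K <= M by apply: le_trans M0M; rewrite M0E lerDr addr_ge0 // !mulr_ge0.
    have e2 : 4 * (A2 * (K * L / M)) <= L.
      have -> : 4 * (A2 * (K * L / M)) = (4 * A2 * K) * (L / M) by clear; ring.
      apply: le_trans (ler_wpM2r _ e1) _; first by rewrite divr_ge0 // ltW.
      by rewrite mulrC divfK // gt_eqF.
    have e3 : 4 * (A2 * (K * N)) <= L by rewrite LE; clear; lra.
    have : 0 <= c0 * (L - 2 * (A2 * (K * N + K * L / M))).
      by rewrite mulr_ge0 // subr_ge0; clear -e2 e3; lra.
    by clear; lra.
  rewrite -opprD nmN (hintB (mulr_ge0 bb0 K10) r101 (fun p _ => w0 p) (hlC _ _ _ ca bb0 f1 (f2' c)) (hlC _ _ _ ca bb0 g1 (g2' c)) Up).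
  have -> : (fun s q => FC (kap c) (d c) (H f c) s q - FC (kap c) (d c) (H g c) s q) = FC (kap c) (d c) (Dl c).
    by apply/funext => s; apply/funext => q; rewrite FC_sub.
  have h0 : 0 <= c0 * (K * N * L) / M.
    by rewrite !mulr_ge0 // invr_ge0 (le_trans ler01).
  apply: le_trans (hC1 Dl _ c p ca h0 Dld _ Up) _ => [q Uq|].
    rewrite DlE; apply: le_trans (Sb dl c0 c q c00 fg Uq) _.
    have M00 : 0 < M by apply: lt_le_trans M1.
    have h4 : (nm q.1)^-1 <= M^-1.
      by have := pM q Uq; rewrite mulrC -ler_pdivlMr // div1r.
    have h5 : 0 <= c0 * (K * N * L) * w q by rewrite !mulr_ge0.
    have := ler_wpM2l h5 h4; clear; lra.
  rewrite /phi (negbTE ca) mul1r; apply: ler_wpM2r => //.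
  have M00 : 0 < M by apply: lt_le_trans M1.
  have e1 : 2 * A1 * K * N * L <= M.
    apply: le_trans M0M; rewrite M0E addrAC lerDr addr_ge0 // !mulr_ge0 //.
  rewrite mulrAC ler_pdivrMr //.
  have := ler_wpM2l c00 e1; clear; lra.
- move=> c p Up; rewrite /T.
  have z0 : adm U phi (fun _ _ => 0).
    by split=> [i q _|]; [exact: dif_cst|exists 0 => // i q _; rewrite nm0 mul0r].
  have HE : H (fun _ _ => 0) = E.
    apply/funext => c'; apply/funext => q; rewrite /H big1 ?add0r // => i _.
    by rewrite mulr0.
  rewrite HE; have [->|ca] := eqVneq c a.
    rewrite nmN; apply: le_trans (hA1 E K p K0 Ed _ Up) _ => [q Uq|].
      by have := bEa q Uq; rewrite exprSr.
    rewrite /phi eqxx mulrA; apply: ler_wpM2r => //.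
    apply: (@le_trans _ _ (B0 * 1)); last by rewrite ler_wpM2l.
    by rewrite mulr1 mulrC B0E ler_wpM2r // lerDr.
  rewrite nmN; apply: le_trans (hC1 E K c p ca K0 Ed _ Up) _ => [q Uq|].
    exact: bE.
  rewrite /phi (negbTE ca) mul1r; apply: ler_wpM2r => //.
  by rewrite mulrC B0E ler_wpM2r // lerDl.
exists g; split=> // [c p Up|c p Up].
  apply: le_trans (gb c p Up) _.
  by apply: le_trans (ler_wpM2l _ (phiL c p)) _; rewrite ?mulr_ge0 // mulrA.
have ag : adm U phi g.
  by split=> //; exists (2 * B0); [rewrite mulr_ge0|exact: gb].
have [b [b0 h1 h2 h3]] := Hall g ag.
have dN (F G : V -> C) q : open U -> (forall q, U q -> F q = - G q) -> U q ->
    differentiable F q -> differentiable G q -> 'd F q (1, 0) = - 'd G q (1, 0).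
  move=> _ FG Uq dF dG; case: q Uq dF dG => z t Uq dF dG.
  have [e e0 He] := (openC_nm U).1 oU _ Uq.
  have k1 := isdN (dif_slice dG).
  apply: (slice_val dF); apply: isd_congr k1; exists e; first exact: e0.
  move=> y hy; apply: esym; apply: FG; apply: He.
  by rewrite -[X in nm X]/(y - z, t - t) subrr nm_pair0.
have [->|ca] := eqVneq c a.
  have hl := hlA _ b b0 h1 h3.
  have [d1 _] := hint_dif oU lw b0 r201 (fun p _ => w0 p) hl Up.
  apply: etrans (dN _ _ p oU _ Up (gd a p Up) d1) _.
    by move=> q Uq; rewrite gT // /T eqxx.
  have rel := FA_rel oD oTV M1 m0 DM Drad b0 (fun q Uq => h1 a q Uq) h3 Up.
  have := hint_deriv oU lw b0 r201 (fun p _ => w0 p) hl Up rel.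
  move=> rl; apply: etrans (congr1 (fun u => - u) rl) _.
  have p0 := dom_neq0 M1 DM Up.
  rewrite /FA cexp0 mulr1 !mul0r addr0 add0r opprK mulrC mulfK //.
  by rewrite -surjective_pairing.
have hl := hlC _ b c ca b0 h1 (h2 c).
have [d1 _] := hint_dif oU lw (mulr_ge0 b0 K10) r101 (fun p _ => w0 p) hl Up.
apply: etrans (dN _ _ p oU _ Up (gd c p Up) d1) _.
  by move=> q Uq; rewrite gT // /T (negbTE ca).
have rel := FC_rel oD oTV M1 m0 DM del0 (nd c ca) (fun t => @kd c t ca) (fun t => @kdel c t ca)
   (fun z s => @Dray c z s ca) b0 (fun q Uq => h1 c q Uq) (h2 c) Up K10 HK1.
have := hint_deriv oU lw (mulr_ge0 b0 K10) r101 (fun p _ => w0 p) hl Up rel.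
move=> rl; apply: etrans (congr1 (fun u => - u) rl) _.
have d0 : d c != 0 by rewrite -nm_gt0 nd.
rewrite /FC mulr0 oppr0 cexp0 mul1r mul0r addr0 -surjective_pairing.
rewrite mulrCA mulVf // mulr1 opprD opprK addrC.
by rewrite gT // /T (negbTE ca) mulrN.
Qed.

End Columns.

(** * Linear equations with parameters *)

Section LinearODE.
Variable R : realType.
Local Notation C := R[i].

Lemma rs_le_primitive (F : C -> C) (g G : R -> R) :
  (forall s : R, 0 <= s <= 1 -> nm (F s%:C) <= g s) ->
  (forall s t : R, 0 <= s -> s <= t -> t <= 1 -> (t - s) * g s <= G t - G s) ->
  forall n (s h : R), 0 <= s -> 0 <= h -> s + h <= 1 ->
    nm (rs n s%:C h%:C F) <= G (s + h) - G s.
Proof.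
move=> Fg gG; elim=> [|n IH] s h s0 h0 sh /=.
  rewrite nmM nmC ger0_norm //.
  have s1 : s <= 1 by apply: le_trans sh; rewrite lerDl.
  have h1 := gG s (s + h) s0 _ sh; rewrite lerDl addrAC subrr add0r in h1.
  by apply: le_trans (h1 h0); rewrite ler_wpM2l // Fg // s0.
have e2 : h%:C / 2 = (h / 2)%:C :> C by rewrite rmorphM fmorphV rmorph_nat.
rewrite e2 -rmorphD /=; apply: le_trans (nmD _ _) _.
have h2 : 0 <= h / 2 by rewrite divr_ge0.
have e3 : s + h / 2 + h / 2 = s + h by rewrite -addrA -splitr.
have h3 : s + h / 2 <= 1 by clear -sh h0; lra.
have := IH s (h / 2) s0 h2 h3.
have := IH (s + h / 2) (h / 2) (addr_ge0 s0 h2) h2; rewrite e3 => /(_ sh).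
by clear; lra.
Qed.

(** The majorant g is integrated through a function G whose increments dominate its left Riemann
    sums, so no real integral is needed. *)
Lemma pint_le_primitive (F : C -> C) (g G : R -> R) : seg_cont 0 1 F ->
  (forall s : R, 0 <= s <= 1 -> nm (F s%:C) <= g s) ->
  (forall s t : R, 0 <= s -> s <= t -> t <= 1 -> (t - s) * g s <= G t - G s) ->
  nm (pint 0 1 F) <= G 1 - G 0.
Proof.
move=> cF Fg gG; apply: (cvgC_nm_le (pint_cvg cF)) => n.
by have := rs_le_primitive Fg gG n (lexx 0) ler01; rewrite !add0r lexx; apply.
Qed.

Lemma expR_tangent (x y : R) : (x - y) * expR y <= expR x - expR y.
Proof.
have -> : expR x = expR (x - y) * expR y by rewrite -expRD subrK.
rewrite -[X in _ <= _ - X]mul1r -mulrBl ler_wpM2r ?expR_ge0 //.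
by have := expR_ge1Dx (x - y); clear; lra.
Qed.

(** The tangent inequality of the exponential, used at both levels of the iterated exponential. *)
Lemma dexp_tangent (k rho s t : R) : 0 <= k -> 0 <= rho -> s <= t ->
  (t - s) * (k * rho * expR (rho * s) * expR (k * expR (rho * s))) <=
  expR (k * expR (rho * t)) - expR (k * expR (rho * s)).
Proof.
move=> k0 r0 st; apply: le_trans (expR_tangent _ _).
rewrite -mulrBr; have h := expR_tangent (rho * t) (rho * s).
have e0 := expR_ge0 (k * expR (rho * s)).
have := ler_wpM2r e0 (ler_wpM2l k0 h); rewrite -mulrBr; clear; lra.
Qed.

Variables (n : nat) (X : normedModType C) (TV : set X) (l Ka : R).
Variable a : 'I_n -> 'I_n -> C * X -> C.
Local Notation V := (C * X)%type.
Definition hplane : set C := [set w | l < complex.Re w].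
Hypotheses (oTV : open TV) (Ka0 : 0 <= Ka).
Hypothesis ad : forall i j p, dom hplane TV p -> differentiable (a i j) p.
Hypothesis ab : forall i j p, dom hplane TV p -> nm (a i j p) <= Ka * expR (complex.Re p.1).
Variable w1 : C.
Hypothesis w1l : hplane w1.

Lemma open_hplane : open hplane.
Proof.
apply/openC_nm => w hw; exists (complex.Re w - l); first by rewrite subr_gt0.
move=> y hy; rewrite /hplane /=.
have := Re_le_nm (y - w); rewrite Re_add Re_opp ler_norml => /andP[h _].
by move: h hy; lra.
Qed.

Lemma seg_hplane w : hplane w -> forall s, seg 0 1 s -> hplane (w1 + s * (w - w1)).
Proof.
move=> hw s [r /andP[r0 r1] ->]; rewrite /hplane /= add0r mulr1 Re_add Re_rM.
rewrite Re_add Re_opp; move: hw w1l; rewrite /hplane /= => hw hw1.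
have [h|/ltW h] := leP (complex.Re w1) (complex.Re w).
  by apply: lt_le_trans hw1 _; rewrite lerDl mulr_ge0 // subr_ge0.
apply: lt_le_trans hw _; rewrite -lerBlDl -[leRHS]opprK -mulrN opprB lerNr opprB.
by rewrite ler_piMl // subr_ge0.
Qed.

Local Notation U := (dom hplane TV).

Lemma linear_ode (y : 'I_n -> C) : exists f : 'I_n -> V -> C,
  [/\ forall i p, U p -> differentiable (f i) p,
      forall i t, TV t -> f i (w1, t) = y i
    & forall i p, U p -> 'd (f i) p (1, 0) = \sum_j a i j p * f j p].
Proof.
have oU : open U := open_dom open_hplane oTV.
have [Kb KbE] : exists Kb, Kb = Ka * expR (complex.Re w1) by eexists.
have Kb0 : 0 <= Kb by rewrite KbE mulr_ge0 // expR_ge0.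
have [N NE] : exists N : R, N = n%:R by eexists.
have N0 : 0 <= N by rewrite NE ler0n.
have [k kE] : exists k, k = 2 * N * Kb + 1 by eexists.
have k1 : 1 <= k by rewrite kE lerDr !mulr_ge0.
have k0 : 0 <= k by apply: le_trans k1.
pose rho (p : V) := nm (p.1 - w1).
have rho0 p : 0 <= rho p := nm_ge0 _.
pose th (x : R) := expR (k * expR x).
have th_mono x x' : x <= x' -> th x <= th x'.
  by move=> h; rewrite ler_expR ler_wpM2l // ler_expR.
have th0 x : 0 < th x := expR_gt0 _.
pose phi (p : V) := th (rho p).
have lrho (F : R -> R) : (forall x x', 0 <= x -> x <= x' -> F x <= F x') -> loc_bounded U (fun p => F (rho p)).
  move=> mono x _; exists 1 => //; exists (F (rho x + 1)) => q hq _; apply: mono => //.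
  apply: le_trans (nm_tri _ x.1 _) _; rewrite addrC lerD2l.
  by apply: le_trans (nm_fst (q - x)) (ltW hq).
have lphi : loc_bounded U phi by apply: lrho => x x' _; exact: th_mono.
have phi0 p : U p -> 0 <= phi p by move=> _; exact: ltW (th0 _).
pose pt (s : C) (p : V) : V := (w1 + s * (p.1 - w1), p.2).
have Upt s p : seg 0 1 s -> U p -> U (pt s p).
  by move=> hs [p1 p2]; split=> //=; apply: seg_hplane.
pose H (f : 'I_n -> V -> C) i p := \sum_j a i j p * f j p.
pose F f i (s : C) (p : V) : C := H f i (pt s p) * (p.1 - w1).
pose T (f : 'I_n -> V -> C) i p := y i + pint 0 1 ((F f i)^~ p).
have Hd f i p : (forall j q, U q -> differentiable (f j) q) -> U p -> differentiable (H f i) p.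
  move=> fd Up; apply: dif_sum => j; apply: difM; [exact: ad|exact: fd].
have ptd s p : differentiable (pt s) p.
  have h1 : differentiable (fun q : V => q.1 - w1) p.
    exact: differentiableB (dif_fst p) (dif_cst _ _).
  have h2 : differentiable (fun q : V => w1 + s * (q.1 - w1)) p.
    exact: differentiableD (dif_cst _ _) (difM (dif_cst _ _) h1).
  exact: differentiable_pair h2 (dif_snd p).
have Fd f i s p : (forall j q, U q -> differentiable (f j) q) -> seg 0 1 s -> U p ->
    differentiable (F f i s) p.
  move=> fd hs Up.
  have h1 : differentiable (fun q : V => q.1 - w1) p.
    exact: differentiableB (dif_fst p) (dif_cst _ _).
  exact: difM (dif_comp (ptd s p) (Hd f i _ fd (Upt _ _ hs Up))) h1.
have Hs f i s w t : (forall j q, U q -> differentiable (f j) q) -> U (pt s (w, t)) ->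
    is_derive s (1 : C) (fun s => H f i (pt s (w, t)))
      ('d (H f i) (pt s (w, t)) (1, 0) * (w - w1)).
  move=> fd Us.
  have h1 := isdD (isd_cst w1 s) (isdM (isd_id s) (isd_cst (w - w1) s)).
  have := isd_comp h1 (dif_slice (Hd f i (pt s (w, t)) fd Us)) => /isd_eq; apply.
  by move: ('d _ _ _) => q; ring.
have nearU s w t : U (pt s (w, t)) -> exists2 e : R, 0 < e &
    forall s', nm (s' - s) < e -> U (pt s' (w, t)).
  move=> Us; have [e e0 He] := (openC_nm U).1 oU _ Us.
  have n1 : 0 < nm (w - w1) + 1 by rewrite ltr_wpDl // nm_ge0.
  exists (e / (nm (w - w1) + 1)); first by rewrite divr_gt0.
  move=> s' hs'; apply: He.
  rewrite -[X in nm X]/(w1 + s' * (w - w1) - (w1 + s * (w - w1)), t - t) subrr nm_pair0.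
  have -> : w1 + s' * (w - w1) - (w1 + s * (w - w1)) = (s' - s) * (w - w1) by ring.
  rewrite nmM; move: hs'; rewrite ltr_pdivlMr //; apply: le_lt_trans.
  by rewrite ler_wpM2l ?nm_ge0 // lerDl.
have Fc f i p : (forall j q, U q -> differentiable (f j) q) -> U p -> seg_cont 0 1 ((F f i)^~ p).
  case: p => w t fd Up s hs.
  exact: isd_cont (isdM (Hs f i s w t fd (Upt _ _ hs Up)) (isd_cst (w - w1) s)).
have apt (s : R) p i j : 0 <= s <= 1 -> U p -> nm (a i j (pt s%:C p)) <= Kb * expR (rho p * s).
  move=> /andP[s0 s1] Up.
  have hs : seg 0 1 (s%:C : C) by exists s; rewrite ?s0 // add0r mulr1.
  apply: le_trans (ab i j (Upt _ _ hs Up)) _.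
  rewrite KbE -mulrA -expRD ler_wpM2l // ler_expR /= Re_add lerD2l Re_rM mulrC.
  by rewrite ler_wpM2r //; apply: le_trans (ler_norm _) (Re_le_nm _).
have rpt (s : R) p : 0 <= s -> rho (pt s%:C p) = rho p * s.
  by move=> s0; rewrite /rho /pt /= addrAC subrr add0r nmM nmC ger0_norm // mulrC.
have Fb f i c (s : R) p : 0 <= c -> (forall j q, U q -> nm (f j q) <= c * phi q) ->
    0 <= s <= 1 -> U p ->
    nm (F f i s%:C p) <= N * Kb * c * (rho p * expR (rho p * s) * th (rho p * s)).
  move=> c0 fb s01 Up; rewrite /F nmM.
  have hs : seg 0 1 (s%:C : C) by exists s; rewrite ?s01 // add0r mulr1.
  have h : nm (H f i (pt s%:C p)) <= N * (Kb * expR (rho p * s) * (c * th (rho p * s))).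
    apply: le_trans (nm_sum _ _ _) _.
    apply: (@le_trans _ _ (\sum_(j < n) Kb * expR (rho p * s) * (c * th (rho p * s)))).
      apply: ler_sum => j _; rewrite nmM; apply: ler_pM; rewrite ?nm_ge0 ?apt //.
      have := fb j _ (Upt _ _ hs Up); rewrite /phi rpt //; by case/andP: s01.
    by rewrite sumr_const card_ord -mulr_natl -NE.
  apply: le_trans (ler_wpM2r (rho0 p) h) _.
  by rewrite le_eqVlt; apply/orP; left; apply/eqP; ring.
pose big (c x : R) := N * Kb * c * (x * expR x * th x).
have bigm c x x' : 0 <= c -> 0 <= x -> x <= x' -> big c x <= big c x'.
  move=> c0 x0 xx; rewrite /big ler_wpM2l ?mulr_ge0 //.
  apply: ler_pM; rewrite ?mulr_ge0 ?expR_ge0 ?(ltW (th0 _)) ?th_mono //.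
  by apply: ler_pM; rewrite ?expR_ge0 ?ler_expR.
have Fbig f i c s p : 0 <= c -> (forall j q, U q -> nm (f j q) <= c * phi q) ->
    seg 0 1 s -> U p -> nm (F f i s p) <= big c (rho p).
  move=> c0 fb [r r01 ->] Up; rewrite add0r mulr1.
  apply: le_trans (Fb f i c r p c0 fb r01 Up) _; rewrite /big ler_wpM2l ?mulr_ge0 //.
  have rr : rho p * r <= rho p by rewrite ler_piMr //; case/andP: r01.
  have rr0 : 0 <= rho p * r by rewrite mulr_ge0 //; case/andP: r01.
  apply: ler_pM; rewrite ?mulr_ge0 ?expR_ge0 ?(ltW (th0 _)) ?th_mono //.
  by apply: ler_wpM2l => //; rewrite ler_expR.
have lbig c : 0 <= c -> loc_bounded U (fun p => big c (rho p)).
  by move=> c0; apply: (lrho (big c)) => x x'; exact: bigm.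
have Tint f i c p : 0 <= c -> (forall j q, U q -> differentiable (f j) q) ->
    (forall j q, U q -> nm (f j q) <= c * phi q) -> U p ->
    nm (pint 0 1 ((F f i)^~ p)) <= c / 2 * phi p.
  move=> c0 fd fb Up.
  have h := @pint_le_primitive ((F f i)^~ p)
    (fun s => N * Kb * c * (rho p * expR (rho p * s) * th (rho p * s)))
    (fun s => c / 2 * th (rho p * s)) (Fc f i p fd Up) (fun s hs => Fb f i c s p c0 fb hs Up) _.
  apply: le_trans (h _) _ => [s t s0 st t1|].
    have := dexp_tangent k0 (rho0 p) st; rewrite -/(th _) -/(th _) => h1.
    rewrite -mulrBr; have c2 : 0 <= c / 2 by rewrite divr_ge0.
    apply: le_trans (ler_wpM2l c2 h1).
    have ts : 0 <= t - s by rewrite subr_ge0.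
    have pos : 0 <= (t - s) * c * (rho p * expR (rho p * s) * th (rho p * s)).
      by rewrite !mulr_ge0 ?expR_ge0 ?(ltW (th0 _)).
    have nk : N * Kb <= k / 2 by rewrite kE; lra.
    by have := ler_wpM2r pos nk; rewrite /th; lra.
  rewrite mulr1 -/(phi p) gerBl mulr_ge0 ?divr_ge0 //; exact: ltW.
pose B0 := \sum_i nm (y i).
have B00 : 0 <= B0 by apply: sumr_ge0 => i _; exact: nm_ge0.
have Td f : adm U (fun _ => phi) f -> forall i p, U p -> differentiable (fun q => pint 0 1 ((F f i)^~ q)) p.
  move=> [fd [b b0 fb]] i p Up.
  have [d1 _] := @pint_dif R V U _ 0 1 (F f i) oU (lbig b b0)
    (fun s p hs Up => Fd f i s p fd hs Up) (fun p Up => Fc f i p fd Up)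
    (fun s p hs Up => Fbig f i b s p b0 fb hs Up) p Up.
  exact: d1.
have zadm : adm U (fun _ : 'I_n => phi) (fun _ _ => 0).
  by split=> [i q _|]; [exact: dif_cst|exists 0 => // i q _; rewrite nm0 mul0r].
have [|||f [fd fb fT]] := @fixed_point R V 'I_n U (fun _ => phi) oU (fun _ => lphi) (fun _ => phi0) T B0 B00.
- move=> f af i p Up; exact: differentiableD (dif_cst _ _) (Td f af i p Up).
- move=> f g [fd [b b0 fb]] [gd [b' b0' gb]] c c0 fg i p Up.
  rewrite /T opprD addrACA subrr add0r.
  have dd j q : U q -> differentiable (fun q => f j q - g j q) q.
    by move=> Uq; apply: differentiableB; [exact: fd|exact: gd].
  have -> : pint 0 1 ((F f i)^~ p) - pint 0 1 ((F g i)^~ p) =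
     pint 0 1 ((F (fun j q => f j q - g j q) i)^~ p).
    have cF := Fc f i p fd Up; have cG := Fc g i p gd Up.
    have := pintD cF (seg_contZ (c := -1) cG); rewrite pintZ // mulN1r => <-.
    apply: pint_ext => z _; rewrite mulN1r /F -mulrBl /H -sumrB.
    by congr (_ * _); apply: eq_bigr => j _; rewrite mulrBr.
  exact: Tint.
- move=> i p Up; rewrite /T.
  have -> : pint 0 1 ((F (fun _ _ => 0) i)^~ p) = 0.
    apply/eqP; rewrite -nm_le0 -(mul0r (phi p)) -(mul0r (2^-1 : R)).
    apply: (Tint (fun _ _ => 0) i 0 p (lexx 0) _ _ Up) => j q _; first exact: dif_cst.
    by rewrite nm0 mul0r.
  rewrite addr0; apply: (@le_trans _ _ (B0 * 1)).
    by rewrite mulr1 /B0 (bigD1 i) //= lerDl sumr_ge0 // => j _; exact: nm_ge0.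
  rewrite ler_wpM2l // /phi /th; apply: le_trans (expR_ge1Dx _).
  by rewrite lerDl mulr_ge0 ?expR_ge0.
have B20 : 0 <= 2 * B0 by rewrite mulr_ge0.
exists f; split=> [//|i t tt|i [w t] Up].
  have Uw : U (w1, t) by split.
  rewrite fT // /T.
  have -> : pint 0 1 ((F f i)^~ (w1, t)) = 0; last by rewrite addr0.
  rewrite (_ : (F f i)^~ (w1, t) = fun=> 0); last first.
    by apply/funext => s; rewrite /F /= subrr mulr0.
  by apply: pint_unique; under eq_fun do rewrite rs_cst mulr0; exact: cvg_cst.
have af : adm U (fun _ => phi) f by split=> //; exists (2 * B0).
have dP := Td f af i (w, t) Up.
(* The w-derivative of (w - w1) H at w1 + s (w - w1) is the s-derivative of s H at the same point,
   so the integral has derivative H at the endpoint. *)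
have Psid s : seg 0 1 s -> is_derive s (1 : C) (fun s => s * H f i (pt s (w, t)))
    (H f i (pt s (w, t)) + s * ('d (H f i) (pt s (w, t)) (1, 0) * (w - w1))).
  move=> hs; have := isdM (isd_id s) (Hs f i s w t fd (Upt _ _ hs Up)) => /isd_eq; apply.
  by rewrite mul1r.
have cont : seg_cont 0 1 (fun s => H f i (pt s (w, t)) + s * ('d (H f i) (pt s (w, t)) (1, 0) * (w - w1))).
  move=> s hs; have [e e0 He] := nearU s w t (Upt _ _ hs Up).
  apply: (@isd_deriv_cont R (fun s => s * H f i (pt s (w, t))) _ s e e0) => z hz.
  have := isdM (isd_id z) (Hs f i z w t fd (He z hz)) => /isd_eq; apply.
  by rewrite mul1r.
have rel s : seg 0 1 s -> 'd (F f i s) (w, t) (1, 0) =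
   H f i (pt s (w, t)) + s * ('d (H f i) (pt s (w, t)) (1, 0) * (w - w1)) + 0 * F f i s (w, t).
  move=> hs; apply: (slice_val (Fd f i s _ fd hs Up)).
  have h0 := isdB (isd_id w) (isd_cst w1 w).
  have h1 := isdD (isd_cst w1 w) (isdZ s h0).
  have h2 := isd_comp h1 (dif_slice (Hd f i (pt s (w, t)) fd (Upt _ _ hs Up))).
  have := isdM h2 h0 => /isd_eq; apply.
  rewrite /pt /=; move: ('d _ _ _) (H _ _ _) => q q'; ring.
have e1 := @pint_dif_eq R V U _ 0 1 (F f i) (w, t) (1, 0) _ _ 0 oU (lbig _ B20)
    (fun s p hs Up => Fd f i s p fd hs Up) (fun p Up => Fc f i p fd Up)
    (fun s p hs Up => Fbig f i _ s p B20 fb hs Up) Up Psid cont rel.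
have e2 : is_derive w (1 : C) (fun z => f i (z, t)) (H f i (w, t)).
  have h1 := isdD (isd_cst (y i) w) (dif_slice dP).
  have h2 : 'd (fun q => pint 0 1 ((F f i)^~ q)) (w, t) (1, 0) = H f i (w, t).
    apply: (etrans e1); rewrite add0r mul1r mul0r subr0 mul0r addr0 /pt /= mul1r.
    by rewrite addrC subrK.
  have [e e0 He] := (openC_nm hplane).1 open_hplane w Up.1.
  apply: isd_congr (isd_eq h1 _).
    exists e; first exact: e0.
    by move=> z hz; rewrite fT //; split; [exact: He|exact: Up.2].
  by rewrite add0r; exact: h2.
exact: slice_val (fd i _ Up) e2.
Qed.

End LinearODE.

(** * Sectors free of Stokes directions *)

Section Sector.
Variable R : realType.
Local Notation C := R[i].

Definition cis (th : R) : C := cexp (0 +i* th).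

Lemma cisE th : cis th = cos th +i* sin th.
Proof. by rewrite /cis /cexp /= expR0 !mul1r. Qed.

Lemma nm_cis th : nm (cis th) = 1.
Proof. by rewrite nm_cexp /= expR0. Qed.

Lemma cisD x y : cis (x + y) = cis x * cis y.
Proof. by rewrite /cis -cexpD; congr (cexp _); apply/eqP; rewrite eq_complex /= addr0 !eqxx. Qed.

Lemma cexp_polar (w : C) : cexp w = (cmod w)%:C * cis (carg w).
Proof.
rewrite /cexp /cmod /carg cisE; case: w => a b.
by apply/eqP; rewrite eq_complex /= !mul0r subr0 addr0 !eqxx.
Qed.

Lemma Re_cisM (k : C) th :
  complex.Re (k * cis th) = complex.Re k * cos th - complex.Im k * sin th.
Proof. by rewrite cisE; case: k. Qed.

Lemma Re_cis_pi (k : C) th :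
  complex.Re (k * cis (th + pi)) = - complex.Re (k * cis th).
Proof. by rewrite !Re_cisM cosDpi sinDpi; ring. Qed.

Lemma cont_Re_cis (k : C) : continuous (fun th : R => complex.Re (k * cis th)).
Proof.
move=> x; rewrite (_ : (fun th => _) =
   (fun th : R => complex.Re k * cos th - complex.Im k * sin th)); last first.
  by apply/funext => th; rewrite Re_cisM.
apply: cvgB; apply: cvgM; [exact: cvg_cst|exact: continuous_cos|exact: cvg_cst|exact: continuous_sin].
Qed.

Lemma Re_cis_sign (k : C) (x y : R) : x <= y ->
  (forall th, x <= th <= y -> complex.Re (k * cis th) != 0) ->
  0 < complex.Re (k * cis x) * complex.Re (k * cis y).
Proof.
move=> xy nz; rewrite ltNge; apply/negP => h.
pose f (th : R) := complex.Re (k * cis th).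
have fx : f x != 0 by apply: nz; rewrite lexx.
have fy : f y != 0 by apply: nz; rewrite lexx xy.
have cf : {within `[x, y], continuous f}.
  by apply: continuous_subspaceT => z; exact: cont_Re_cis.
have [|th thi th0] := @IVT R f x y 0 xy cf.
  have {}h : f x * f y <= 0 := h.
  rewrite ge_min le_max.
  case: (ltrgtP (f x) 0) fx => [a _|a _|_ //].
    case: (ltrgtP (f y) 0) fy => [b _|b _|_ //] //=.
    by exfalso; clear -a b h; nra.
  case: (ltrgtP (f y) 0) fy => [b _|b _|_ //] //=.
  by exfalso; clear -a b h; nra.
move: (nz th); rewrite -/(f th) th0 eqxx => H; apply: (negP (H _)) => //.
Qed.

Lemma Re_cis_near (k : C) (x : R) : complex.Re (k * cis x) != 0 ->
  exists2 e : R, 0 < e & forall y, `|y - x| < e ->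
    0 < complex.Re (k * cis x) * complex.Re (k * cis y).
Proof.
move=> nz; have c0 : 0 < `|complex.Re (k * cis x)| by rewrite normr_gt0.
have /cvgrPdist_lt /(_ _ c0) /nbhs_ballP [e e0 H] := @cont_Re_cis k x.
exists e => // y hy.
have {H} := H y; rewrite /ball /= distrC => /(_ hy).
set a := complex.Re (k * cis x) in nz c0 *; set b := complex.Re (k * cis y).
move=> h; rewrite -subr_gt0 subr0.
have [a0|a0|a0] := ltgtP a 0; last by rewrite a0 eqxx in nz.
  rewrite nmulr_rgt0 //; move: h; rewrite (ltr0_norm a0) ltr_norml => /andP[h1 h2].
  by clear -h1 h2; lra.
rewrite pmulr_rgt0 //; move: h; rewrite (gtr0_norm a0) ltr_norml => /andP[h1 h2].
by clear -h1 h2; lra.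
Qed.

(** A common threshold for finitely many conditions that persist when the threshold decreases. *)
Lemma fin_inf (I : finType) (P : I -> R -> Prop) :
  (forall i x y, P i x -> 0 < y -> y <= x -> P i y) ->
  (forall i, exists2 x : R, 0 < x & P i x) -> exists2 x : R, 0 < x & forall i, P i x.
Proof.
move=> mono ex.
have [f Hf] := choice (fun i => let: ex_intro2 x x0 h := ex i in ex_intro (fun x => 0 < x /\ P i x) x (conj x0 h)).
have : exists2 x : R, 0 < x & forall i, i \in enum I -> P i x.
  elim: (enum I) => [|i s [x x0 IH]]; first by exists 1.
  exists (Num.min x (f i)); first by rewrite lt_min x0; case: (Hf i).
  move=> j; have m0 : 0 < Num.min x (f i) by rewrite lt_min x0; case: (Hf i).
  rewrite inE => /orP[/eqP ->|/IH h]; last by apply: mono h m0 _; rewrite ge_min lexx.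
  by have [_ h] := Hf i; apply: mono h m0 _; rewrite ge_min lexx orbT.
by move=> [x x0 h]; exists x => // i; apply: h; rewrite mem_enum.
Qed.

Lemma cos_ge_sin (x e : R) : 0 <= e -> e <= pi / 2 -> - (pi / 2) + e <= x ->
  x <= pi / 2 - e -> sin e <= cos x.
Proof.
move=> e0 e1 x0 x1.
have -> : sin e = cos (pi / 2 - e) by rewrite cosB cos_pihalf sin_pihalf mul0r mul1r add0r.
have p0 := pi_gt0 R.
rewrite -(cos_norm x) leNgt ltr_cos; first by rewrite -leNgt ler_norml; apply/andP; split; clear -x0 x1; lra.
- by rewrite in_itv /=; apply/andP; split; clear -e0 e1 p0; lra.
- by rewrite in_itv /= normr_ge0 ler_norml; apply/andP; split; clear -x0 x1 e0 p0; lra.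
Qed.

(** Each Re ((u_c - u_a) e^(i th)) keeps its sign on [al, be] and on a slightly larger [al', be'];
    so for each pair one of the directions al', be' - pi is admissible for the ray. [D] is the union
    of two half-planes, of directions from al' - pi to al' and from be' - pi to be'. Together they
    contain the closed sector [al - pi, be] near infinity, and both are stable under translation
    along both rays. *)
Lemma sector_pkg (n : nat) (u : 'I_n -> C) (al be : R) : al <= be ->
  (forall a b, a != b -> forall th, al <= th <= be ->
     complex.Re ((u a - u b) * cis th) != 0) ->
  exists (d : 'I_n -> 'I_n -> C) (del : R),
   [/\ 0 < del,
     forall a c, c != a -> nm (d a c) = 1 /\ del <= complex.Re ((u c - u a) * d a c)
   & forall M : R, 1 <= M -> exists (D : set C) (M' : R),
      [/\ open D, forall z, D z -> M <= nm z,
          forall z (s : R), D z -> 0 <= s -> D (z * (expR s)%:C),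
          forall a c z (s : R), c != a -> D z -> 0 <= s -> D (z + s%:C * d a c)
        & forall w : C, al - pi <= carg w <= be -> M' <= cmod w -> D (cexp w)]].
Proof.
move=> ab nz; have p0 := pi_gt0 R.
have Re_cont (k : C) (M : R) : open [set z : C | M < complex.Re (z * k)].
  apply/openC_nm => z hz; have k1 : 0 < nm k + 1 by rewrite ltr_wpDl // nm_ge0.
  exists ((complex.Re (z * k) - M) / (nm k + 1)).
    by rewrite divr_gt0 // subr_gt0.
  move=> y; rewrite ltr_pdivlMr // => hy /=.
  have h := Re_le_nm ((y - z) * k); rewrite nmM mulrBl Re_add Re_opp in h.
  have := nm_ge0 (y - z); have := nm_ge0 k; move: h hy; rewrite ler_norml => /andP[h _].
  by clear -h; nra.
(* Without a pair of distinct indices the interval [al, be] can have any length, and the exterior of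
   a disc serves. *)
case: (pselect (exists a b : 'I_n, a != b)) => [[a0 [b0 ab0]]|none]; last first.
  exists (fun _ _ => 1), 1; split=> // [a c ca|M M1].
    by exfalso; apply: none; exists c, a.
  exists [set z | M < nm z], (M + 1); split=> //.
  - apply/openC_nm => z hz; exists (nm z - M); first by rewrite subr_gt0.
    move=> y hy /=; have := nmBD z y; rewrite nmB; move: hy => /=; clear; lra.
  - by move=> z /ltW.
  - move=> z s /= hz s0; rewrite nmM nmC ger0_norm ?expR_ge0 //.
    apply: lt_le_trans hz _; rewrite ler_peMr ?nm_ge0 //.
    by apply: le_trans (expR_ge1Dx s); rewrite lerDl.
  - by move=> a c z s ca; exfalso; apply: none; exists c, a.
  - move=> w _ hw /=; rewrite nm_cexp; move: hw; rewrite /cmod; clear; lra.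
(* The sinusoid changes sign over any interval of length pi. *)
have abpi : be - al < pi.
  rewrite ltNge; apply/negP => h.
  have hb : al <= al + pi by rewrite lerDl ltW.
  have hn : forall th, al <= th <= al + pi -> complex.Re ((u a0 - u b0) * cis th) != 0.
    move=> th /andP[t1 t2]; apply: nz => //; rewrite t1 /=.
    by apply: le_trans t2 _; rewrite addrC -lerBrDr.
  have := Re_cis_sign hb hn; rewrite Re_cis_pi mulrN oppr_gt0 -expr2.
  by rewrite ltNge sqr_ge0.
pose I : finType := ('I_n * 'I_n)%type.
have [eta e0 He] : exists2 eta : R, 0 < eta & forall i : I, i.1 != i.2 ->
   0 < complex.Re ((u i.1 - u i.2) * cis al) * complex.Re ((u i.1 - u i.2) * cis (al - eta)) /\
   0 < complex.Re ((u i.1 - u i.2) * cis be) * complex.Re ((u i.1 - u i.2) * cis (be + eta)) /\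
   eta <= (pi - (be - al)) / 8.
  have [|e e0 He] := @fin_inf I (fun i e => i.1 != i.2 -> forall x, `|x| <= e ->
   0 < complex.Re ((u i.1 - u i.2) * cis al) * complex.Re ((u i.1 - u i.2) * cis (al + x)) /\
   0 < complex.Re ((u i.1 - u i.2) * cis be) * complex.Re ((u i.1 - u i.2) * cis (be + x)))
   (fun i x y h y0 yx hi z hz => h hi z (le_trans hz yx)); last first.
    exists (Num.min e ((pi - (be - al)) / 8)).
      by rewrite lt_min e0 divr_gt0 // subr_gt0.
    move=> i hi; set x := Num.min _ _.
    have x0 : 0 < x by rewrite lt_min e0 divr_gt0 // subr_gt0.
    have xe : x <= e by rewrite ge_min lexx.
    have [h1 _] := He i hi (- x) ltac:(by rewrite normrN ger0_norm // ltW).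
    have [_ h2] := He i hi x ltac:(by rewrite ger0_norm // ltW).
    by split=> //; split=> //; rewrite ge_min lexx orbT.
  move=> [i j] /=; have [->|ij] := eqVneq i j; first by exists 1 => //; rewrite eqxx.
  have n1 : complex.Re ((u i - u j) * cis al) != 0 by apply: nz => //; rewrite lexx.
  have n2 : complex.Re ((u i - u j) * cis be) != 0 by apply: nz => //; rewrite lexx ab.
  have [e1 e10 H1] := Re_cis_near n1; have [e2 e20 H2] := Re_cis_near n2.
  exists (Num.min e1 e2 / 2); first by rewrite divr_gt0 // lt_min e10.
  move=> _ x hx.
  have hm : Num.min e1 e2 / 2 < Num.min e1 e2.
    by rewrite ltr_pdivrMr // ltr_pMr ?ltr1n // lt_min e10.
  have := le_lt_trans hx hm; rewrite lt_min => /andP[x1 x2].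
  by split; [apply: H1|apply: H2]; rewrite addrAC subrr add0r.
pose al' := al - eta; pose be' := be + eta.
pose pos (a c : 'I_n) := 0 < complex.Re ((u c - u a) * cis al).
pose d (a c : 'I_n) : C := if pos a c then cis al' else - cis be'.
have dpos a c : c != a -> 0 < complex.Re ((u c - u a) * d a c).
  move=> ca; have [h1 [h2 _]] := He (c, a) ca; rewrite /= -/al' -/be' in h1 h2.
  have h3 := Re_cis_sign ab (nz c a ca).
  rewrite /d /pos; case: (ltP 0 (complex.Re ((u c - u a) * cis al))) => p1.
    by rewrite (pmulr_rgt0 _ p1) in h1.
  have {}p1 : complex.Re ((u c - u a) * cis al) < 0.
    by rewrite lt_neqAle p1 andbT; apply: nz; rewrite ?lexx.
  rewrite (nmulr_rgt0 _ p1) in h3; rewrite (nmulr_rgt0 _ h3) in h2.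
  by rewrite mulrN Re_opp oppr_gt0.
have [|del d0 Hdel] := @fin_inf I (fun i e => i.2 != i.1 -> e <= complex.Re ((u i.2 - u i.1) * d i.1 i.2))
  (fun i x y h y0 yx hi => le_trans yx (h hi)).
  move=> [i j] /=; have [->|h] := eqVneq j i; first by exists 1.
  by exists (complex.Re ((u j - u i) * d i j)) => //; exact: dpos.
have eta8 : eta <= (pi - (be - al)) / 8 by have [_ []] := He (a0, b0) ab0.
exists d, del; split=> // [a c ca|M M1].
  split; last exact: (Hdel (a, c)).
  by rewrite /d; case: ifP => _; rewrite ?nmN nm_cis.
(* Conjugates of the inner normals: z lies in a half-plane when Re (z m) > M. Each ray is parallel
   to the edge of one half-plane and has product sin (be' - al') >= 0 with the normal of the
   other. *)
pose m1 := cis (- (al' - pi / 2)); pose m2 := cis (- (be' - pi / 2)).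
have gap : 0 <= be' - al' <= pi by apply/andP; split; rewrite /be' /al'; clear -ab eta8 e0 abpi; lra.
have sg : 0 <= sin (be' - al') by exact: sin_ge0_pi.
have Rc x : complex.Re (cis x) = cos x by rewrite cisE.
have Rd a c : 0 <= complex.Re (d a c * m1) /\ 0 <= complex.Re (d a c * m2).
  rewrite /d; case: ifP => _; rewrite ?mulNr ?Re_opp -!cisD !Rc.
    have -> : al' - (al' - pi / 2) = pi / 2 by clear; lra.
    have -> : al' - (be' - pi / 2) = - (be' - al') + pi / 2 by clear; lra.
    by rewrite cos_pihalf cosDpihalf sinN opprK.
  have -> : be' - (be' - pi / 2) = pi / 2 by clear; lra.
  have -> : be' - (al' - pi / 2) = (be' - al') + pi / 2 by clear; lra.
  by rewrite cos_pihalf cosDpihalf opprK oppr0.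
pose D : set C := [set z | M < complex.Re (z * m1)] `|` [set z | M < complex.Re (z * m2)].
have s0 : 0 < sin eta.
  by apply: sin_gt0_pi; rewrite e0 /=; clear -ab e0 eta8; lra.
(* A point of the sector is at angle at least eta from the edge of one of the half-planes, where Re
   (z m) >= |z| sin eta. *)
exists D, (M / sin eta + 1); split.
- exact: openU.
- move=> z; have h k : nm k = 1 -> complex.Re (z * k) <= nm z.
    move=> k1; rewrite -[leRHS]mulr1 -k1 -nmM.
    exact: le_trans (ler_norm _) (Re_le_nm _).
  by case=> /= /ltW hz; apply: le_trans hz _; apply: h; exact: nm_cis.
- move=> z s; have h k : M < complex.Re (z * k) -> 0 <= s -> M < complex.Re (z * (expR s)%:C * k).
    move=> hz s0'; rewrite mulrAC mulrC Re_rM; apply: (lt_le_trans hz).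
    rewrite ler_peMl //; first by apply: le_trans (ltW hz); apply: le_trans M1.
    by apply: le_trans (expR_ge1Dx s); rewrite lerDl.
  by case=> /= hz s0'; [left|right]; apply: h.
- move=> a c z s ca; have [r1 r2] := Rd a c.
  have h k : 0 <= complex.Re (d a c * k) -> M < complex.Re (z * k) -> 0 <= s ->
     M < complex.Re ((z + s%:C * d a c) * k).
    move=> hk hz s0'; rewrite mulrDl -mulrA Re_add Re_rM; apply: lt_le_trans hz _.
    by rewrite lerDl mulr_ge0.
  by case=> /= hz s0'; [left|right]; apply: h.
move=> w /andP[w1 w2] hw; rewrite cexp_polar.
have big x : - (pi / 2) + eta <= carg w + x -> carg w + x <= pi / 2 - eta ->
    M < complex.Re ((cmod w)%:C * cis (carg w) * cis x).
  move=> h1 h2; rewrite -mulrA -cisD Re_rM Rc.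
  have c1 := @cos_ge_sin (carg w + x) eta (ltW e0) _ h1 h2.
  have {}c1 : sin eta <= cos (carg w + x) by apply: c1; clear -ab e0 eta8; lra.
  apply: lt_le_trans (_ : cmod w * sin eta <= _).
    rewrite -ltr_pdivrMr //; apply: lt_le_trans hw; by rewrite ltrDl.
  by rewrite ler_wpM2l // /cmod expR_ge0.
(* al - 2 eta is still eta inside the first half-plane; beyond it the second one takes over, since 8
   eta <= pi - (be - al). *)
have [h|h] := leP (carg w) (al - 2 * eta).
  by left; apply: big; rewrite /al'; clear -h w1 eta8; lra.
by right; apply: big; rewrite /be'; clear -h w2 eta8 abpi; lra.
Qed.

End Sector.

(** * Matrix-valued functions and compactness *)

Section MatrixDiff.
Variable R : realType.
Local Notation C := R[i].

Lemma nm_entry m n (M : 'M[C]_(m, n)) i j : nm (M i j) <= nm M.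
Proof.
rewrite -lecR !nmE [`|M|]/Num.norm /= mx_normE.
rewrite -[leLHS]nngE num_le.
exact: (le_bigmax _ (fun ij : 'I_m * 'I_n => `|M ij.1 ij.2|%:nng) (i, j)).
Qed.

Lemma nm_mx_le m n (M : 'M[C]_(m, n)) (B : R) : 0 <= B ->
  (forall i j, nm (M i j) <= B) -> nm M <= B.
Proof.
move=> B0 H; have [->|M0] := eqVneq M 0; first by rewrite nm0.
have h : mx_norm M != 0 by rewrite -[mx_norm M]/(`|M|) normr_eq0.
have [[i j] e] := mx_norm_neq0 h.
by apply: le_trans (H i j); rewrite -lecR !nmE [`|M|]/Num.norm /= e.
Qed.

Variable V : normedModType C.

Lemma dif_entry m n (F : V -> 'M[C]_(m, n)) p i j : differentiable F p ->
  differentiable (fun q => F q i j) p.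
Proof.
move=> dF; apply: (@dif_comp R V _ _ F (fun M : 'M[C]_(m, n) => M i j) p dF).
exact: differentiable_coord.
Qed.

Lemma dif_mx m n (F : V -> 'M[C]_(m, n)) p :
  (forall i j, differentiable (fun q => F q i j) p) -> differentiable F p.
Proof.
move=> dF.
rewrite (_ : F = \sum_(ij : 'I_m * 'I_n) (fun q => F q ij.1 ij.2 *: delta_mx ij.1 ij.2)).
  elim/big_ind: _ => [|f g|[i j] _]; first exact: dif_cst.
    exact: differentiableD.
  exact: differentiableZl.
apply/funext => q; rewrite fct_sumE {1}[F q]matrix_sum_delta.
by rewrite pair_bigA.
Qed.

Lemma dif_prod (I : Type) (r : seq I) (f : I -> V -> C) p :
  (forall i, differentiable (f i) p) ->
  differentiable (fun q => \prod_(i <- r) f i q) p.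
Proof.
move=> df; elim: r => [|i r IH].
  rewrite (_ : (fun q => _) = fun=> 1); first exact: dif_cst.
  by apply/funext => q; rewrite big_nil.
rewrite (_ : (fun q => _) = fun q => f i q * \prod_(i <- r) f i q).
  exact: difM (df i) IH.
by apply/funext => q; rewrite big_cons.
Qed.

Lemma dif_det n (F : V -> 'M[C]_n) p :
  (forall i j, differentiable (fun q => F q i j) p) ->
  differentiable (fun q => \det (F q)) p.
Proof.
move=> dF; rewrite /determinant.
apply: dif_sum => s; apply: difM; first exact: dif_cst.
by apply: dif_prod => i; apply: dF.
Qed.

(** [invmx] is defined by cases; near p the determinant stays nonzero and Cramer's formula
    applies. *)
Lemma dif_inv n (F : V -> 'M[C]_n) p : F p \in unitmx ->
  (forall i j, differentiable (fun q => F q i j) p) ->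
  forall i j, differentiable (fun q => invmx (F q) i j) p.
Proof.
move=> uF dF i j.
have dd := dif_det dF.
have d0 : \det (F p) != 0 by rewrite -unitfE -unitmxE.
have h1 : differentiable (fun q => (\det (F q))^-1) p.
  exact: dif_comp1 dd (isd_V d0).
have h2 : differentiable (fun q => cofactor (F q) j i) p.
  apply: difM; first exact: dif_cst.
  by apply: dif_det => a b; under eq_fun do rewrite !mxE; apply: dF.
have := differentiable_continuous dd => /cont_nmP.
have e0 : 0 < nm (\det (F p)) / 2 by rewrite divr_gt0 // nm_gt0.
move=> /(_ _ e0) [d dd0 Hd].
apply: (dif_congr _ (difM h1 h2)); exists d => // q /Hd h.
have q0 : \det (F q) != 0.
  rewrite -nm_gt0; have := nmBD (\det (F p)) (\det (F q)); rewrite nmB.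
  by move: h; rewrite -nm_gt0 in d0; clear -d0; lra.
by rewrite /invmx unitmxE unitfE q0 !mxE.
Qed.

End MatrixDiff.

Section Compactness.
Variable R : realType.
Local Notation C := R[i].

(** A single index N serves both as the constant in Q and as the inverse size of a neighbourhood of
    K. If no N worked, the counterexamples would cluster at a point of K and contradict the local
    hypothesis there. *)
Lemma compact_uniform (V : normedModType C) (K : set V) (Q : nat -> V -> Prop) :
  compact K ->
  (forall N N' y, (N <= N')%N -> Q N y -> Q N' y) ->
  (forall x, K x -> exists2 r : R, 0 < r & exists N, forall y, nm (y - x) < r -> Q N y) ->
  exists N, forall x y, K x -> nm (y - x) < N.+1%:R^-1 -> Q N y.
Proof.
move=> cK mono loc; apply: contrapT => no.
have bad N : exists xy : V * V, [/\ K xy.1, nm (xy.2 - xy.1) < N.+1%:R^-1 & ~ Q N xy.2].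
  apply: contrapT => h; apply: no; exists N => x y Kx xy; apply: contrapT => nq.
  by apply: h; exists (x, y).
have [f Hf] := choice bad.
pose F := (fun N => (f N).1) @ \oo.
have FK : F K by exists 0%N => // N _; have [] := Hf N.
have [x [Kx cx]] := cK F _ FK.
have [r r0 [N0 HN0]] := loc x Kx.
have r2 : 0 < r / 2 by rewrite divr_gt0.
have [N1 _ HN1] := near_infty_natSinv_lt (PosNum r2).
have tail : F [set (f N).1 | N in [set N | (maxn N0 N1 <= N)%N]].
  by exists (maxn N0 N1) => // N hN; exists N.
have nb : nbhs x [set y | nm (y - x) < r / 2] by apply/nbhs_nmP; exists (r / 2).
have [_ [[N hN <-] h1]] := cx _ _ tail nb.
have [_ h2 nq] := Hf N; apply: nq.
move: hN => /=; rewrite geq_max => /andP[n0 n1].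
apply: (mono _ _ _ n0); apply: HN0.
rewrite [r]splitr; apply: (ballD h1); apply: lt_trans h2 _.
exact: HN1.
Qed.

Lemma compact_disc (e : R) : compact [set z : C | nm z <= e].
Proof.
pose f (p : R * R) : C := p.1 +i* p.2.
have cf : continuous f.
  move=> [x y]; apply/cvg_nmP => d d0; have d2 : 0 < d / 2 by rewrite divr_gt0.
  exists (ball x (d / 2), ball y (d / 2)); first by split; exact: nbhsx_ballx.
  move=> [a b] [/= ha hb]; rewrite /f /=; apply: le_trans (nm_le_ReIm _) _ => /=.
  by rewrite [d]splitr; apply: lerD; apply: ltW.
have c1 := compact_setX (@segment_compact R (- e) e) (@segment_compact R (- e) e).
have c2 : compact (f @` (`[- e, e] `*` `[- e, e])%classic).
  by apply: continuous_compact c1; apply: continuous_subspaceT.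
apply: (subclosed_compact _ c2).
  rewrite -[X in closed X]setCK; apply: open_closedC.
  apply/openC_nm => z /= /negP; rewrite -ltNge => hz.
  exists (nm z - e); first by rewrite subr_gt0.
  move=> y hy /=; apply/negP; rewrite -ltNge; have := nmBD z y; rewrite nmB.
  by move: hy; clear; lra.
move=> z /= hz; exists (complex.Re z, complex.Im z); last by case: z hz.
split; rewrite /= in_itv /= -ler_norml.
  exact: le_trans (Re_le_nm z) hz.
exact: le_trans (Im_le_nm z) hz.
Qed.

Lemma compact_circle (e : R) : compact [set z : C | nm z = e].
Proof.
apply: (subclosed_compact _ (@compact_disc e)); last by move=> z /= ->.
rewrite -[X in closed X]setCK; apply: open_closedC.
apply/openC_nm => z /= /eqP hz.
exists `|nm z - e|; first by rewrite normr_gt0 subr_eq0.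
move=> y hy /= ye; move: hy; rewrite ltNge => /negP; apply.
rewrite -ye ler_norml; have := nmBD z y; have := nmBD y z; rewrite (nmB z y).
by clear; lra.
Qed.

Lemma compact_polydisc n (e : R) : compact (@polydisc R n 0 e).
Proof.
have := @rV_compact C n (fun _ => [set z : C | nm z <= e]) (fun _ => @compact_disc e).
congr (compact _); apply/seteqP; split=> t h i; have := h i.
  by rewrite /= mxE subr0 nm_leE.
by rewrite /polydisc /= mxE subr0 nm_leE.
Qed.

End Compactness.

(** * The system near infinity *)

Section Laurent.
Variable R : realType.
Local Notation C := R[i].

Lemma nm_cexp_ln (r : R) (w : C) : 0 < r -> complex.Re w = ln r -> nm (cexp w) = r.
Proof. by move=> r0 h; rewrite nm_cexp h lnK. Qed.

Lemma isdX (x : C) k : is_derive x (1 : C) (fun z : C => z ^+ k) (k%:R * x ^+ k.-1).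
Proof.
elim: k => [|k IH].
  rewrite mul0r (_ : (fun z : C => z ^+ 0) = fun=> 1); first exact: isd_cst.
  by apply/funext => z; rewrite expr0.
rewrite (_ : (fun z : C => z ^+ k.+1) = fun z => z * z ^+ k); last first.
  by apply/funext => z; rewrite exprS.
have := isdM (isd_id x) IH => /isd_eq; apply.
rewrite mul1r -natr1 mulrDl mul1r /= addrC mulrCA; congr (_ + _).
by case: k {IH} => [|k]; rewrite ?mul0r // -exprS.
Qed.

(** Orthogonality of the powers of z on a circle: for k != j the integrand has a primitive of period
    2 pi i. *)
Lemma pint_powers (x : R) (k j : nat) :
  pint x%:C (@tpi R) (fun w => cexp w ^+ k * (cexp w)^-1 ^+ j) =
  if k == j then @tpi R else 0.
Proof.
pose m : C := k%:R - j%:R.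
have E w : cexp w ^+ k * (cexp w)^-1 ^+ j = cexp (m * w).
  have X l : cexp w ^+ l = cexp (l%:R * w).
    elim: l => [|l IH]; first by rewrite mul0r cexp0 expr0.
    by rewrite exprS IH -cexpD -natr1 mulrDl mul1r addrC.
  by rewrite exprVn !X -cexpN -cexpD /m mulrBl.
have [kj|kj] := eqVneq k j.
  apply: pint_unique; apply: (@cvgC_ext _ (fun=> @tpi R)); last exact: cvg_cst.
  move=> n; rewrite (_ : (fun w => _) = fun=> 1) ?rs_cst ?mulr1 //.
  by apply/funext => w; rewrite E /m kj subrr mul0r cexp0.
have m0 : m != 0 by rewrite /m subr_eq0 eqr_nat.
have D w : is_derive w (1 : C) (fun w => m^-1 * cexp (m * w)) (cexp w ^+ k * (cexp w)^-1 ^+ j).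
  have := isdZ m^-1 (isd_comp (isdZ m (isd_id w)) (isd_cexp (m * w))) => /isd_eq; apply.
  by rewrite mulr1 mulrCA mulVf // mulr1 E.
rewrite (@pint_deriv R (fun w => m^-1 * cexp (m * w)) _ x%:C (@tpi R) (fun w _ => D w)); last first.
  move=> w _; have e1 : (fun w => cexp w ^+ k * (cexp w)^-1 ^+ j) = fun w => cexp (m * w).
    by apply/funext => w'; rewrite E.
  rewrite e1; exact: isd_cont (isd_comp (isdZ m (isd_id w)) (isd_cexp (m * w))).
by rewrite -!E cexp_2pi subrr.
Qed.

Variables (X : normedModType C) (TV P : set X) (g : C * X -> C) (r0 N0 Bd : R).
Variable c : nat -> X -> C.
Hypotheses (oTV : open TV) (PTV : P `<=` TV) (r00 : 0 < r0) (rN : r0 < N0).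
Hypothesis gd : forall (z : C) t, nm z = r0 -> TV t -> differentiable g (z, t).
Hypothesis gb : forall (z : C) t, nm z = r0 -> TV t -> nm (g (z, t)) <= Bd.
Hypothesis gP : forall (z : C) t, r0 <= nm z -> P t -> differentiable g (z, t).
Hypothesis gs : forall (z : C) t, N0 <= nm z -> P t ->
  (fun n => \sum_(j < n) z^-1 ^+ j * c j t) @ \oo --> g (z, t).

(** Coefficient of z^(-k) as a Cauchy integral over |z| = r0. It makes sense for t in [TV], where g
    is only known near this circle. *)
Definition lcoef k t : C :=
  (@tpi R)^-1 * pint (ln r0)%:C (@tpi R) (fun w => g (cexp w, t) * cexp w ^+ k).

Let Gd k t w : differentiable g (cexp w, t) ->
  differentiable (fun w => g (cexp w, t) * cexp w ^+ k) w.
Proof.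
move=> dg; have h1 := isd_comp (isd_cexp w) (dif_slice dg).
have h2 := isd_comp (isd_cexp w) (isdX (cexp w) k).
exact: isd_dif (isdM h1 h2).
Qed.

Let Gb k t w : TV t -> seg (ln r0)%:C (@tpi R) w ->
  nm (g (cexp w, t) * cexp w ^+ k) <= Bd * r0 ^+ k.
Proof.
move=> tt /Re_seg_tpi hw; have hn := nm_cexp_ln r00 hw.
by rewrite nmM nmX hn ler_wpM2r ?exprn_ge0 ?(ltW r00) // gb.
Qed.

Let Gc k t : TV t -> seg_cont (ln r0)%:C (@tpi R) (fun w => g (cexp w, t) * cexp w ^+ k).
Proof.
move=> tt w /Re_seg_tpi hw; apply: differentiable_continuous; apply: Gd.
by apply: gd => //; apply: nm_cexp_ln.
Qed.

Lemma lcoef_le k t : TV t -> nm (lcoef k t) <= Bd * r0 ^+ k.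
Proof.
move=> tt; have t0 : 0 < nm (@tpi R) by rewrite nm_gt0 tpi_neq0.
rewrite nmM nmV mulrC ler_pdivrMr //.
by apply: pint_le => [|w hw]; [exact: Gc|exact: Gb].
Qed.

Lemma lcoef_dif k t : TV t -> differentiable (lcoef k) t.
Proof.
move=> tt; apply: difM; first exact: dif_cst.
have [||||d1 _] := @pint_dif R X TV (fun=> Bd * r0 ^+ k) (ln r0)%:C (@tpi R)
  (fun w t => g (cexp w, t) * cexp w ^+ k) oTV _ _ _ _ t tt; last exact: d1.
- by move=> x _; exists 1 => //; exists (Bd * r0 ^+ k).
- move=> w q /Re_seg_tpi hw tq; apply: difM; last exact: dif_cst.
  apply: (@dif_comp R X _ _ (fun q => (cexp w, q)) g).
    by apply: differentiable_pair; [exact: dif_cst|].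
  by apply: gd => //; apply: nm_cexp_ln.
- by move=> q tq; exact: Gc.
- by move=> w q hw tq; exact: Gb.
Qed.

(** For t in [P] the circle can be enlarged to |z| = 2 N0, where the given series converges
    uniformly and can be integrated term by term. *)
Lemma lcoef_eq k t : P t -> lcoef k t = c k t.
Proof.
move=> Pt; have N00 : 0 < N0 by apply: lt_trans rN.
have N20 : 0 < 2 * N0 by rewrite mulr_gt0.
pose G w := g (cexp w, t) * cexp w ^+ k.
have t0 := tpi_neq0 R.
have x12 : ln r0 <= ln (2 * N0).
  rewrite ler_ln ?posrE //; apply: le_trans (ltW rN) _.
  by rewrite ler_peMl ?(ltW N00) // ler1n.
have E : pint (ln r0)%:C (@tpi R) G = pint (ln (2 * N0))%:C (@tpi R) G.
  apply: circle_indep x12 _ _ => [w /andP[w1 _]|w]; last by rewrite /G cexp_2pi.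
  apply: Gd; apply: gP => //; rewrite nm_cexp -[X in X <= _]lnK //.
  by rewrite ler_expR.
rewrite /lcoef -/(G) E; apply: (mulfI t0); rewrite mulVKf //.
(* Convergence at z = N0 bounds the terms by 2 from some index on; the earlier ones are covered by a
   finite sum. On |z| = 2 N0 the terms then decay like 2^(-j). *)
have [Cb Cb0 HC] : exists2 Cb : R, 0 <= Cb & forall j, nm (c j t) <= Cb * N0 ^+ j.
  have nz : N0 <= nm (N0%:C : C) by rewrite nmC ger0_norm // ltW.
  have /cvgn_nmP /(_ 1 ltr01) [n0 Hn] := gs nz Pt.
  pose s n := \sum_(j < n) (N0%:C : C)^-1 ^+ j * c j t.
  have tail j : (n0 <= j)%N -> nm (c j t) <= 2 * N0 ^+ j.
    move=> hj; have h1 := Hn j hj; have h2 := Hn j.+1 (leqW hj).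
    have e : s j.+1 - s j = (N0%:C)^-1 ^+ j * c j t.
      by rewrite /s big_ord_recr /= addrAC subrr add0r.
    have := nm_tri (s j.+1) (g (N0%:C, t)) (s j); rewrite e (nmB _ (s j)) nmM nmX nmV.
    rewrite nmC ger0_norm ?(ltW N00) // => h3.
    have N0j : 0 < N0 ^+ j by rewrite exprn_gt0.
    have : N0^-1 ^+ j * nm (c j t) <= 2.
      by apply: le_trans h3 _; rewrite -[2]/(1 + 1); apply: lerD.
    by rewrite exprVn mulrC ler_pdivrMr.
  exists (2 + \sum_(j < n0) nm (c j t) / N0 ^+ j).
    by rewrite addr_ge0 // sumr_ge0 // => j _; rewrite divr_ge0 ?nm_ge0 ?exprn_ge0 ?(ltW N00).
  move=> j; have N0j : 0 < N0 ^+ j by rewrite exprn_gt0.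
  have sp : 0 <= \sum_(j < n0) nm (c j t) / N0 ^+ j.
    by rewrite sumr_ge0 // => i _; rewrite divr_ge0 ?nm_ge0 ?exprn_ge0 ?(ltW N00).
  have [hj|hj] := ltnP j n0; last first.
    by apply: le_trans (tail j hj) _; rewrite ler_wpM2r ?(ltW N0j) // lerDl.
  rewrite -ler_pdivrMr // (bigD1 (Ordinal hj)) //= addrCA lerDl addr_ge0 //.
  by rewrite sumr_ge0 // => i _; rewrite divr_ge0 ?nm_ge0 ?exprn_ge0 ?(ltW N00).
have h2 : 0 <= (2^-1 : R) < 1 by rewrite invr_ge0 ler0n invf_lt1 ?ltr1n.
have tailz z J : nm z = 2 * N0 ->
    nm (g (z, t) - \sum_(j < J) z^-1 ^+ j * c j t) <= Cb / (1 - 2^-1) * 2^-1 ^+ J.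
  move=> nz; have [|l l1 l2] := @geo_cvg R (fun n => \sum_(j < n) z^-1 ^+ j * c j t) Cb 2^-1 Cb0 h2.
    move=> n; rewrite big_ord_recr /= addrAC subrr add0r nmM nmX nmV nz.
    apply: le_trans (ler_wpM2l _ (HC n)) _.
      by rewrite exprn_ge0 // invr_ge0 ltW.
    rewrite mulrCA ler_wpM2l // -exprMn; rewrite invfM -mulrA mulVf ?mulr1 //.
    by rewrite gt_eqF.
  have zN : N0 <= nm z by rewrite nz ler_peMl ?(ltW N00) // ler1n.
  by rewrite (cvgC_unique (gs zN Pt) l1).
have dG w : complex.Re w = ln (2 * N0) -> differentiable G w.
  move=> hw; apply: Gd; apply: gP => //; rewrite (nm_cexp_ln N20 hw).
  by apply: le_trans (ltW rN) _; rewrite ler_peMl ?(ltW N00) // ler1n.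
have cG := seg_cont_tpi dG.
have part J : (k < J)%N ->
   nm (pint (ln (2 * N0))%:C (@tpi R) G - @tpi R * c k t) <=
     2^-1 ^+ J * (Cb / (1 - 2^-1) * (2 * N0) ^+ k * nm (@tpi R)).
  move=> kJ; pose S w := \sum_(j < J) (cexp w ^+ k * (cexp w)^-1 ^+ j) * c j t.
  have cS1 j : seg_cont (ln (2 * N0))%:C (@tpi R) (fun w => cexp w ^+ k * (cexp w)^-1 ^+ j).
    move=> w _; have a1 := isd_comp (isd_cexp w) (isdX (cexp w) k).
    have a2 := isd_comp (isd_comp (isd_cexp w) (isd_V (cexp_neq0 w))) (isdX (cexp w)^-1 j).
    exact: isd_cont (isdM a1 a2).
  have [cS pS] : seg_cont (ln (2 * N0))%:C (@tpi R) S /\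
      pint (ln (2 * N0))%:C (@tpi R) S = @tpi R * c k t.
    have gen J' : seg_cont (ln (2 * N0))%:C (@tpi R)
         (fun w => \sum_(j < J') (cexp w ^+ k * (cexp w)^-1 ^+ j) * c j t) /\
        pint (ln (2 * N0))%:C (@tpi R) (fun w => \sum_(j < J') (cexp w ^+ k * (cexp w)^-1 ^+ j) * c j t) =
        if (k < J')%N then @tpi R * c k t else 0.
      elim: J' => [|J' [IH1 IH2]].
        rewrite (_ : (fun w => _) = fun=> 0); last by apply/funext => w; rewrite big_ord0.
        split=> [w _|]; first exact: (@cst_continuous C C 0 w).
        by apply: pint_unique; under eq_fun do rewrite rs_cst mulr0; exact: cvg_cst.
      pose f1 w := \sum_(j < J') (cexp w ^+ k * (cexp w)^-1 ^+ j) * c j t.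
      pose f2 w := c J' t * (cexp w ^+ k * (cexp w)^-1 ^+ J').
      rewrite (_ : (fun w => _) = fun w => f1 w + f2 w); last first.
        by apply/funext => w; rewrite big_ord_recr /= [_ * c J' t]mulrC.
      have c2 := @seg_contZ R (ln (2 * N0))%:C (@tpi R) _ (c J' t) (cS1 J').
      have {}c2 : seg_cont (ln (2 * N0))%:C (@tpi R) f2 := c2.
      split; first exact: (@seg_contD R _ _ f1 f2 IH1 c2).
      rewrite (@pintD R _ _ f1 f2 IH1 c2) IH2 (@pintZ R _ _ _ (c J' t) (cS1 J')).
      rewrite pint_powers ltnS.
      have [->|kJ'] := eqVneq k J'; first by rewrite ltnn leqnn add0r mulrC.
      by rewrite mulr0 addr0 [in RHS]leq_eqVlt (negbTE kJ').
    by have [h3 h4] := gen J; split=> //; rewrite /S h4 kJ.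
  rewrite -pS.
  have cN : seg_cont (ln (2 * N0))%:C (@tpi R) (fun w => -1 * S w) := @seg_contZ R _ _ S (-1) cS.
  have e1 : pint (ln (2 * N0))%:C (@tpi R) G - pint (ln (2 * N0))%:C (@tpi R) S =
     pint (ln (2 * N0))%:C (@tpi R) (fun w => G w + (-1) * S w).
    by rewrite (@pintD R _ _ G (fun w => -1 * S w) cG cN) (@pintZ R _ _ S (-1) cS) mulN1r.
  rewrite e1 mulrA; apply: pint_le; first exact: (@seg_contD R _ _ G _ cG cN).
  move=> w /Re_seg_tpi hw; have nz := nm_cexp_ln N20 hw.
  have e2 : G w + (-1) * S w = (g (cexp w, t) - \sum_(j < J) (cexp w)^-1 ^+ j * c j t) * cexp w ^+ k.
    rewrite mulN1r mulrBl /S /G; congr (_ - _); rewrite mulr_suml.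
    by apply: eq_bigr => j _; rewrite -mulrA mulrC.
  rewrite e2 nmM nmX nz mulrA ler_wpM2r ?exprn_ge0 ?(ltW N20) // mulrC.
  exact: tailz.
apply/subr0_eq/(@nm_small_eq0 R C _ (Cb / (1 - 2^-1) * (2 * N0) ^+ k * nm (@tpi R))).
  rewrite !mulr_ge0 ?nm_ge0 ?exprn_ge0 ?(ltW N20) // invr_ge0 subr_ge0.
  by case/andP: h2 => _ /ltW.
move=> e e0; have [J hJ] := half_small e0.
have kJ : (k < maxn k.+1 J)%N by rewrite leq_maxl.
apply: le_trans (part _ kJ) _; apply: ler_wpM2r.
  rewrite !mulr_ge0 ?nm_ge0 ?exprn_ge0 ?(ltW N20) // invr_ge0 subr_ge0.
  by case/andP: h2 => _ /ltW.
apply: le_trans (_ : 2^-1 ^+ J <= e); last exact: ltW hJ.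
have [a1 /ltW a2] := andP h2.
by rewrite ler_wiXn2l // leq_maxr.
Qed.

End Laurent.

Section PowerSum.
Variable R : realType.
Local Notation C := R[i].
Variables (X : normedModType C) (TV : set X) (c : nat -> X -> C) (B r0 r1 : R).
Hypotheses (oTV : open TV) (B0 : 0 <= B) (r00 : 0 < r0) (r01 : r0 < r1).
Hypothesis cd : forall k t, TV t -> differentiable (c k) t.
Hypothesis cb : forall k t, TV t -> nm (c k t) <= B * r0 ^+ k.

Definition psum (J : nat) (p : C * X) : C := \sum_(k < J) p.1^-1 ^+ k * c k p.2.
Definition ssum (p : C * X) : C := lim (psum^~ p @ \oo).

Let B1 : R := B / (1 - r0 / r1).

Let r10 : 0 < r1. Proof. exact: lt_trans r01. Qed.

Let q01 : 0 <= r0 / r1 < 1.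
Proof. by rewrite divr_ge0 ?(ltW r00) ?(ltW r10) //= ltr_pdivrMr // mul1r. Qed.

Let term_le k (p : C * X) : r1 <= nm p.1 -> TV p.2 ->
  nm (p.1^-1 ^+ k * c k p.2) <= B * (r0 / nm p.1) ^+ k.
Proof.
move=> hp tp; rewrite nmM nmX nmV exprMn mulrC mulrA ler_wpM2r ?cb //.
by rewrite exprn_ge0 // invr_ge0 nm_ge0.
Qed.

Let q_le (p : C * X) : r1 <= nm p.1 -> 0 <= r0 / nm p.1 <= r0 / r1.
Proof.
move=> hp; have n0 : 0 < nm p.1 by apply: lt_le_trans hp.
rewrite divr_ge0 ?nm_ge0 ?(ltW r00) //= ler_wpM2l ?(ltW r00) // lef_pV2 ?posrE //.
Qed.

Lemma ssum_cvg (p : C * X) : r1 <= nm p.1 -> TV p.2 -> psum^~ p @ \oo --> ssum p /\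
  forall J, nm (ssum p - psum J p) <= B1 * (r0 / nm p.1) ^+ J.
Proof.
move=> hp tp; have /andP[a1 a2] := q_le hp; have /andP[b1 b2] := q01.
have h : 0 <= r0 / nm p.1 < 1 by rewrite a1 (le_lt_trans a2).
have [|l hl Hl] := @geo_cvg R (psum^~ p) B (r0 / nm p.1) B0 h.
  by move=> k; rewrite /psum big_ord_recr /= addrAC subrr add0r; exact: term_le.
have -> : ssum p = l by apply: cvg_lim.
split=> // J; apply: le_trans (Hl J) _; rewrite ler_wpM2r ?exprn_ge0 //.
rewrite /B1 ler_wpM2l // lef_pV2 ?posrE ?subr_gt0 //; last by case/andP: h.
by rewrite lerB.
Qed.

Lemma ssum_dif (p : C * X) : r1 < nm p.1 -> TV p.2 -> differentiable ssum p.
Proof.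
move=> hp tp; pose D : set C := [set z | r1 < nm z].
have oD : open D.
  apply/openC_nm => z hz; exists (nm z - r1); first by rewrite subr_gt0.
  by move=> y; rewrite /D /= nmB; have := nmBD z y; lra.
have B10 : 0 <= B1.
  by have /andP[_ b2] := q01; rewrite /B1 mulr_ge0 // invr_ge0 subr_ge0 ltW.
have [|||||d1 _] := @dif_limw R (C * X)%type (dom D TV) (fun=> B1) psum ssum (open_dom oD oTV) _ _ _ _ p _; last exact: d1.
- by move=> x _; exists 1 => //; exists B1.
- move=> J q [q1 q2]; have q0 : q.1 != 0 by rewrite -nm_gt0; apply: lt_trans q1.
  apply: dif_sum => k; apply: difM.
    have h1 := dif_comp1 (dif_fst q) (isd_V q0).
    exact: (dif_comp1 h1 (isdX _ _)).
  exact: (dif_comp (dif_snd q) (cd k q2)).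
- move=> J q [/ltW q1 q2]; apply: le_trans (nm_sum _ _ _) _.
  have /andP[a1 a2] := q_le q1.
  apply: le_trans (_ : \sum_(k < J) B * (r0 / r1) ^+ k <= _).
    apply: ler_sum => k _; apply: le_trans (term_le k q1 q2) _.
    by rewrite ler_wpM2l // lerXn2r // nnegrE (le_trans a1).
  by rewrite -mulr_sumr ler_wpM2l //; apply: geo_sum_le.
- by move=> q [/ltW q1 q2]; case: (ssum_cvg q1 q2).
- by [].
Qed.

End PowerSum.

Section NormalForm.
Variable R : realType.
Local Notation C := R[i].

Lemma dif_locbd (V W : normedModType C) (f : V -> W) x : differentiable f x ->
  exists2 r : R, 0 < r & exists N : nat, forall y, nm (y - x) < r -> nm (f y) <= N%:R.
Proof.
move=> /differentiable_continuous /cont_nmP /(_ 1 ltr01) [r r0 H].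
exists r => //; have [N hN] : exists N : nat, nm (f x) + 1 <= N%:R.
  by exists (Num.truncn (nm (f x) + 1)).+1; apply/ltW/truncnS_gt.
exists N => y /H h; apply: le_trans hN; have := nmBD (f y) (f x).
by move: h; clear; lra.
Qed.

Lemma dif_id (V : normedModType C) (x : V) : differentiable (fun y : V => y) x.
Proof.
by apply: (@lin_dif R V V (fun y : V => y) 1) => [a v w //|h]; rewrite mul1r.
Qed.

Lemma nm_mulmx m n p (M : 'M[C]_(m, n)) (N : 'M[C]_(n, p)) i j (a b : R) :
  (forall k, nm (M i k) <= a) -> (forall k, nm (N k j) <= b) ->
  nm ((M *m N) i j) <= n%:R * (a * b).
Proof.
move=> ha hb; rewrite mxE; apply: le_trans (nm_sum _ _ _) _.
apply: le_trans (_ : \sum_(k < n) a * b <= _).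
  by apply: ler_sum => k _; rewrite nmM ler_pM ?nm_ge0.
by rewrite sumr_const card_ord mulr_natl.
Qed.

Lemma cvg_entry m n (M : nat -> 'M[C]_(m, n)) (L : 'M[C]_(m, n)) i j :
  M @ \oo --> L -> (fun k => M k i j) @ \oo --> L i j.
Proof.
move=> /cvgn_nmP h; apply/cvgn_nmP => e /h [N HN]; exists N => k /HN.
by apply: le_trans; have := nm_entry (M k - L) i j; rewrite !mxE.
Qed.

(* The system conjugated by [G0]: [S] has the expansion sum_k Ah_k z^(-k) at
   infinity, with remainders bounded uniformly in t. *)
Record normal_form n (X : normedModType C) (TV : set X) (r1 : R)
    (u : X -> 'rV[C]_n) (Ah : nat -> X -> 'M[C]_n) (S : C * X -> 'M[C]_n) : Prop :=
  NormalForm {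
  nf_TV : open TV;
  nf_r : 0 < r1;
  nf_Ad : forall k t i j, TV t -> differentiable (fun t => Ah k t i j) t;
  nf_A0 : forall t, TV t -> Ah 0%N t = diag_mx (u t);
  nf_Sd : forall p i j, r1 < nm p.1 -> TV p.2 -> differentiable (fun p => S p i j) p;
  nf_S : forall m : nat, exists2 Ab : R, 0 <= Ab &
    forall t, TV t -> (forall k i j, (k <= m)%N -> nm (Ah k t i j) <= Ab) /\
      forall z J i j, r1 <= nm z -> (J <= m)%N ->
       nm (S (z, t) i j - \sum_(k < J) z^-1 ^+ k * Ah k t i j) <= Ab * (nm z)^-1 ^+ J }.

(** The extension of A is used only near the compact set of points with |z| = N0 and t in the
    polydisc. The circle integrals give coefficients of geometric growth, holomorphic on [TV], and
    the conjugated system is recovered as their sum. *)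
Lemma ex_normal_form n (eps0 N0 : R) (hN0 : 0 < N0)
  (A : C -> 'rV[C]_n -> 'M[C]_n) (Ak : nat -> 'rV[C]_n -> 'M[C]_n)
  (hA : holomorphic_on
     [set p : C * 'rV[C]_n | N0%:C <= `|p.1| /\ polydisc 0 eps0 p.2]
     (fun p => A p.1 p.2))
  (hAk : forall (z : C) t, N0%:C <= `|z| -> polydisc 0 eps0 t ->
     series (fun j => z ^- j *: Ak j t) @ \oo --> A z t)
  (G0 : 'rV[C]_n -> 'M[C]_n) (u : 'rV[C]_n -> 'rV[C]_n)
  (hG0 : holomorphic_on (polydisc 0 eps0) G0)
  (hG0u : forall t, polydisc 0 eps0 t -> G0 t \in unitmx)
  (hdiag : forall t, polydisc 0 eps0 t ->
     invmx (G0 t) *m Ak 0%N t *m G0 t = diag_mx (u t))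
  (hlin : forall t a, polydisc 0 eps0 t -> u t 0 a = u 0 0 a + t 0 a) :
  exists (TV : set 'rV[C]_n) (r1 : R) (gG : 'rV[C]_n -> 'M[C]_n) Ah S,
   [/\ normal_form TV r1 (fun t => u 0 + t) Ah S, r1 < N0, polydisc 0 eps0 `<=` TV,
       forall t, TV t -> [/\ differentiable gG t, gG t \in unitmx & polydisc 0 eps0 t -> gG t = G0 t]
     & forall t, polydisc 0 eps0 t ->
        (forall k, Ah k t = invmx (G0 t) *m Ak k t *m G0 t) /\
        forall z, N0 <= nm z -> S (z, t) = invmx (G0 t) *m A z t *m G0 t].
Proof.
pose X := 'rV[C]_n; pose P : set X := polydisc 0 eps0.
have [OA [gA [oOA subA dA eA]]] := hA; have [OG [gG [oOG subG dG eG]]] := hG0.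
have uG t : P t -> gG t \in unitmx by move=> Pt; rewrite eG // hG0u.
pose V := (C * X)%type.
(* All that is needed near the compact set, with one bound N: both extensions are available, the
   extension of [G0] is invertible, and everything is bounded. *)
pose Q N (p : V) := [/\ OA p, nm (gA p) <= N%:R, OG p.2, gG p.2 \in unitmx &
  [/\ nm (gG p.2) <= N%:R, nm (invmx (gG p.2)) <= N%:R & nm (u 0 + p.2) <= N%:R]].
have cK := compact_setX (@compact_circle R N0) (@compact_polydisc R n eps0).
have [||N HN] := @compact_uniform R V _ Q cK.
- move=> N N' p NN' [h1 h2 h3 h4 [h5 h6 h7]].
  have hh : N%:R <= (N'%:R : R) by rewrite ler_nat.
  by split=> //; [exact: le_trans hh|split; exact: le_trans hh].
- move=> [z t] [/= hz Pt].
  have mem : OA (z, t) by apply: subA; split=> //=; rewrite -nmE lecR hz.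
  have Gt := subG _ Pt.
  have [ra ra0 Ha] := (openC_nm OA).1 oOA _ mem.
  have [rb rb0 Hb] := (openC_nm OG).1 oOG _ Gt.
  have [rc rc0 [Nc Hc]] := dif_locbd (dA _ mem).
  have [rd rd0 [Nd Hd]] := dif_locbd (dG _ Gt).
  have dGi : differentiable (fun t => invmx (gG t)) t.
    by apply: dif_mx => i j; apply: dif_inv (uG _ Pt) _ i j => i j; apply: dif_entry (dG _ Gt).
  have [re re0 [Ne He]] := dif_locbd dGi.
  have du : differentiable (fun t : X => u 0 + t) t.
    by apply: differentiableD; [exact: dif_cst|exact: dif_id].
  have [rf rf0 [Nf Hf]] := dif_locbd du.
  have dd : differentiable (fun t => \det (gG t)) t.
    by apply: dif_det => i j; apply: dif_entry (dG _ Gt).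
  have d0 : 0 < nm (\det (gG t)) by have := uG _ Pt; rewrite unitmxE unitfE -nm_gt0.
  have d02 : 0 < nm (\det (gG t)) / 2 by rewrite divr_gt0.
  have /cont_nmP/(_ _ d02) [rg rg0 Hg] := differentiable_continuous dd.
  pose r := Num.min ra (Num.min rb (Num.min rc (Num.min rd (Num.min re (Num.min rf rg))))).
  exists r; first by rewrite /r !lt_min ra0 rb0 rc0 rd0 re0 rf0 rg0.
  exists (maxn Nc (maxn Nd (maxn Ne Nf))) => y hy.
  move: (hy); rewrite /r !lt_min => /and5P[h1 _ h3 _ _].
  have := le_lt_trans (nm_snd (y - (z, t))) hy.
  rewrite /r !lt_min /= => /and5P[_ g2 _ g4 /and3P[g5 g6 g7]].
  have le4 k : (k <= maxn Nc (maxn Nd (maxn Ne Nf)))%N ->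
     k%:R <= (maxn Nc (maxn Nd (maxn Ne Nf)))%:R :> R by rewrite ler_nat.
  split.
  + exact: Ha.
  + by apply: le_trans (Hc _ h3) (le4 _ _); rewrite leq_maxl.
  + exact: Hb.
  + have := Hg _ g7; have := nmBD (\det (gG t)) (\det (gG y.2)).
    rewrite unitmxE unitfE -nm_gt0 (nmB (\det (gG t))).
    by move: d0; clear; lra.
  + split.
    * by apply: le_trans (Hd _ g4) (le4 _ _); rewrite !leq_max leqnn ?orbT.
    * by apply: le_trans (He _ g5) (le4 _ _); rewrite !leq_max leqnn ?orbT.
    * by apply: le_trans (Hf _ g6) (le4 _ _); rewrite !leq_max leqnn ?orbT.
pose de : R := N.+1%:R^-1.
have de0 : 0 < de by rewrite invr_gt0.
pose TV : set X := [set t | exists2 s, P s & nm (t - s) < de].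
have oTV : open TV.
  apply/openC_nm => t [s Ps ts]; exists (de - nm (t - s)); first by rewrite subr_gt0.
  move=> y hy; exists s => //; apply: le_lt_trans (nm_tri y t s) _.
  by move: hy; clear; lra.
have PTV : P `<=` TV by move=> t Pt; exists t => //; rewrite subrr nm0.
pose r0 := N0 - Num.min de N0 / 2.
have [m1 m2] : Num.min de N0 <= de /\ Num.min de N0 <= N0 by rewrite !ge_min !lexx orbT.
have m0 : 0 < Num.min de N0 by rewrite lt_min de0.
have r00 : 0 < r0 by rewrite /r0; move: m0 m2 hN0; clear; lra.
have rN : r0 < N0 by rewrite /r0; move: m0; clear; lra.
(* z is compared with its radial projection on the circle |z| = N0, at distance N0 - |z| < [de]. *)
have HQ z t : r0 <= nm z <= N0 -> TV t -> Q N (z, t).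
  move=> /andP[z1 z2] [s Ps ts]; have z0 : 0 < nm z := lt_le_trans r00 z1.
  apply: (HN (z * (N0 / nm z)%:C, s)).
    split=> //=; rewrite nmM nmC ger0_norm ?divr_ge0 ?ltW // mulrC divfK //.
    by rewrite gt_eqF.
  rewrite nm_pair /= gt_max ts andbT.
  rewrite (_ : z - _ = z * (1 - N0 / nm z)%:C); last first.
    by rewrite rmorphB /= mulrBr mulr1.
  rewrite nmM nmC ler0_norm; last by rewrite subr_le0 ler_pdivlMr // mul1r.
  rewrite opprB mulrBr mulr1 mulrCA divff ?gt_eqF // mulr1.
  by apply: lt_le_trans m1; move: z1 m0; rewrite /r0; clear; lra.
have HT t : TV t -> [/\ OG t, gG t \in unitmx & [/\ nm (gG t) <= N%:R, nm (invmx (gG t)) <= N%:R & nm (u 0 + t) <= N%:R]].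
  move=> tt; have [|_ _ a1 a2 a3] := HQ r0%:C t _ tt; last by [].
  by rewrite nmC (ger0_norm (ltW r00)) lexx ltW.
have NN0 : 0 <= (N%:R : R) by [].
pose Ac k t : 'M[C]_n := \matrix_(i, j) lcoef (fun p => gA p i j) r0 k t.
have gd i j z t : nm z = r0 -> TV t -> differentiable (fun p => gA p i j) (z, t).
  move=> hz tt; have [|a1 _ _ _ _] := HQ z t _ tt; first by rewrite hz lexx ltW.
  exact: dif_entry (dA _ a1).
have gb i j z t : nm z = r0 -> TV t -> nm (gA (z, t) i j) <= N%:R.
  move=> hz tt; have [|_ a1 _ _ _] := HQ z t _ tt; first by rewrite hz lexx ltW.
  exact: le_trans (nm_entry _ i j) a1.
have Acd k i j t : TV t -> differentiable (fun t => Ac k t i j) t.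
  move=> tt; rewrite (_ : (fun t => _) = lcoef (fun p => gA p i j) r0 k).
    exact: (lcoef_dif oTV r00 (gd i j) (gb i j) k tt).
  by apply/funext => t'; rewrite mxE.
have Acb k i j t : TV t -> nm (Ac k t i j) <= N%:R * r0 ^+ k.
  by move=> tt; rewrite mxE; exact: (lcoef_le r00 (gd i j) (gb i j) k tt).
have Ace k t : P t -> Ac k t = Ak k t.
  move=> Pt; apply/matrixP => i j; rewrite mxE.
  apply: (@lcoef_eq R X P _ r0 N0 (fun k t => Ak k t i j) r00 rN _ _ k t Pt).
    move=> z s hz Ps; have [zN|/ltW zN] := leP (nm z) N0.
      have [|a1 _ _ _ _] := HQ z s _ (PTV _ Ps); first by rewrite hz.
      exact: dif_entry (dA _ a1).
    by apply/dif_entry/dA/subA; split=> //=; rewrite -nmE lecR.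
  move=> z s hz Ps; have hz' : N0%:C <= `|z| by rewrite -nmE lecR.
  have := @cvg_entry n n (series (fun j => z ^- j *: Ak j s)) (A z s) i j (hAk z s hz' Ps).
  rewrite eA /=; last by split.
  apply: cvgC_ext => m; rewrite seriesEnat /= summxE big_mkord.
  by apply: eq_bigr => k' _; rewrite mxE exprVn.
(* Off the polydisc the conjugate of the leading coefficient need not be diagonal; the linear
   eigenvalues extend it as a diagonal matrix. *)
pose Ah k t : 'M[C]_n := if k is 0%N then diag_mx (u 0 + t) else invmx (gG t) *m Ac k t *m gG t.
pose B : R := n%:R * (n%:R * (N%:R * N%:R) * N%:R) + N%:R.
have B0 : 0 <= B by rewrite /B addr_ge0 // !mulr_ge0.
have Ahd k i j t : TV t -> differentiable (fun t => Ah k t i j) t.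
  move=> tt; have [a1 a2 _] := HT _ tt; case: k => [|k] /=.
    rewrite /Ah; have [->|ij] := eqVneq i j.
      under eq_fun do rewrite !mxE eqxx mulr1n; apply: (difD _ _).1; first exact: dif_cst.
      exact: differentiable_coord.
    by under eq_fun do rewrite !mxE (negbTE ij) mulr0n; exact: dif_cst.
  rewrite /Ah; under eq_fun do rewrite mxE; apply: dif_sum => l.
  apply: difM; last exact: dif_entry (dG _ a1).
  under eq_fun do rewrite mxE; apply: dif_sum => l'.
  apply: difM (Acd _ _ _ _ tt).
  by apply: dif_inv a2 _ i l' => a b; exact: dif_entry (dG _ a1).
have Ahb k i j t : TV t -> nm (Ah k t i j) <= B * r0 ^+ k.
  move=> tt; have [a1 a2 [a3 a4 a5]] := HT _ tt.
  have sB : n%:R * (n%:R * (N%:R * N%:R) * N%:R) <= B by rewrite /B lerDl.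
  have e0 k' : 0 <= r0 ^+ k' by rewrite exprn_ge0 ?ltW.
  case: k => [|k].
    rewrite /Ah expr0 mulr1 mxE; have [_|_] := eqVneq i j; last by rewrite mulr0n nm0.
    rewrite mulr1n; apply: le_trans (nm_entry _ _ _) _; apply: le_trans a5 _.
    by rewrite /B lerDr !mulr_ge0.
  have h1 i' l : nm ((invmx (gG t) *m Ac k.+1 t) i' l) <= n%:R * (N%:R * (N%:R * r0 ^+ k.+1)).
    by apply: nm_mulmx => l'; [exact: le_trans (nm_entry _ _ _) a4|exact: Acb].
  have h2 l : nm (gG t l j) <= N%:R by exact: le_trans (nm_entry _ _ _) a3.
  rewrite /Ah; apply: le_trans (nm_mulmx (h1 i) h2) _.
  apply: le_trans (ler_wpM2r (e0 k.+1) sB); rewrite le_eqVlt; apply/orP; left; apply/eqP.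
  by ring.
(* Above r0, so that the series converges geometrically for |z| >= r1, and below N0, so that |z| >=
   N0 lies in the open domain |z| > r1. *)
pose r1 := (r0 + N0) / 2.
have r01 : r0 < r1 by rewrite /r1; move: rN; clear; lra.
have r1N : r1 < N0 by rewrite /r1; move: rN; clear; lra.
pose S (p : V) : 'M[C]_n := \matrix_(i, j) ssum (fun k t => Ah k t i j) p.
pose B1 := B / (1 - r0 / r1).
have hq : 0 <= 1 - r0 / r1 < 1.
  rewrite subr_ge0 ltrBlDr ltrDl divr_gt0 ?(lt_trans r00 r01) // andbT.
  by rewrite ler_pdivrMr ?(lt_trans r00 r01) // mul1r ltW.
have q0 : 0 < 1 - r0 / r1 by rewrite subr_gt0 ltr_pdivrMr ?(lt_trans r00 r01) // mul1r.
have BB1 : B <= B1.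
  by have /andP[_ /ltW q1] := hq; rewrite /B1 ler_pdivlMr // ler_piMr.
exists TV, r1, gG, Ah, S; split=> //.
- split=> //.
  + exact: lt_trans r01.
  + by move=> k t i j; exact: Ahd.
  + move=> [z t] i j hz tt; rewrite (_ : (fun p => _) = ssum (fun k t => Ah k t i j)).
      exact: (ssum_dif oTV B0 r00 r01 (fun k t tt => Ahd k i j t tt) (fun k t tt => Ahb k i j t tt)).
    by apply/funext => p; rewrite mxE.
  + move=> m; pose e := (1 + r0) ^+ m.
    have e1 k : (k <= m)%N -> r0 ^+ k <= e.
      move=> km; have h : 1 <= 1 + r0 by rewrite lerDl ltW.
      apply: le_trans (_ : (1 + r0) ^+ k <= e); last by rewrite /e ler_weXn2l.
      have h0 : r0 <= 1 + r0 by rewrite lerDr.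
      by apply: (lerXn2r k _ _ h0); rewrite nnegrE; [exact: ltW|apply: le_trans h0; exact: ltW].
    have e0 : 0 <= e by rewrite exprn_ge0 // addr_ge0 // ltW.
    exists (B1 * e); first by rewrite mulr_ge0 // (le_trans B0).
    move=> t tt; split=> [k i j km|z J i j hz Jm].
      apply: le_trans (Ahb k i j t tt) _.
      by apply: ler_pM BB1 (e1 _ km) => //; rewrite exprn_ge0 // ltW.
    have [_ h] := @ssum_cvg R X TV _ B r0 r1 B0 r00 r01 (fun k t tt => Ahb k i j t tt) (z, t) hz tt.
    rewrite mxE; apply: le_trans (h J) _; rewrite exprMn mulrA ler_wpM2r //.
      by rewrite exprn_ge0 // invr_ge0 nm_ge0.
    by rewrite ler_wpM2l ?e1 // (le_trans B0).
- by move=> t tt; have [a1 a2 _] := HT _ tt; split=> //; [exact: dG|exact: eG].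
move=> t Pt; have AhE k : Ah k t = invmx (G0 t) *m Ak k t *m G0 t.
  case: k => [|k]; last by rewrite /Ah Ace // eG.
  rewrite /Ah hdiag //; congr diag_mx; apply/rowP => a.
  by rewrite hlin // !mxE.
split=> // z hz; apply/matrixP => i j; rewrite mxE.
have hz1 : r1 <= nm (z, t).1 by apply: le_trans (ltW r1N) hz.
have [h _] := @ssum_cvg R X TV _ B r0 r1 B0 r00 r01 (fun k t tt => Ahb k i j t tt) (z, t) hz1 (PTV _ Pt).
apply: (cvgC_unique h).
have hz' : N0%:C <= `|z| by rewrite -nmE lecR.
pose f (M : 'M[C]_n) := (invmx (G0 t) *m M *m G0 t) i j.
have df : differentiable f (A z t).
  rewrite /f; under eq_fun do rewrite mxE; apply: dif_sum => l.
  apply: difM; last exact: dif_cst.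
  under eq_fun do rewrite mxE; apply: dif_sum => l'.
  by apply: difM; [exact: dif_cst|exact: differentiable_coord].
have := cvg_comp _ _ (hAk z t hz' Pt) (differentiable_continuous df).
apply: cvgC_ext => m; rewrite /= /f seriesEnat /= big_mkord mulmx_sumr mulmx_suml summxE.
by apply: eq_bigr => k _; rewrite AhE -scalemxAr -scalemxAl mxE exprVn.
Qed.

End NormalForm.

(** * Fundamental matrices and uniqueness *)

Section Fundamental.
Variable R : realType.
Local Notation C := R[i].

Definition cconvex (D : set C) : Prop :=
  forall a b : C, D a -> D b -> forall s : C, seg a (b - a) s -> D s.

Lemma isd0_const (g : C -> C) (D : set C) : cconvex D ->
  (forall w, D w -> is_derive w (1 : C) g 0) ->
  forall a b, D a -> D b -> g a = g b.
Proof.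
move=> cD dg a b Da Db.
have h : nm (g (a + (b - a)) - g a) <= 0 * nm (b - a).
  apply: (@mean_value R g (fun=> 0)); first by move=> s /(cD _ _ Da Db); exact: dg.
  by move=> s _; rewrite nm0.
apply/esym/subr0_eq/eqP; rewrite -nm_le0.
by move: h; rewrite mul0r [a + _]addrC subrK.
Qed.

Lemma hplane_cconvex (l : R) : cconvex (hplane l).
Proof.
move=> a b; rewrite /hplane /= => ha hb s [r /andP[r0 r1] ->].
rewrite /= Re_add Re_rM Re_add Re_opp.
have -> : complex.Re a + r * (complex.Re b - complex.Re a) =
  (1 - r) * complex.Re a + r * complex.Re b by ring.
have [->|r1'] := eqVneq r 1; first by rewrite subrr mul0r add0r mul1r.
rewrite -[l]mul1r -[X in X * l](subrK r) mulrDl.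
apply: ltr_leD; first by rewrite ltr_pM2l // subr_gt0 lt_neqAle r1'.
by rewrite ler_wpM2l // ltW.
Qed.

Lemma hplane_nm (r1 : R) w : 0 < r1 -> hplane (ln r1) w -> r1 < nm (cexp w).
Proof. by move=> r0 h; rewrite nm_cexp -[X in X < _]lnK ?posrE // ltr_expR. Qed.

Section Fund.
Variables (n : nat) (X : normedModType C) (TV : set X) (r1 : R).
Variables (u : X -> 'rV[C]_n) (Ah : nat -> X -> 'M[C]_n) (S : C * X -> 'M[C]_n).
Hypothesis nf : normal_form TV r1 u Ah S.

Definition solves (t : X) (D : set C) (y : C -> 'M[C]_n) : Prop :=
  forall w i j, D w -> is_derive w (1 : C) (fun w => y w i j)
    (cexp w * (S (cexp w, t) *m y w) i j).

(** [Psi] solves the adjoint equation, whence [Psi] times any solution is constant on a convex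
    domain. Applied to [Phi] this gives the inverse without a Wronskian; applied to another solution
    it gives its connection matrix. *)
Lemma ex_fund (w1 : C) : hplane (ln r1) w1 ->
  exists Phi Psi : C * X -> 'M[C]_n,
  [/\ forall p i j, dom (hplane (ln r1)) TV p ->
        differentiable (fun p => Phi p i j) p /\ differentiable (fun p => Psi p i j) p,
      forall t, TV t -> solves t (hplane (ln r1)) (fun w => Phi (w, t)),
      forall t w, TV t -> hplane (ln r1) w -> Psi (w, t) *m Phi (w, t) = 1%:M
    & forall t (D : set C) (y : C -> 'M[C]_n), TV t -> cconvex D -> D `<=` hplane (ln r1) ->
        solves t D y -> forall w w', D w -> D w' -> Psi (w, t) *m y w = Psi (w', t) *m y w'].
Proof.
move=> hw1; have r0 := nf_r nf; have oTV := nf_TV nf.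
pose a i j (p : C * X) := cexp p.1 * S (cexp p.1, p.2) i j.
have ad i j p : dom (hplane (ln r1)) TV p -> differentiable (a i j) p.
  move=> [p1 p2]; have d1 : differentiable (fun p : C * X => cexp p.1) p.
    exact: dif_comp1 (dif_fst p) (isd_cexp p.1).
  apply: difM => //; apply: (@dif_comp R _ _ _ (fun p : C * X => (cexp p.1, p.2)) (fun p => S p i j)).
    by apply: differentiable_pair => //; exact: dif_snd.
  by apply: (nf_Sd nf) => //; exact: hplane_nm.
have [Ka Ka0 HKa] := nf_S nf 0.
have ab i j p : dom (hplane (ln r1)) TV p -> nm (a i j p) <= Ka * expR (complex.Re p.1).
  move=> [p1 p2]; rewrite nmM nm_cexp mulrC ler_wpM2r ?expR_ge0 //.
  have [_ h] := HKa _ p2; have := h (cexp p.1) 0%N i j (ltW (hplane_nm r0 p1)) (leqnn _).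
  by rewrite big_ord0 subr0 expr0 mulr1.
have ad' i j p : dom (hplane (ln r1)) TV p -> differentiable (fun p => - a j i p) p.
  by move=> hp; apply: differentiableN; exact: ad.
have ab' i j p : dom (hplane (ln r1)) TV p -> nm (- a j i p) <= Ka * expR (complex.Re p.1).
  by rewrite nmN; exact: ab.
have [f Hf] := choice (fun k : 'I_n => linear_ode oTV Ka0 ad ab hw1 (fun i => (i == k)%:R)).
have [g Hg] := choice (fun k : 'I_n => linear_ode oTV Ka0 ad' ab' hw1 (fun i => (k == i)%:R)).
pose Phi p : 'M[C]_n := \matrix_(i, j) f j i p.
pose Psi p : 'M[C]_n := \matrix_(i, j) g i j p.
have dPhi t : TV t -> solves t (hplane (ln r1)) (fun w => Phi (w, t)).
  move=> tt w i j hw; have [h1 _ h3] := Hf j.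
  have wt : dom (hplane (ln r1)) TV (w, t) by [].
  under eq_fun do rewrite mxE; apply: (isd_eq (dif_slice (h1 i _ wt))).
  apply: (etrans (h3 i _ wt)); rewrite mxE big_distrr /=.
  by apply: eq_bigr => l _; rewrite /a mxE /= mulrA.
have dPsi t w i j : TV t -> hplane (ln r1) w -> is_derive w (1 : C) (fun w => Psi (w, t) i j)
    (- (cexp w * (Psi (w, t) *m S (cexp w, t)) i j)).
  move=> tt hw; have [h1 _ h3] := Hg i.
  have wt : dom (hplane (ln r1)) TV (w, t) by [].
  under eq_fun do rewrite mxE; apply: (isd_eq (dif_slice (h1 j _ wt))).
  apply: (etrans (h3 j _ wt)); rewrite mxE big_distrr -sumrN /=.
  by apply: eq_bigr => l _; rewrite /a mxE /=; ring.
have const t (D : set C) (y : C -> 'M[C]_n) : TV t -> cconvex D -> D `<=` hplane (ln r1) ->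
    solves t D y -> forall w w', D w -> D w' -> Psi (w, t) *m y w = Psi (w', t) *m y w'.
  move=> tt cD sD sy w w' Dw Dw'; apply/matrixP => i j.
  apply: (@isd0_const (fun w => (Psi (w, t) *m y w) i j) D cD) Dw Dw' => {}w Dw.
  under eq_fun do rewrite mxE.
  have := isd_sum (index_enum 'I_n) (fun k => isdM (dPsi t w i k tt (sD _ Dw)) (sy w k j Dw)).
  move/isd_eq; apply.
  rewrite big_split /= (eq_bigr (fun k => - cexp w * ((Psi (w, t) *m S (cexp w, t)) i k * y w k j))); last first.
    by move=> k _; ring.
  rewrite -mulr_sumr -[X in - cexp w * X + _](_ : ((Psi (w, t) *m S (cexp w, t)) *m y w) i j = _); last by rewrite mxE.
  rewrite [X in _ + X](eq_bigr (fun k => cexp w * (Psi (w, t) i k * (S (cexp w, t) *m y w) k j))); last first.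
    by move=> k _; ring.
  rewrite -mulr_sumr -[X in _ + cexp w * X](_ : (Psi (w, t) *m (S (cexp w, t) *m y w)) i j = _); last by rewrite mxE.
  by rewrite mulmxA mulNr addNr.
exists Phi, Psi; split=> //.
- move=> p i j hp; split.
    have [h1 _ _] := Hf j; rewrite (_ : (fun p => _) = f j i); first exact: h1.
    by apply/funext => q; rewrite mxE.
  have [h1 _ _] := Hg i; rewrite (_ : (fun p => _) = g i j); first exact: h1.
  by apply/funext => q; rewrite mxE.
- move=> t w tt hw.
  rewrite (const t _ _ tt (@hplane_cconvex _) (fun w h => h) (dPhi t tt) w w1 hw hw1).
  rewrite (_ : Psi (w1, t) = 1%:M).
    rewrite mul1mx; apply/matrixP => i j; rewrite !mxE; have [_ h _] := Hf j.
    by rewrite h.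
  by apply/matrixP => i j; rewrite !mxE; have [_ h _] := Hg i; rewrite h.
Qed.

End Fund.
End Fundamental.

Section Uniqueness.
Variable R : realType.
Local Notation C := R[i].

(** Row i0 of N x is read at an entry of x of largest modulus: the perturbation of the identity
    removes at most half of it. *)
Lemma small_vec n (N : 'M[C]_n) (x : 'I_n -> C) (e eta : R) :
  (forall i, nm (\sum_k N i k * x k) <= e) ->
  (forall i k, nm (N i k - (i == k)%:R) <= eta) -> n%:R * eta <= 2^-1 ->
  forall i, nm (x i) <= 2 * e.
Proof.
move=> hx hN hn i.
have [i0 _ H] := @arg_maxP _ R _ i xpredT (fun k => nm (x k)) isT.
apply: le_trans (H i isT) _.
have E : x i0 = \sum_k N i0 k * x k - \sum_k (N i0 k - (i0 == k)%:R) * x k.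
  rewrite -sumrB (bigD1 i0) //= eqxx big1 ?addr0; last first.
    by move=> k /negbTE ki; rewrite eq_sym ki subr0 subrr.
  by rewrite mulr1n mulrBl mul1r opprB addrC subrK.
have h1 : nm (x i0) <= e + n%:R * eta * nm (x i0).
  rewrite {1}E; apply: le_trans (nmD _ _) _; rewrite nmN.
  apply: lerD; first exact: hx.
  apply: le_trans (nm_sum _ _ _) _.
  apply: le_trans (_ : \sum_(k < n) eta * nm (x i0) <= _); last first.
    by rewrite sumr_const card_ord -[_ *+ n]mulr_natl mulrA.
  apply: ler_sum => k _; rewrite nmM ler_pM ?nm_ge0 //; exact: H.
have h2 : n%:R * eta * nm (x i0) <= 2^-1 * nm (x i0) by rewrite ler_wpM2r ?nm_ge0.
by move: h1 h2; clear; lra.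
Qed.

(** With r = log |z|, the exponential term c |z| dominates the logarithmic contribution of z^B. Here
    exp r >= (1 + r / 2)^2 suffices. *)
Lemma exp_growth (c be b0 : R) : 0 < c -> 0 <= be -> 0 <= b0 ->
  exists M, forall r, M <= r -> be * (`|r| + b0) <= c * expR r.
Proof.
move=> c0 be0 b00; have h0 : 0 <= be * (1 + b0) by rewrite mulr_ge0 // addr_ge0.
exists (1 + 4 * (be * (1 + b0) / c)) => r hr.
have q0 : 0 <= be * (1 + b0) / c by rewrite divr_ge0 // ltW.
have r1 : 1 <= r by move: hr q0; clear; lra.
have r0 : 0 <= r by apply: le_trans r1.
have e1 : (1 + r / 2) ^+ 2 <= expR r.
  rewrite [X in expR X]splitr expRD -expr2; apply: lerXn2r; rewrite ?nnegrE.
  - by rewrite addr_ge0 // divr_ge0.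
  - exact: expR_ge0.
  - exact: expR_ge1Dx.
have e2 : r * (4 * (be * (1 + b0) / c)) <= r * r.
  by rewrite ler_wpM2l //; move: hr; clear; lra.
have e3 : be * (1 + b0) * (4 * r) <= c * (r * r).
  have -> : be * (1 + b0) * (4 * r) = c * (r * (4 * (be * (1 + b0) / c))).
    by field; rewrite gt_eqF.
  by rewrite ler_wpM2l // ltW.
have e4 : be * (r + b0) <= be * (1 + b0) * r.
  rewrite -mulrA ler_wpM2l // mulrDl mul1r lerD2l -[X in X <= _]mulr1.
  by rewrite ler_wpM2l.
have e5 : c * (r * r) <= 4 * (c * expR r).
  rewrite [leRHS]mulrCA ler_wpM2l ?(ltW c0) //.
  have h : r * r <= 4 * (1 + r / 2) ^+ 2 by rewrite expr2; move: r0; clear; nra.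
  by apply: le_trans h _; rewrite ler_wpM2l.
by rewrite ger0_norm //; move: e3 e4 e5; clear; nra.
Qed.

Lemma exp_small (x K M : R) : 0 <= K -> (forall r, M <= r -> x <= K / expR r) -> x <= 0.
Proof.
move=> K0 H; rewrite leNgt; apply/negP => x0.
pose r := Num.max M (K / x).
have h1 : M <= r by rewrite le_max lexx.
have h2 : K <= x * r by rewrite mulrC -ler_pdivrMr // /r le_max lexx orbT.
have := H r h1; rewrite ler_pdivlMr ?expR_gt0 // => h3.
have h4 : x * (1 + r) <= x * expR r by rewrite ler_wpM2l ?(ltW x0) // expR_ge1Dx.
by move: h2 h3 h4 x0; clear; lra.
Qed.

Lemma le_expR (x : R) : x <= expR x.
Proof. by have := expR_ge1Dx x; lra. Qed.

Section Rays.
Variables (n : nat) (Ph : C -> 'M[C]_n) (u b : 'rV[C]_n) (ttau : R).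

Definition nrm (Cm : 'M[C]_n) (w : C) : 'M[C]_n :=
  Ph w *m Cm *m expdiag (- (cexp w *: u)) *m expdiag (- (w *: b)).

(* The normalized solution tends to 1 along the two rays bounding the half-plane
   of directions [ttau - pi, ttau]; this alone determines the connection matrix. *)
Definition good (Cm : 'M[C]_n) : Prop := exists K M : R, forall w : C,
  carg w = ttau \/ carg w = ttau - pi -> M <= cmod w ->
  forall i j, nm (nrm Cm w i j - (i == j)%:R) <= K / cmod w.

Lemma nrmE Cm w i j : nrm Cm w i j =
  (Ph w *m Cm) i j * (cexp (- (cexp w * u 0 j)) * cexp (- (w * b 0 j))).
Proof. by rewrite /nrm /expdiag !mul_mx_diag !mxE mulrA. Qed.

Lemma goodP Cm : good Cm -> exists2 K : R, 0 <= K & exists M : R, forall w : C,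
  carg w = ttau \/ carg w = ttau - pi -> M <= complex.Re w ->
  [/\ forall i j, nm (nrm Cm w i j - (i == j)%:R) <= K / expR (complex.Re w)
    & n%:R * (K / expR (complex.Re w)) <= 2^-1].
Proof.
move=> [K [M H]]; pose K' := Num.max K 0; have K'0 : 0 <= K' by rewrite le_max lexx orbT.
exists K' => //; exists (Num.max M (2 * (n%:R * K'))) => w hw; rewrite ge_max => /andP[h1 h2].
have e1 : complex.Re w <= expR (complex.Re w).
  exact: le_expR.
split=> [i j|].
  apply: le_trans (H w hw (le_trans h1 e1) i j) _.
  by rewrite ler_wpM2r ?invr_ge0 ?expR_ge0 // le_max lexx.
rewrite mulrA ler_pdivrMr ?expR_gt0 //.
have {h2} := le_trans h2 e1; set a := n%:R * K'; set y := expR _.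
by lra.
Qed.

(** At one point far out on a ray the normalized matrix is so close to 1 that it is invertible, and
    [Cm] is one of its factors. *)
Lemma good_unit Cm : good Cm -> Cm \in unitmx.
Proof.
move=> /goodP[K K0 [M H]]; have [|h1 h2] := H (M +i* ttau) (or_introl erefl); first exact: lexx.
have : nrm Cm (M +i* ttau) \in unitmx.
  rewrite -unitmx_tr -row_free_unit.
  apply: inj_row_free => v hv; apply/rowP => k; rewrite mxE.
  apply/eqP; rewrite -nm_le0; have := small_vec (x := fun k => v 0 k) (e := 0) _ h1 h2 k.
  rewrite mulr0; apply=> i.
  have /rowP/(_ i) := hv; rewrite !mxE => hh.
  rewrite (_ : \sum__ _ = 0) ?nm0 //; rewrite -[RHS]hh; apply: eq_bigr => l _.
  by rewrite [in RHS]mxE mulrC.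
by rewrite /nrm !unitmx_mul => /andP[/andP[/andP[_ ->]]].
Qed.

Hypothesis sep : forall a c : 'I_n, a != c -> complex.Re ((u 0 a - u 0 c) * cis ttau) != 0.

(* On one of the two opposite rays the conjugating exponential
   e^((u_k - u_j) z) z^(b_k - b_j) grows, so the (k, j) entry vanishes. *)
Lemma good_unique C1 C2 : good C1 -> good C2 -> C1 = C2.
Proof.
move=> g1 g2; have u1 := good_unit g1.
have [K1 K10 [M1 H1]] := goodP g1; have [K2 K20 [M2 H2]] := goodP g2.
pose D := invmx C1 *m C2 - 1%:M.
have CD : C2 = C1 *m (1%:M + D) by rewrite /D addrC subrK mulmxA mulmxV // mul1mx.
pose E w j := cexp (- (cexp w * u 0 j)) * cexp (- (w * b 0 j)).
have E0 w j : E w j != 0 by rewrite mulf_neq0 ?cexp_neq0.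
(* The difference of the two normalized solutions is the first one times E^(-1) D E, with E
   diagonal; as the first is close to 1 and the difference is O(1/|z|), so is E^(-1) D E. *)
have key w k j : carg w = ttau \/ carg w = ttau - pi -> Num.max M1 M2 <= complex.Re w ->
    nm (D k j) * nm ((E w k)^-1 * E w j) <= 2 * (K1 + K2) / expR (complex.Re w).
  rewrite ge_max => hw /andP[m1 m2]; have [a1 a2] := H1 w hw m1; have [b1 _] := H2 w hw m2.
  have := small_vec (x := fun k => (E w k)^-1 * D k j * E w j)
    (e := (K1 + K2) / expR (complex.Re w)) _ a1 a2 k.
  rewrite -nmM [D k j * _]mulrA [D k j * _]mulrC -[2 * _ / _]mulrA; apply=> i.
  rewrite (_ : \sum__ _ = nrm C2 w i j - nrm C1 w i j).
    rewrite mulrDl [leRHS]addrC; apply: le_trans (nm_tri (nrm C2 w i j : C) ((i == j)%:R : C) (nrm C1 w i j))  _.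
    by apply: lerD; [exact: b1|rewrite nmB; exact: a1].
  rewrite !nrmE CD mulmxA mulmxDr mulmx1 [in X in X * _ - _]mxE mulrDl addrAC subrr add0r.
  rewrite mxE big_distrl /=; apply: eq_bigr => l _; rewrite nrmE -/(E w l) -/(E w j).
  by rewrite -[LHS]mulrA !(mulrA (E w l)) mulfV // mul1r mulrA.
suff D0 : D = 0 by rewrite CD D0 addr0 mulmx1.
apply/matrixP => k j; rewrite [RHS]mxE; apply/eqP; rewrite -nm_le0.
have gen th (M : R) : th = ttau \/ th = ttau - pi ->
    (forall r, M <= r -> 1 <= nm ((E (r +i* th) k)^-1 * E (r +i* th) j)) -> nm (D k j) <= 0.
  move=> hth hE; apply: (@exp_small _ (2 * (K1 + K2)) (Num.max M (Num.max M1 M2))).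
    by rewrite mulr_ge0 // addr_ge0.
  move=> r; rewrite ge_max => /andP[r1 r2]; apply: le_trans (key (r +i* th) k j hth r2).
  by rewrite ler_peMr ?nm_ge0 // hE.
(* On the diagonal the conjugation by E is trivial and decay alone suffices. *)
have [e|kj] := eqVneq k j.
  by apply: (gen ttau 0 (or_introl erefl)) => r _; rewrite e mulVf ?nm1.
have growth th : 0 < complex.Re ((u 0 k - u 0 j) * cis th) ->
    exists M, forall r, M <= r -> 1 <= nm ((E (r +i* th) k)^-1 * E (r +i* th) j).
  move=> c0; have [M HM] := exp_growth c0 (nm_ge0 (b 0 k - b 0 j)) (normr_ge0 th).
  exists M => r /HM hr; set w := r +i* th.
  rewrite /E invfM -!cexpN !opprK mulrACA -!cexpD nm_cexp -expR0 ler_expR.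
  rewrite (_ : _ + _ = (u 0 k - u 0 j) * cexp w + (b 0 k - b 0 j) * w); last by ring.
  rewrite Re_add cexp_polar /cmod /carg /= (_ : _ * _ = (expR r)%:C * ((u 0 k - u 0 j) * cis th)); last by rewrite mulrCA.
  rewrite Re_rM mulrC; have h1 := Re_le_nm ((b 0 k - b 0 j) * w).
  have h2 : nm ((b 0 k - b 0 j) * w) <= nm (b 0 k - b 0 j) * (`|r| + `|th|).
    by rewrite nmM ler_wpM2l ?nm_ge0 //; exact: nm_le_ReIm.
  move: h1; rewrite ler_norml => /andP[h1 _].
  by move: h1 h2 hr; lra.
have := sep kj; rewrite neq_lt => /orP[] c0.
  have [|M HM] := growth (ttau - pi); last by apply: gen HM; right.
  by rewrite -oppr_lt0 -Re_cis_pi subrK.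
by have [M HM] := growth _ c0; apply: gen HM; left.
Qed.

End Rays.
End Uniqueness.

(** * Actual solutions from formal ones *)

Section Residual.
Variable R : realType.
Local Notation C := R[i].

Lemma poly_low_bound (q : {poly C}) (m L : nat) (B : R) (x : C) : nm x <= 1 ->
  (size q <= L)%N -> (forall l, (l < m)%N -> q`_l = 0) ->
  (forall l, (l < L)%N -> nm q`_l <= B) -> nm q.[x] <= L%:R * B * nm x ^+ m.
Proof.
move=> x1 sq q0 qB; rewrite (horner_coef_wide _ sq).
apply: le_trans (nm_sum _ _ _) _.
apply: le_trans (_ : \sum_(i < L) B * nm x ^+ m <= _); last first.
  by rewrite sumr_const card_ord -[_ *+ L]mulr_natl mulrA.
apply: ler_sum => i _; rewrite nmM nmX.
have B0 : 0 <= B by apply: le_trans (nm_ge0 _) (qB i (ltn_ord i)).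
have [im|mi] := ltnP i m.
  by rewrite q0 // nm0 mul0r mulr_ge0 // exprn_ge0 // nm_ge0.
apply: ler_pM; rewrite ?nm_ge0 ?exprn_ge0 ?nm_ge0 ?qB //.
by rewrite ler_wiXn2l ?nm_ge0.
Qed.

(** Coefficient of z^(-k) in the defect A F - F (Lambda + b/z) - F' of a formal series F; it
    vanishes for all k exactly when F is formally a solution. *)
Definition fdef n (Ah : nat -> 'M[C]_n) (lam b : 'rV[C]_n) (F : nat -> 'M[C]_n) k :=
  fs_mul Ah F k - fs_mul F (fs_exponent lam b) k - fs_deriv F k.

Lemma fs_mul_exponent n (F : nat -> 'M[C]_n) (lam b : 'rV[C]_n) k c a :
  fs_mul F (fs_exponent lam b) k c a =
  F k c a * lam 0 a + (if k is k'.+1 then F k' c a * b 0 a else 0).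
Proof.
case: k => [|k]; rewrite /fs_mul.
  by rewrite big_ord1 addr0 subnn /= mul_mx_diag mxE.
rewrite big_ord_recr big_ord_recr /= subnn subSn // subnn /= big1 ?add0r.
  by rewrite !mul_mx_diag !mxE addrC.
move=> i _; have ik : (i < k)%N := ltn_ord i.
have -> : (k.+1 - i)%N = (k - i.+1).+2 by rewrite (subSn (ltnW ik)) (subnSK ik).
by rewrite mulmx0.
Qed.

(** With x = 1/z, [E] is the defect of the truncated column a. Up to the remainder of S it is a
    polynomial in x whose coefficients below x^m vanish; in component a the coefficient of x^m
    vanishes too. K depends only on n, m and the bounds; 2 Ab <= K is requested so that K also
    bounds the matrix of the correction equation. *)
Lemma residual_bound (n m : nat) (Ab Fb : R) : 0 <= Ab -> 0 <= Fb -> (0 < m)%N ->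
  exists2 K : R, 2 * Ab <= K & forall (S : 'M[C]_n) (Ah F : nat -> 'M[C]_n) (lam : 'rV[C]_n) (x : C) (a : 'I_n),
  nm x <= 1 -> (forall k i j, (k <= m)%N -> nm (Ah k i j) <= Ab) ->
  (forall k i j, nm (F k i j) <= Fb) -> (forall k, (m <= k)%N -> F k = 0) ->
  (forall i j, nm (S i j - \sum_(k < m.+1) x ^+ k * Ah k i j) <= Ab * nm x ^+ m.+1) ->
  Ah 0%N = diag_mx lam ->
  (forall k, (k < m)%N -> fdef Ah lam (diag_part (Ah 1%N)) F k = 0) ->
  fdef Ah lam (diag_part (Ah 1%N)) F m a a = 0 ->
  let p c := \sum_(k < m) F k c a * x ^+ k in
  let E c := \sum_c' S c c' * p c' - p c * (lam 0 a + Ah 1%N a a * x) +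
     \sum_(k < m) F k c a * (k%:R * x ^+ k.+1) in
  (forall c, nm (E c) <= K * nm x ^+ m) /\ nm (E a) <= K * nm x ^+ m.+1.
Proof.
(* L bounds the number of coefficients of the defect polynomial: the product of S truncated at order
   m with the column has degree below 2 m. *)
move=> Ab0 Fb0 m0; pose L := (m + m).+2; pose Lr : R := L%:R; pose nr : R := n%:R.
have Lr0 : 0 <= Lr by []. have nr0 : 0 <= nr by [].
pose Bc := nr * (Lr * (Ab * Fb)) + 2 * (Ab * Fb) + Lr * Fb.
have AF : 0 <= Ab * Fb by rewrite mulr_ge0.
have Bc0 : 0 <= Bc by rewrite /Bc !addr_ge0 // !mulr_ge0.
pose K0 := Lr * Bc + nr * (Ab * (Lr * Fb)).
have K00 : 0 <= nr * (Ab * (Lr * Fb)) by rewrite !mulr_ge0.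
have LB0 : 0 <= Lr * Bc by rewrite mulr_ge0.
exists (2 * Ab + K0); first by rewrite lerDl addr_ge0.
move=> S Ah F lam x a x1 hA hF F0 hS A0 d0 da p E.
pose SP c c' : {poly C} := \poly_(k < m.+1) Ah k c c'.
pose PP c : {poly C} := \poly_(k < m) F k c a.
pose DP c : {poly C} := \poly_(k < m.+1) (fs_deriv F k) c a.
pose b := diag_part (Ah 1%N).
pose EP c := \sum_c' SP c c' * PP c' - PP c * ((lam 0 a)%:P + (b 0 a) *: 'X) - DP c.
have ppE c k : (PP c)`_k = F k c a.
  by rewrite coef_poly; case: ltnP => // /F0 ->; rewrite mxE.
have px c : (PP c).[x] = p c by rewrite /PP horner_poly.
have dx c : (DP c).[x] = - \sum_(k < m) F k c a * (k%:R * x ^+ k.+1).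
  rewrite /DP horner_poly big_ord_recl /= mxE mul0r add0r -sumrN.
  by apply: eq_bigr => k _; rewrite /bump /= !mxE; ring.
have sx c c' : (SP c c').[x] = \sum_(k < m.+1) x ^+ k * Ah k c c'.
  by rewrite horner_poly; apply: eq_bigr => k _; rewrite mulrC.
have xx : 0 <= nm x := nm_ge0 x.
have EE c : E c = (EP c).[x] + \sum_c' (S c c' - (SP c c').[x]) * p c'.
  rewrite /EP !hornerD !hornerN horner_sum dx hornerM hornerD hornerZ hornerC hornerX px opprK.
  rewrite (_ : b 0 a = Ah 1%N a a); last by rewrite mxE.
  rewrite /E (_ : \sum_c' S c c' * p c' = \sum_c' (SP c c' * PP c').[x] + \sum_c' (S c c' - (SP c c').[x]) * p c').
    by ring.
  by rewrite -big_split /=; apply: eq_bigr => c' _; rewrite hornerM px; ring.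
have coefMX (q : {poly C}) (al be : C) l :
    (q * (al%:P + be *: 'X))`_l = q`_l * al + (if l is l'.+1 then q`_l' * be else 0).
  rewrite mulrDr coefD coefMC -scalerAr coefZ coefMX.
  by case: l => [|l] /=; rewrite ?mulr0 // [be * _]mulrC.
have coefSP c l : (\sum_c' SP c c' * PP c')`_l =
    \sum_c' \sum_(j < l.+1) (if (j < m.+1)%N then Ah j c c' else 0) * F (l - j)%N c' a.
  rewrite coef_sum; apply: eq_bigr => c' _; rewrite coefM.
  by apply: eq_bigr => j _; rewrite coef_poly ppE.
have dpE c l : (DP c)`_l = if (l < m.+1)%N then fs_deriv F l c a else 0 by exact: coef_poly.
have coefE c l : (l <= m)%N -> (EP c)`_l = fdef Ah lam b F l c a.
  move=> lm; rewrite /EP !coefB coefMX coefSP dpE ltnS lm /fdef !mxE fs_mul_exponent.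
  congr (_ - (_ + _) - _).
  - rewrite /fs_mul summxE exchange_big /=; apply: eq_bigr => j _.
    by rewrite mxE; apply: eq_bigr => c' _; rewrite (leq_trans (ltn_ord j)).
  - by rewrite ppE.
  - by case: l lm => // l _; rewrite ppE mxE.
have coefb c l : (l < L)%N -> nm (EP c)`_l <= Bc.
  move=> lL; have lLr : l.+1%:R <= Lr by rewrite ler_nat.
  rewrite /EP !coefB coefMX coefSP /Bc.
  apply: le_trans (nmD _ _) _; rewrite nmN; apply: lerD.
    apply: le_trans (nmD _ _) _; rewrite nmN; apply: lerD.
      apply: le_trans (nm_sum _ _ _) _.
      apply: le_trans (_ : \sum_(c' < n) Lr * (Ab * Fb) <= _); last first.
        by rewrite sumr_const card_ord -[_ *+ n]mulr_natl.
      apply: ler_sum => c' _; apply: le_trans (nm_sum _ _ _) _.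
      apply: le_trans (_ : \sum_(j < l.+1) (Ab * Fb) <= _); last first.
        by rewrite sumr_const card_ord -[_ *+ l.+1]mulr_natl ler_wpM2r.
      apply: ler_sum => j _; rewrite nmM ler_pM ?nm_ge0 //.
      by case: ltnP => // jm; [exact: hA|rewrite nm0].
    rewrite mulrDl mul1r; apply: le_trans (nmD _ _) _; apply: lerD.
      rewrite nmM mulrC ler_pM ?nm_ge0 // ?ppE //.
      by have := hA 0%N a a isT; rewrite A0 mxE eqxx mulr1n.
    case: (l) => [|l']; first by rewrite nm0.
    by rewrite nmM mulrC ler_pM ?nm_ge0 // ?ppE // mxE hA.
  rewrite dpE; case: ltnP => [lm|_]; last by rewrite nm0 mulr_ge0.
  case: (l) lLr => [|l'] lLr /=; first by rewrite mxE nm0 mulr_ge0.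
  rewrite !mxE nmN nmM ler_pM ?nm_ge0 //.
  have -> : (l'%:R : C) = (l'%:R : R)%:C by rewrite rmorph_nat.
  by rewrite nmC ger0_norm // (le_trans _ lLr) // ler_nat leqW.
have sizeE c : (size (EP c) <= L)%N.
  apply/leq_sizeP => l lL; rewrite /EP !coefB coefMX coefSP dpE.
  have ml : (m < l)%N by apply: leq_trans lL; rewrite /L ltnW // ltnS leq_addr.
  rewrite big1 => [|c' _].
    rewrite !ppE F0 ?(ltnW ml) // mxE mul0r !add0r.
    case: l lL ml => // l _ ml; rewrite ltnS [(l < m)%N]ltnNge (ltnSE ml) /= subr0.
    by rewrite ppE F0 // mxE mul0r oppr0.
  apply: big1 => j _; case: ltnP => jm; last by rewrite mul0r.
  rewrite F0 ?mxE ?mulr0 // leq_subRL; last by rewrite -ltnS ltn_ord.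
  have h : (j + m <= m + m)%N by rewrite leq_add2r -ltnS.
  by apply: leq_trans h _; apply: leq_trans lL; rewrite /L leqW // leqW.
have tail c : nm (\sum_c' (S c c' - (SP c c').[x]) * p c') <= nr * (Ab * (Lr * Fb)) * nm x ^+ m.+1.
  apply: le_trans (nm_sum _ _ _) _.
  apply: le_trans (_ : \sum_(c' < n) Ab * nm x ^+ m.+1 * (Lr * Fb) <= _); last first.
    by rewrite sumr_const card_ord -[_ *+ n]mulr_natl le_eqVlt; apply/orP; left; apply/eqP; rewrite /nr; ring.
  apply: ler_sum => c' _; rewrite nmM ler_pM ?nm_ge0 // ?sx //.
  apply: le_trans (nm_sum _ _ _) _.
  apply: le_trans (_ : \sum_(k < m) Fb <= _).
    apply: ler_sum => k _; rewrite nmM nmX -[leRHS]mulr1 ler_pM ?nm_ge0 ?exprn_ge0 //.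
    by rewrite exprn_ile1.
  by rewrite sumr_const card_ord -[_ *+ m]mulr_natl ler_wpM2r // ler_nat /L leqW // leqW // leq_addr.
have K1 : Lr * Bc <= 2 * Ab + K0 - nr * (Ab * (Lr * Fb)) by rewrite /K0; lra.
have fin c l : (forall j, (j < l)%N -> (EP c)`_j = 0) -> (l <= m.+1)%N ->
    nm (E c) <= (2 * Ab + K0) * nm x ^+ l.
  move=> hl lm; have xl : nm x ^+ m.+1 <= nm x ^+ l by rewrite ler_wiXn2l.
  rewrite EE; apply: le_trans (nmD _ _) _.
  apply: le_trans (lerD (poly_low_bound x1 (sizeE c) hl (coefb c)) (tail c)) _.
  apply: le_trans (lerD (lexx _) (ler_wpM2l K00 xl)) _.
  rewrite -/Lr -mulrDl ler_wpM2r ?exprn_ge0 // /K0; lra.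
split=> [c|]; apply: fin => // j jm.
  by rewrite coefE ?(ltnW jm) // d0 // mxE.
by rewrite coefE //; move: jm; rewrite ltnS leq_eqVlt => /orP[/eqP -> //|jm]; rewrite d0 // mxE.
Qed.

End Residual.

Section Columns.
Variable R : realType.
Local Notation C := R[i].

(** At order m the defect is required to vanish on the diagonal only: there F_m cancels from the
    equation, so a formal solution truncated before order m satisfies it. The off-diagonal entries
    do involve F_m. *)
Record expansion n (W : normedModType C) (D : set C) (TW : set W) (m : nat) (Ab Fb : R)
    (lam : W -> 'rV[C]_n) (Ah : nat -> W -> 'M[C]_n) (S : C * W -> 'M[C]_n)
    (F : nat -> W -> 'M[C]_n) : Prop := Expansion {
  ex_Ad : forall k i j q, TW q -> differentiable (fun q => Ah k q i j) q;
  ex_A0 : forall q, TW q -> Ah 0%N q = diag_mx (lam q);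
  ex_Ab : forall k i j q, (k <= m.+1)%N -> TW q -> nm (Ah k q i j) <= Ab;
  ex_Sd : forall p i j, dom D TW p -> differentiable (fun p => S p i j) p;
  ex_S : forall p J i j, dom D TW p -> (J <= m.+1)%N ->
    nm (S p i j - \sum_(k < J) p.1^-1 ^+ k * Ah k p.2 i j) <= Ab * (nm p.1)^-1 ^+ J;
  ex_Fd : forall k i j q, TW q -> differentiable (fun q => F k q i j) q;
  ex_Fb : forall k i j q, TW q -> nm (F k q i j) <= Fb;
  ex_F0 : forall k q, TW q -> (m <= k)%N -> F k q = 0;
  ex_def : forall k q, TW q -> (k < m)%N ->
    fdef (Ah^~ q) (lam q) (diag_part (Ah 1%N q)) (F^~ q) k = 0;
  ex_defd : forall q a, TW q ->
    fdef (Ah^~ q) (lam q) (diag_part (Ah 1%N q)) (F^~ q) m a a = 0 }.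

(** The solution is the truncated column plus the correction from [ex_column], with rates kap_c =
    lam_c - lam_a. The exponent of column a contains the diagonal entry of the z^(-1) term, so the
    entry (a, a) of the correction matrix is O(z^(-2)), as [cd_Ra] demands. *)
Lemma ex_col (n m : nat) (del Ab Fb : R) : 0 < del -> 0 <= Ab -> 0 <= Fb -> (0 < m)%N ->
  exists M0 Cc : R, [/\ 1 <= M0, 0 <= Cc &
  forall (W : normedModType C) (D : set C) (TW : set W) (M : R) (a : 'I_n)
    (d : 'I_n -> C) (lam : W -> 'rV[C]_n) (Ah : nat -> W -> 'M[C]_n)
    (S : C * W -> 'M[C]_n) (F : nat -> W -> 'M[C]_n),
  M0 <= M -> open D -> open TW -> (forall z, D z -> M <= nm z) ->
  (forall z (s : R), D z -> 0 <= s -> D (z * (expR s)%:C)) ->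
  (forall c, c != a -> nm (d c) = 1) ->
  (forall c q, c != a -> TW q -> del <= complex.Re ((lam q 0 c - lam q 0 a) * d c)) ->
  (forall c z (s : R), c != a -> D z -> 0 <= s -> D (z + s%:C * d c)) ->
  expansion D TW m Ab Fb lam Ah S F ->
  exists f : 'I_n -> C * W -> C, 
   [/\ forall c p, dom D TW p -> differentiable (f c) p,
     forall c z q, D z -> TW q -> is_derive z (1 : C) (fun z => f c (z, q))
       (\sum_c' S (z, q) c c' * f c' (z, q) - (lam q 0 a + Ah 1%N q a a * z^-1) * f c (z, q))
   & forall c p, dom D TW p ->
       nm (f c p - \sum_(k < m) F k p.2 c a * p.1^-1 ^+ k) <= Cc * (nm p.1)^-1 ^+ m]].
Proof.
move=> del0 Ab0 Fb0 m0; have [K KA HK] := residual_bound n Ab0 Fb0 m0.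
have K0 : 0 <= K by apply: le_trans KA; rewrite mulr_ge0.
have [M0 [Cc [M01 Cc0 H]]] := ex_column n K0 del0 m0.
exists M0, Cc; split=> // W D TW M a d lam Ah S F MM oD oTW DM Drad d1 dd Dray ex.
have M1 : 1 <= M by apply: le_trans MM.
have z0 p : dom D TW p -> p.1 != 0.
  by move=> [/DM h _]; rewrite -nm_gt0; apply: lt_le_trans (le_trans M1 h).
have zV p : dom D TW p -> differentiable (fun p : C * W => p.1^-1) p.
  by move=> hp; exact: dif_comp1 (dif_fst p) (isd_V (z0 p hp)).
have dA k i j p : dom D TW p -> differentiable (fun p : C * W => Ah k p.2 i j) p.
  by move=> [_ p2]; exact: (dif_comp (dif_snd p) (ex_Ad ex k i j p2)).
have lamE c q : TW q -> lam q 0 c = Ah 0%N q c c.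
  by move=> tq; rewrite (ex_A0 ex tq) mxE eqxx mulr1n.
pose pp c (p : C * W) := \sum_(k < m) F k p.2 c a * p.1^-1 ^+ k.
pose Rm c c' (p : C * W) := S p c c' - (c == c')%:R * (Ah 0%N p.2 c c + Ah 1%N p.2 a a * p.1^-1).
pose E c (p : C * W) := \sum_c' S p c c' * pp c' p - pp c p * (Ah 0%N p.2 a a + Ah 1%N p.2 a a * p.1^-1) +
     \sum_(k < m) F k p.2 c a * (k%:R * p.1^-1 ^+ k.+1).
pose kap c q := Ah 0%N q c c - Ah 0%N q a a.
have zX k p : dom D TW p -> differentiable (fun p : C * W => p.1^-1 ^+ k) p.
  by move=> hp; exact: (dif_comp1 (zV p hp) (isdX _ k)).
have dF k i j p : dom D TW p -> differentiable (fun p : C * W => F k p.2 i j) p.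
  by move=> [_ p2]; exact: (dif_comp (dif_snd p) (ex_Fd ex k i j p2)).
have ppd c p : dom D TW p -> differentiable (pp c) p.
  by move=> hp; apply: dif_sum => k; apply: difM; [exact: dF|exact: zX].
have lbd b c p : dom D TW p -> differentiable (fun p : C * W => Ah 0%N p.2 c c + Ah 1%N p.2 b b * p.1^-1) p.
  move=> hp; apply: (difD _ _).1; first exact: dA.
  by apply: difM; [exact: dA|exact: zV].
have hx p : dom D TW p -> nm p.1^-1 <= 1.
  move=> hp; rewrite nmV invf_le1 ?nm_gt0 ?z0 //.
  by case: hp => /DM h _; exact: le_trans h.
have Rmb c c' p : dom D TW p -> nm (S p c c' - (c == c')%:R * Ah 0%N p.2 c c) <= Ab * (nm p.1)^-1.
  move=> hp; have := @ex_S _ _ _ _ _ _ _ _ _ _ _ ex p 1%N c c' hp isT.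
  rewrite big_ord_recl big_ord0 addr0 expr0 mul1r expr1.
  case: hp => _ tq; rewrite (ex_A0 ex tq) !mxE eqxx mulr1n.
  by have [->|cc] := eqVneq c c'; rewrite ?mulr1n ?mul1r // mulr0n mul0r.
have resid p : dom D TW p -> (forall c, nm (E c p) <= K * (nm p.1)^-1 ^+ m) /\
     nm (E a p) <= K * (nm p.1)^-1 ^+ m.+1.
  move=> hp; have [_ tq] := hp.
  have hS i j : nm (S p i j - \sum_(k < m.+1) p.1^-1 ^+ k * Ah k p.2 i j) <= Ab * nm p.1^-1 ^+ m.+1.
    by rewrite nmV; exact: (ex_S ex).
  have := HK (S p) (Ah^~ p.2) (F^~ p.2) (lam p.2) p.1^-1 a (hx p hp)
    (fun k i j hk => ex_Ab ex i j (leqW hk) tq) (fun k i j => ex_Fb ex k i j tq)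
    (fun k => ex_F0 ex tq) hS (ex_A0 ex tq) (fun k => ex_def ex tq) (ex_defd ex a tq).
  by rewrite nmV lamE.
have cd : column_data K del m D TW M a kap d Rm E.
  apply: (ColumnData oD oTW DM Drad d1 _ _ Dray).
  - move=> c q _ tq; apply: differentiableB; exact: (ex_Ad ex).
  - by move=> c q ca tq; rewrite /kap -!lamE //; exact: dd.
  - move=> c c' p hp; apply: differentiableB; first exact: (ex_Sd ex).
    by apply: difM; [exact: dif_cst|exact: lbd].
  - move=> c p hp; apply: (difD _ _).1; last first.
      apply: dif_sum => k; apply: difM; first exact: dF.
      by apply: difM; [exact: dif_cst|exact: zX].
    apply: differentiableB; last by apply: difM; [exact: ppd|exact: lbd].
    by apply: dif_sum => c'; apply: difM; [exact: (ex_Sd ex)|exact: ppd].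
  - move=> c c' p hp; have x0 : 0 <= (nm p.1)^-1 by rewrite invr_ge0 nm_ge0.
    apply: le_trans (ler_wpM2r x0 KA); rewrite /Rm mulrDr opprD addrA.
    rewrite -mulrA mulrDl mul1r; apply: le_trans (nmD _ _) _; rewrite nmN; apply: lerD; first exact: Rmb.
    case: hp => _ tq; rewrite !nmM nmV mulrA ler_wpM2r //.
    have := ex_Ab ex a a (isT : (1 <= m.+1)%N) tq.
    by case: eqP => _; rewrite ?nm1 ?mul1r // nm0 mul0r.
  - move=> p hp; have x0 : 0 <= (nm p.1)^-1 ^+ 2 by rewrite exprn_ge0 // invr_ge0 nm_ge0.
    have AK : Ab <= K by apply: le_trans KA; rewrite ler_peMl // ler1n.
    apply: le_trans (ler_wpM2r x0 AK).
    have := @ex_S _ _ _ _ _ _ _ _ _ _ _ ex p 2%N a a hp (m0 : (2 <= m.+1)%N).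
    rewrite !big_ord_recl big_ord0 addr0 expr0 mul1r /= /bump /= expr1 /Rm eqxx mul1r [p.1^-1 * _]mulrC.
    by [].
  - by move=> c p hp; case: (resid p hp) => h _; exact: h.
  - by move=> p hp; case: (resid p hp).
have [g [gd gb ge]] := H W D TW M a kap d Rm E MM cd.
exists (fun c p => pp c p + g c p); split.
- by move=> c p hp; apply: (difD _ _).1; [exact: ppd|exact: gd].
- move=> c z q Dz tq; have hp : dom D TW (z, q) by [].
  have zz : z != 0 := z0 _ hp.
  have i1 : is_derive z (1 : C) (fun z => pp c (z, q)) (- \sum_(k < m) F k q c a * (k%:R * z^-1 ^+ k.+1)).
    have h k := isdZ (F k q c a) (isd_comp (isd_V zz) (isdX z^-1 k)).
    have := isd_sum (index_enum 'I_m) h => /isd_eq; apply.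
    rewrite -sumrN; apply: eq_bigr => k _; case: (nat_of_ord k) => [|k'].
      by rewrite !mul0r !mulr0 oppr0.
    by rewrite /= -exprVn !exprS; ring.
  have := isdD i1 (dif_slice (gd c _ hp)) => /isd_eq; apply.
  apply: (etrans (congr2 +%R erefl (ge c _ hp))) => /=.
  rewrite (_ : \sum_c' S (z, q) c c' * (pp c' (z, q) + g c' (z, q)) =
     \sum_c' S (z, q) c c' * pp c' (z, q) + \sum_c' S (z, q) c c' * g c' (z, q)); last first.
    by rewrite -big_split /=; apply: eq_bigr => c' _; rewrite mulrDr.
  rewrite (_ : \sum_c' Rm c c' (z, q) * g c' (z, q) = \sum_c' S (z, q) c c' * g c' (z, q) -
     (Ah 0%N q c c + Ah 1%N q a a * z^-1) * g c (z, q)); last first.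
    rewrite [in RHS](bigD1 c) // [LHS](bigD1 c) //= {1}/Rm eqxx mul1r mulrBl /= addrAC; congr (_ - _).
    by congr (_ + _); apply: eq_bigr => c' /negbTE; rewrite eq_sym /Rm => ->; rewrite mul0r subr0.
  rewrite (_ : (if c == a then 0 else kap c q) = Ah 0%N q c c - Ah 0%N q a a); last first.
    by case: eqP => // ->; rewrite subrr.
  by rewrite /E /= lamE //; ring.
- by move=> c p hp; rewrite addrC addKr; exact: gb.
Qed.

End Columns.

Section LocalSolution.
Variable R : realType.
Local Notation C := R[i].

Definition strip (al be M : R) : set C :=
  [set w | al <= carg w <= be /\ M <= cmod w].

Lemma strip_cconvex (al be M : R) : 0 < M -> cconvex (strip al be M).
Proof.
move=> M0 a b [/andP[a1 a2] a3] [/andP[b1 b2] b3] s [r /andP[r0 r1] ->].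
have mono (f : C -> R) : (forall x y : C, f (x + y) = f x + f y) ->
    (forall (x : C), f (r%:C * x) = r * f x) -> f (a + r%:C * (b - a)) = (1 - r) * f a + r * f b.
  move=> fD fM; have f0 : f 0 = 0 by have := fD 0 0; rewrite addr0; lra.
  have fN x : f (- x) = - f x by have := fD x (- x); rewrite subrr f0; lra.
  by rewrite fD fM fD fN; ring.
have ReE := mono (@complex.Re R) (@Re_add R) (@Re_rM R r).
have ImE : carg (a + r%:C * (b - a)) = (1 - r) * carg a + r * carg b.
  apply: (mono (@complex.Im R)) => [[x1 x2] [y1 y2] //|[x1 x2]] /=.
  by rewrite mul0r addr0.
have r1' : 0 <= 1 - r by rewrite subr_ge0.
have cv (x y l : R) : l <= x -> l <= y -> l <= (1 - r) * x + r * y.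
  move=> lx ly; rewrite (_ : l = (1 - r) * l + r * l); last by ring.
  by apply: lerD; apply: ler_wpM2l.
have cv' (x y l : R) : x <= l -> y <= l -> (1 - r) * x + r * y <= l.
  move=> lx ly; rewrite (_ : l = (1 - r) * l + r * l); last by ring.
  by apply: lerD; apply: ler_wpM2l.
split; first by rewrite ImE cv // cv'.
have e (w : C) : (M <= cmod w) = (ln M <= complex.Re w).
  by rewrite /cmod -[X in X <= _](@lnK R) ?posrE // ler_expR.
by rewrite e ReE; apply: cv; rewrite -e.
Qed.

Section Local.
Variables (n : nat) (X : normedModType C) (TV : set X) (r1 ttau : R).
Variables (u : X -> 'rV[C]_n) (Ah : nat -> X -> 'M[C]_n) (S : C * X -> 'M[C]_n).
Hypothesis nf : normal_form TV r1 u Ah S.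
Variables Phi Psi : C * X -> 'M[C]_n.
Hypothesis dPsi : forall p i j, dom (hplane (ln r1)) TV p -> differentiable (fun p => Psi p i j) p.
Hypothesis PsiPhi : forall t w, TV t -> hplane (ln r1) w -> Psi (w, t) *m Phi (w, t) = 1%:M.
Hypothesis Psi_const : forall t (D : set C) (y : C -> 'M[C]_n), TV t -> cconvex D ->
  D `<=` hplane (ln r1) -> solves S t D y ->
  forall w w', D w -> D w' -> Psi (w, t) *m y w = Psi (w', t) *m y w'.

Let b t := diag_part (Ah 1%N t).

(* With [tau] the identity this gives solutions holomorphic in t, and with [tau]
   constant it gives asymptotics whose constants do not depend on t. *)
Lemma local_solution t1 (al be : R) (m : nat) (Fb : R) :
  TV t1 -> al <= ttau - pi -> ttau <= be ->
  (forall a c, a != c -> forall th, al + pi <= th <= be ->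
     complex.Re ((u t1 0 a - u t1 0 c) * cis th) != 0) ->
  (0 < m)%N -> 0 <= Fb ->
  exists rho M Cc : R, [/\ 0 < rho, forall q, nm (q - t1) < rho -> TV q
   & forall (W : normedModType C) (TW : set W) (tau : W -> X) (F : nat -> W -> 'M[C]_n),
     open TW -> (forall q, TW q -> differentiable tau q /\ nm (tau q - t1) < rho) ->
     (forall k i j q, TW q -> differentiable (fun q => F k q i j) q) ->
     (forall k i j q, TW q -> nm (F k q i j) <= Fb) ->
     (forall k q, TW q -> (m <= k)%N -> F k q = 0) ->
     (forall k q, TW q -> (k < m)%N ->
        fdef (Ah^~ (tau q)) (u (tau q)) (b (tau q)) (F^~ q) k = 0) ->
     (forall q a, TW q -> fdef (Ah^~ (tau q)) (u (tau q)) (b (tau q)) (F^~ q) m a a = 0) ->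
     exists C' : W -> 'M[C]_n, (forall q i j, TW q -> differentiable (fun q => C' q i j) q) /\
       forall q w c a, TW q -> al <= carg w <= be -> M <= cmod w ->
         nm (nrm (fun w => Phi (w, tau q)) (u (tau q)) (b (tau q)) (C' q) w c a -
             \sum_(k < m) F k q c a * (cexp w)^-1 ^+ k) <= Cc / cmod w ^+ m].
Proof.
move=> Tt1 al1 be1 sep m0 Fb0; have r10 := nf_r nf.
have al' : al + pi <= be by apply: le_trans be1; rewrite -lerBrDr.
have [d [del [del0 Hd HD]]] := sector_pkg al' sep.
have [Ab Ab0 HAb] := nf_S nf m.+1.
(* Each eigenvalue moves by at most del / 4, so a difference moves by at most del / 2 and the ray
   directions chosen at t1 keep decay rate del / 2. *)
have [rho rho0 [rhoT rhod]] : exists2 rho : R, 0 < rho & (forall q, nm (q - t1) < rho -> TV q) /\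
    forall q a, nm (q - t1) < rho -> nm (u q 0 a - u t1 0 a) <= del / 4.
  have [r2 r20 H2] := (openC_nm TV).1 (nf_TV nf) _ Tt1.
  have dA : differentiable (Ah 0%N) t1 by apply: dif_mx => i j; exact: (nf_Ad nf).
  have d4 : 0 < del / 4 by rewrite divr_gt0.
  have /cont_nmP/(_ _ d4) [r3 r30 H3] := differentiable_continuous dA.
  exists (Num.min r2 r3); first by rewrite lt_min r20 r30.
  have hT q : nm (q - t1) < Num.min r2 r3 -> TV q by rewrite lt_min => /andP[/H2].
  split=> // q a hq; have tq := hT q hq; move: hq; rewrite lt_min => /andP[_ /H3].
  apply: le_trans; rewrite (nf_A0 nf tq) (nf_A0 nf Tt1).
  by have := nm_entry (diag_mx (u q) - diag_mx (u t1)) a a; rewrite !mxE eqxx !mulr1n.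
have del2 : 0 < del / 2 by rewrite divr_gt0.
have [M0 [Cc [M01 Cc0 H]]] := ex_col n del2 Ab0 Fb0 m0.
pose M1 := Num.max M0 (r1 + 1).
have M01' : M0 <= M1 by rewrite le_max lexx.
have M11 : 1 <= M1 by apply: le_trans M01'.
have r1M : r1 < M1 by rewrite /M1 lt_max ltrDl ltr01 orbT.
have [D [M' [oD DM Drad Dray Dsec]]] := HD M1 M11.
pose M2 := Num.max M' M1.
have M20 : 0 < M2 by rewrite lt_max (lt_le_trans ltr01 M11) orbT.
exists rho, M2, Cc; split=> // W TW tau F oTW Htau Fd FB F0 Fdef Fdefd.
have tauT q : TW q -> TV (tau q) by move=> /Htau[_ /rhoT].
have zr p : dom D TW p -> r1 < nm p.1 by move=> [/DM h _]; exact: lt_le_trans h.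
have dtau p : dom D TW p -> differentiable (fun p : C * W => (p.1, tau p.2)) p.
  move=> [_ tq]; apply: differentiable_pair; first exact: dif_fst.
  exact: (dif_comp (dif_snd p) (Htau _ tq).1).
have ex : expansion D TW m Ab Fb (u \o tau) (fun k q => Ah k (tau q)) (fun p => S (p.1, tau p.2)) F.
  split=> [k i j q tq|q tq|k i j q km tq|p i j hp|p J i j hp Jm|||||q a tq] //.
  - exact: (dif_comp (Htau _ tq).1 (nf_Ad nf k i j (tauT _ tq))).
  - exact: (nf_A0 nf (tauT _ tq)).
  - by have [h _] := HAb _ (tauT _ tq); exact: h.
  - apply: (@dif_comp R _ _ _ (fun p : C * W => (p.1, tau p.2)) (fun p => S p i j) p (dtau p hp)).
    by case: hp (zr p hp) => _ tq hz; apply: (nf_Sd nf) => //=; exact: tauT.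
  - by case: hp (ltW (zr p hp)) => _ tq hz; have [_ h] := HAb _ (tauT _ tq); exact: h.
  - exact: Fdefd.
have col (a : 'I_n) : exists f : 'I_n -> C * W -> C,
   [/\ forall c p, dom D TW p -> differentiable (f c) p,
     forall c z q, D z -> TW q -> is_derive z (1 : C) (fun z => f c (z, q))
       (\sum_c' S (z, tau q) c c' * f c' (z, q) - (u (tau q) 0 a + Ah 1%N (tau q) a a * z^-1) * f c (z, q))
   & forall c p, dom D TW p ->
       nm (f c p - \sum_(k < m) F k p.2 c a * p.1^-1 ^+ k) <= Cc * (nm p.1)^-1 ^+ m].
  apply: (H W D TW M1 a (d a) (u \o tau) (fun k q => Ah k (tau q)) (fun p => S (p.1, tau p.2)) F) => //.
  - by move=> c ca; case: (Hd a c ca).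
  - move=> c q ca tq /=; have [d1 d2] := Hd a c ca; have [_ hq] := Htau _ tq.
    have h1 := rhod _ c hq; have h2 := rhod _ a hq.
    set x := u (tau q) 0 c in h1 *; set y := u (tau q) 0 a in h2 *.
    have e : (x - y) * d a c = (u t1 0 c - u t1 0 a) * d a c + ((x - u t1 0 c) - (y - u t1 0 a)) * d a c by ring.
    rewrite e Re_add; have := Re_le_nm (((x - u t1 0 c) - (y - u t1 0 a)) * d a c).
    rewrite nmM d1 mulr1 ler_norml => /andP[h3 _].
    have := nmD (x - u t1 0 c) (- (y - u t1 0 a)); rewrite nmN => h4.
    by move: d2 h1 h2 h3 h4; lra.
  - by move=> c z s ca; exact: Dray.
have [f Hf] := choice col.
(* The factor z^(b_a) e^(u_a z), which turns the normalized column back into a solution; it is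
   single-valued in w = log z only. *)
pose ex1 q w a := cexp (cexp w * u (tau q) 0 a + w * Ah 1%N (tau q) a a).
pose Yl q w : 'M[C]_n := \matrix_(c, a) (f a c (cexp w, q) * ex1 q w a).
have Dstr w : strip al be M2 w -> D (cexp w) /\ hplane (ln r1) w.
  move=> [/andP[w1 w2]]; rewrite ge_max => /andP[w3 w4]; split.
    by apply: Dsec w3; rewrite addrK w1.
  by rewrite /hplane /= -ltr_expR lnK ?posrE //; exact: lt_le_trans w4.
have Ysol q : TW q -> solves S (tau q) (strip al be M2) (Yl q).
  move=> tq w c a hw; have [Dw _] := Dstr w hw; have [_ f2 _] := Hf a.
  under eq_fun do rewrite mxE.
  have h1 := isd_comp (isd_cexp w) (f2 c _ _ Dw tq).
  have h2 := isdD (isdM (isd_cexp w) (isd_cst (u (tau q) 0 a) w)) (isdM (isd_id w) (isd_cst (Ah 1%N (tau q) a a) w)).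
  have := isdM h1 (isd_comp h2 (isd_cexp _)) => /isd_eq; apply.
  rewrite mxE [in RHS](eq_bigr (fun c' => S (cexp w, tau q) c c' * f a c' (cexp w, q) * ex1 q w a)); last first.
    by move=> c' _; rewrite mxE mulrA.
  rewrite -big_distrl /= -/(ex1 q w a).
  set s := \sum_c' _; set x := cexp w; have x0 : x != 0 := cexp_neq0 w.
  by field.
pose w2 : C := ln M2 +i* ttau.
have hw2 : strip al be M2 w2.
  split; last by rewrite /cmod /= lnK ?posrE.
  rewrite /carg /= be1 andbT; apply: le_trans al1 _.
  by rewrite gerBl pi_ge0.
have [Dw2 hpw2] := Dstr _ hw2.
(* The connection matrix does not depend on the point of the strip, so it may be evaluated at the
   fixed [w2], where it is visibly holomorphic in q. *)
exists (fun q => Psi (w2, tau q) *m Yl q w2); split=> [q i j tq|q w c a tq hw Mw].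
  have [dt _] := Htau _ tq.
  under eq_fun do rewrite mxE; apply: dif_sum => l; apply: difM.
    apply: (@dif_comp R _ _ _ (fun q => (w2, tau q)) (fun p => Psi p i l)).
      by apply: differentiable_pair; [exact: dif_cst|].
    by apply: dPsi; split=> //=; exact: tauT.
  under eq_fun do rewrite mxE; apply: difM.
    have [f1 _ _] := Hf j; apply: (@dif_comp R _ _ _ (fun q => (cexp w2, q)) (f j l)).
      by apply: differentiable_pair; [exact: dif_cst|exact: dif_id].
    by apply: f1.
  apply: dif_comp1 (isd_cexp _); apply: (difD _ _).1; apply: difM; try exact: dif_cst.
    (* Holomorphy of the eigenvalues is read off the diagonal of the leading coefficient. *)
    apply: (dif_congr _ (dif_comp dt (nf_Ad nf 0 j j (tauT _ tq)))).
    have [e0 e00 He] := (openC_nm TW).1 oTW _ tq; exists e0; first exact: e00.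
    by move=> y /He ty; rewrite (nf_A0 nf (tauT _ ty)) mxE eqxx mulr1n.
  exact: (dif_comp dt (nf_Ad nf 1 j j (tauT _ tq))).
have sw : strip al be M2 w by [].
have [Dw hpw] := Dstr _ sw.
have PP : Phi (w, tau q) *m (Psi (w2, tau q) *m Yl q w2) = Yl q w.
  rewrite (Psi_const (tauT _ tq) (strip_cconvex M20) _ (Ysol q tq) hw2 sw); last by move=> w' /Dstr[].
  by rewrite mulmxA (mulmx1C (PsiPhi (tauT _ tq) hpw)) mul1mx.
rewrite nrmE PP mxE /ex1 -cexpD -mulrA -cexpD /b [(diag_part _) 0 a]mxE.
rewrite (_ : _ + _ + (_ + _) = 0); last by ring.
rewrite cexp0 mulr1; have [_ _ f3] := Hf a.
have := f3 c (cexp w, q) (conj Dw tq); rewrite /= nm_cexp -/(cmod w).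
by rewrite exprVn.
Qed.

End Local.
End LocalSolution.

(** * Formal coefficients and Stokes directions *)

Section MatrixDerive.
Variable R : realType.
Local Notation C := R[i].

Lemma isd_mx_entry m n (M : C -> 'M[C]_(m, n)) (w : C) D i j :
  is_derive w (1 : C) M D -> is_derive w (1 : C) (fun w => M w i j) (D i j).
Proof.
move=> hM; have dM : differentiable M w by apply/derivable1_diffP; apply: ex_derive.
have e1 : 'd M w 1 = D by rewrite -deriveE //; exact: derive_val.
have eh h : 'd M w h = h *: D.
  by rewrite -e1 -linearZ; congr ('d M w _); rewrite /GRing.scale /= mulr1.
apply: isd_of_eps => e e0; have [d d0 H] := dif_eps dM e0; exists d => // h hd.
apply: le_trans (H h hd); have := nm_entry (M (w + h) - M w - 'd M w h) i j.
by rewrite eh !mxE [D i j * h]mulrC.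
Qed.

Lemma isd_mx m n (M : C -> 'M[C]_(m, n)) (w : C) (D : 'M[C]_(m, n)) :
  (forall i j, is_derive w (1 : C) (fun w => M w i j) (D i j)) ->
  is_derive w (1 : C) M D.
Proof.
move=> hM; pose L (h : C) := h *: D.
have lin : linear L by move=> a u v; rewrite /L scalerDl scalerA.
have bd h : nm (L h) <= nm D * nm h by rewrite nmZ mulrC.
have [|dM e] := @dif_of_eps R C _ M L (nm D) w lin bd.
  move=> e e0.
  have [||d d0 H] := @fin_inf R ('I_m * 'I_n)%type (fun ij d => forall h, nm h < d ->
    nm (M (w + h) ij.1 ij.2 - M w ij.1 ij.2 - D ij.1 ij.2 * h) <= e * nm h).
  - by move=> ij x y Hx _ yx h hy; apply: Hx; exact: lt_le_trans yx.
  - by move=> ij; have [d d0 H] := isd_eps (hM ij.1 ij.2) e0; exists d.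
  exists d => // h hd; apply: nm_mx_le => [|i j]; first by rewrite mulr_ge0 ?nm_ge0 ?ltW.
  by have := H (i, j) h hd; rewrite /= !mxE [D i j * h]mulrC.
split; first exact: diff_derivable.
by rewrite deriveE //; apply: etrans (congr1 (fun f => f 1) e) _; rewrite /L scale1r.
Qed.

End MatrixDerive.

Lemma nm_nat (R : realType) k : nm (k%:R : R[i]) = k%:R.
Proof. by have := nmC (k%:R : R); rewrite rmorph_nat => ->; rewrite ger0_norm. Qed.

Section Coefficients.
Variables (R : realType) (n : nat).
Local Notation C := R[i].
Implicit Types (Ah F : nat -> 'M[C]_n) (lam b : 'rV[C]_n).

Lemma fs_mul_le Ah F F' k : (forall j, (j <= k)%N -> F j = F' j) ->
  fs_mul Ah F k = fs_mul Ah F' k.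
Proof. by move=> h; apply: eq_bigr => j _; rewrite h // leq_subr. Qed.

Lemma fs_mul_head Ah F lam k c a : Ah 0%N = diag_mx lam ->
  fs_mul Ah F k c a = lam 0 c * F k c a + (\sum_(j < k.+1 | (1 <= j)%N) Ah j *m F (k - j)%N) c a.
Proof.
move=> A0; rewrite /fs_mul (bigD1 ord0) //= subn0 mxE A0 mul_diag_mx mxE; congr (_ + _).
by congr (fun_of_matrix _ c a); apply: eq_bigl => -[[]].
Qed.

Lemma fdefE Ah lam b F k c a : Ah 0%N = diag_mx lam -> fdef Ah lam b F k c a =
  lam 0 c * F k c a + (\sum_(j < k.+1 | (1 <= j)%N) Ah j *m F (k - j)%N) c a -
  (F k c a * lam 0 a + (if k is k'.+1 then F k' c a * b 0 a else 0)) - fs_deriv F k c a.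
Proof. by move=> A0; rewrite -fs_mul_head // -fs_mul_exponent !mxE. Qed.

(** Below order m the defect only sees retained coefficients. At order m the term F_m enters a
    diagonal entry as lam_a F_m - F_m lam_a = 0. *)
Lemma fdef_trunc Ah lam b F m : Ah 0%N = diag_mx lam ->
  (forall k, fdef Ah lam b F k = 0) ->
  let F' k := if (k < m)%N then F k else 0 in
  (forall k, (k < m)%N -> fdef Ah lam b F' k = 0) /\ forall a, fdef Ah lam b F' m a a = 0.
Proof.
move=> A0 H F'; have FF j k : (k < m)%N -> (j <= k)%N -> F' j = F j.
  by move=> km jk; rewrite /F' (leq_ltn_trans jk km).
have fd k : (k <= m)%N -> fs_deriv F' k = fs_deriv F k.
  by case: k => //= k km; rewrite /F' km.
split=> [k km|a].
  rewrite -[RHS](H k) /fdef fd ?(ltnW km) //; congr (_ - _ - _).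
    by apply: fs_mul_le => j jk; exact: FF jk.
  by apply: eq_bigr => -[j /= jk] _; rewrite (FF j k km jk).
have := H m => /matrixP /(_ a a); rewrite !fdefE // fd // mxE.
rewrite (eq_bigr (fun j : 'I_m.+1 => Ah j *m F' (m - j)%N)); last first.
  move=> j j1; rewrite /F' (_ : (m - j < m)%N) //.
  by rewrite ltn_subrL j1 (leq_trans j1) // -ltnS ltn_ord.
rewrite (_ : (if m is k'.+1 then F k' a a * b 0 a else 0) = (if m is k'.+1 then F' k' a a * b 0 a else 0)); last first.
  by case: (m) FF => // m' FF; rewrite (FF m' m').
have gen (l f f' p q d : C) : l * f + p - (f * l + q) - d = l * f' + p - (f' * l + q) - d by ring.
by move=> h; apply: etrans h; exact: gen.
Qed.

Lemma nm_fs_tail Ah F (Ab Fb : R) (k l : nat) c a : 0 <= Ab -> 0 <= Fb -> (l <= k)%N ->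
  (forall j i i', (j <= k)%N -> nm (Ah j i i') <= Ab) ->
  (forall j i i', (j <= k - l)%N -> nm (F j i i') <= Fb) ->
  nm ((\sum_(j < k.+1 | (l <= j)%N) Ah j *m F (k - j)%N) c a) <= k.+1%:R * (n%:R * (Ab * Fb)).
Proof.
move=> Ab0 Fb0 lk hA hF; rewrite summxE; apply: le_trans (nm_sum _ _ _) _.
apply: le_trans (_ : \sum_(j < k.+1) n%:R * (Ab * Fb) <= _); last first.
  by rewrite sumr_const card_ord -[_ *+ k.+1]mulr_natl.
rewrite big_mkcond /=; apply: ler_sum => -[j jk] _ /=; case: ifP => lj; last by rewrite !mulr_ge0.
apply: nm_mulmx => i; first exact: hA.
by apply: hF; exact: leq_sub2l.
Qed.

(* The off-diagonal entries of F_k are read off the coefficient of z^(-k), the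
   diagonal ones off the coefficient of z^(-k-1). *)
Lemma coeff_bound (eta Ab : R) (m : nat) : 0 < eta -> 0 <= Ab ->
  exists2 Fb : R, 1 <= Fb & forall Ah F lam,
    (forall a c, a != c -> eta <= nm (lam 0 a - lam 0 c)) ->
    (forall k i j, (k <= m.+1)%N -> nm (Ah k i j) <= Ab) -> Ah 0%N = diag_mx lam ->
    F 0%N = 1%:M -> (forall k, fdef Ah lam (diag_part (Ah 1%N)) F k = 0) ->
    forall k i j, (k <= m)%N -> nm (F k i j) <= Fb.
Proof.
move=> eta0 Ab0; elim: m => [|m [Fb Fb1 IH]].
  exists 1 => // Ah F lam _ _ _ F0 _ k i j; rewrite leqn0 => /eqP ->.
  by rewrite F0 mxE; case: eqP => _; rewrite ?nm1 ?nm0.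
have Fb0 : 0 <= Fb by apply: le_trans Fb1.
pose q := m.+3%:R * (n%:R * (Ab * Fb)).
have q0 : 0 <= q by rewrite /q !mulr_ge0.
pose G := (Fb * Ab + m%:R * Fb + q) / eta.
have G0 : 0 <= G by rewrite /G !mulr_ge0 ?addr_ge0 ?mulr_ge0 // ltW // invr_gt0.
pose G' := n%:R * (Ab * G) + q.
have G'0 : 0 <= G' := addr_ge0 (mulr_ge0 (ler0n _ _) (mulr_ge0 Ab0 G0)) q0.
exists (Fb + G + G'); first by rewrite -addrA ler_wpDr // addr_ge0.
move=> Ah F lam hl hA A0 F0 H k i j; rewrite leq_eqVlt => /orP[/eqP ->|]; last first.
  rewrite ltnS => km; apply: le_trans (_ : Fb <= _); last by rewrite -addrA lerDl addr_ge0.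
  by apply: (IH Ah F lam) => // k' i' j' k'm; apply: hA; exact: leqW.
have FB k' i' j' : (k' <= m)%N -> nm (F k' i' j') <= Fb.
  by move=> k'm; apply: (IH Ah F lam) => // k'' i'' j'' k'm'; apply: hA; exact: leqW.
have split1 k' : (0 < k')%N -> \sum_(j < k'.+1 | (1 <= j)%N) Ah j *m F (k' - j)%N =
    Ah 1%N *m F k'.-1 + \sum_(j < k'.+1 | (2 <= j)%N) Ah j *m F (k' - j)%N.
  case: k' => // k' _; rewrite (bigD1 (Ordinal (isT : (1 < k'.+2)%N))) //= subSS subn0.
  by congr (_ + _); apply: eq_bigl => -[[|[|]]].
have off c a : c != a -> nm (F m.+1 c a) <= G.
  move=> ca; have := H m.+1 => /matrixP /(_ c a).
  rewrite fdefE // !mxE.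
  set T := \sum_(j < _ | _) _; move=> h.
  have hT : nm (T c a) <= q.
    apply: le_trans (nm_fs_tail c a (k := m.+1) (l := 1) (Ah := Ah) (F := F) Ab0 Fb0 isT _ _) _.
    - by move=> j' i' i'' j'm; apply: hA; exact: leqW.
    - by move=> j' i' i''; rewrite subSS subn0; exact: FB.
    - by rewrite /q ler_wpM2r ?mulr_ge0 // ler_nat.
  have E : (lam 0 c - lam 0 a) * F m.+1 c a = F m c a * Ah 1%N a a - m%:R * F m c a - T c a.
    by apply/eqP; rewrite -subr_eq0; apply/eqP; rewrite -[RHS]h; ring.
  rewrite /G ler_pdivlMr // mulrC.
  apply: le_trans (ler_wpM2r (nm_ge0 _) (hl c a ca)) _.
  rewrite -nmM E; apply: le_trans (nmD _ _) _; rewrite nmN; apply: lerD hT.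
  apply: le_trans (nmD _ _) _; rewrite nmN; apply: lerD.
    by rewrite nmM ler_pM ?nm_ge0 ?FB // hA.
  rewrite nmM nm_nat.
  by rewrite ler_wpM2l // FB.
have dia a : nm (F m.+1 a a) <= G'.
  have := H m.+2 => /matrixP /(_ a a).
  rewrite fdefE // split1 //; set T := \sum_(j < _ | _) _; rewrite !mxE.
  rewrite (bigD1 a) //=; set s := \sum_(l | l != a) _; move=> h.
  have hT : nm (T a a) <= q.
    apply: le_trans (nm_fs_tail a a (k := m.+2) (l := 2) (Ah := Ah) (F := F) Ab0 Fb0 isT _ _) _ => //.
    by move=> j' i' i''; rewrite !subSS subn0; exact: FB.
  have hs : nm s <= n%:R * (Ab * G).
    apply: le_trans (nm_sum _ _ _) _; rewrite big_mkcond /=.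
    apply: le_trans (_ : \sum_(l < n) Ab * G <= _); last first.
      by rewrite sumr_const card_ord -[_ *+ n]mulr_natl.
    apply: ler_sum => l _; case: ifP => la; last by rewrite mulr_ge0.
    by rewrite nmM ler_pM ?nm_ge0 ?off // hA.
  have E : m.+1%:R * F m.+1 a a = - s - T a a.
    by apply/eqP; rewrite -subr_eq0; apply/eqP; rewrite -[RHS]h; ring.
  apply: le_trans (_ : nm (m.+1%:R * F m.+1 a a) <= _).
    rewrite nmM nm_nat.
    by rewrite ler_peMl ?nm_ge0 // ler1n.
  by rewrite E; apply: le_trans (nmD _ _) _; rewrite !nmN; exact: lerD.
have [->|ij] := eqVneq i j; first by apply: le_trans (dia j) _; rewrite lerDr addr_ge0.
by apply: le_trans (off i j ij) _; rewrite -addrA addrCA lerDl addr_ge0.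
Qed.

End Coefficients.

Section Stokes.
Variable R : realType.
Local Notation C := R[i].

Lemma cis_pihalf : cis (pi / 2 : R) = 0 +i* 1.
Proof. by rewrite cisE cos_pihalf sin_pihalf. Qed.

Lemma stokes_dir_Re n (lam : 'rV[C]_n) a c (th : R) : lam 0 a != lam 0 c ->
  complex.Re ((lam 0 a - lam 0 c) * cis th) = 0 ->
  stokes_dir lam th /\ stokes_dir lam (th - pi).
Proof.
move=> ac h; have gen th' : complex.Re ((lam 0 a - lam 0 c) * cis th') = 0 -> stokes_dir lam th'.
  move=> h'; exists a, c; split=> // w hw; rewrite cexp_polar hw mulrCA Re_rM.
  by apply/eqP; rewrite mulf_eq0; apply/orP; right; apply/eqP.
split; apply: gen => //; apply/eqP; rewrite -oppr_eq0 -Re_cis_pi subrK.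
exact/eqP.
Qed.

(** If the real part vanished, (u_a - u_c) e^(i ttau) would be a nonzero imaginary number: on the
    negative half-axis k = 0 shows that t lies in [crossing], on the positive one k = -1. *)
Lemma crossing_sep n (eps0 : R) (u : 'rV[C]_n -> 'rV[C]_n) (ttau : R) t :
  polydisc 0 eps0 t -> ~ coalescence eps0 u t -> ~ crossing eps0 u ttau t ->
  forall a c, a != c -> complex.Re ((u t 0 a - u t 0 c) * cis ttau) != 0.
Proof.
move=> Pt nco ncr a c ac; apply/eqP => h.
have uac : u t 0 a != u t 0 c by apply/eqP => e; apply: nco; split=> //; exists a, c.
apply: ncr; split=> //; exists a, c; split=> //.
set x := u t 0 a - u t 0 c in h *.
have x0 : x != 0 by rewrite subr_eq0.
have c0 : cis ttau != 0 := cexp_neq0 _.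
pose y := complex.Im (x * cis ttau).
have xy : x * cis ttau = y%:C * (0 +i* 1).
  by rewrite /y; move: h; case: (x * cis ttau) => p q /= ->; apply/eqP; rewrite eq_complex /=; apply/andP; split; apply/eqP; ring.
have y0 : y != 0.
  apply/eqP => y0; have : x * cis ttau != 0 by rewrite mulf_neq0.
  by rewrite xy y0 mul0r eqxx.
have wE (r th : R) : 0 < r -> cexp (ln r +i* th) * cis ttau = r%:C * cis (th + ttau).
  by move=> r0; rewrite cexp_polar /cmod /carg /= lnK ?posrE // cisD mulrA.
move: y0; rewrite neq_lt => /orP[] y0.
  exists 0; exists (ln (- y) +i* (3 * pi / 2 - ttau + 0%:~R * pi)) => //.
  apply: (mulIf c0); rewrite xy wE ?oppr_gt0 //.
  rewrite (_ : _ + ttau = pi / 2 + pi); last by rewrite mulr0z; field.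
  rewrite cisE cosDpi sinDpi cos_pihalf sin_pihalf.
  by apply/eqP; rewrite eq_complex /=; apply/andP; split; apply/eqP; ring.
exists (- 1); exists (ln y +i* (3 * pi / 2 - ttau + (- 1)%:~R * pi)) => //.
apply: (mulIf c0); rewrite xy wE //.
rewrite (_ : _ + ttau = pi / 2); last by rewrite mulrN1z; field.
by rewrite cis_pihalf.
Qed.

(* A Stokes direction in [min al (ttau - pi) + pi, max be ttau], or its opposite,
   would separate the strip [al, be] from the sector. *)
Lemma sector_sep n (lam : 'rV[C]_n -> 'rV[C]_n) (ttau al be : R) t : al <= be ->
  [set w : C | al <= carg w <= be] `<=` stokes_sector lam ttau t ->
  (forall a c, a != c -> complex.Re ((lam t 0 a - lam t 0 c) * cis ttau) != 0) ->
  forall a c, a != c -> forall th, Num.min al (ttau - pi) + pi <= th <= Num.max be ttau ->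
    complex.Re ((lam t 0 a - lam t 0 c) * cis th) != 0.
Proof.
move=> ab sub sep a c ac th /andP[th1 th2]; apply/eqP => h.
have lac : lam t 0 a != lam t 0 c.
  by apply/eqP => e; have := sep a c ac; rewrite e subrr mul0r eqxx.
have [s1 s2] := stokes_dir_Re lac h.
have [tt|tt|tt] := ltgtP th ttau; last by have := sep a c ac; rewrite -tt h eqxx.
  have ha : al <= carg (0 +i* al) <= be by rewrite /carg /= lexx.
  have [_ h2] := sub _ ha; have t2 : th - pi < ttau - pi by rewrite ltrD2r.
  have := h2 _ s2 t2; rewrite /carg /= => h3.
  by move: th1; rewrite -lerBrDr ge_min !leNgt h3 t2.
have hb : al <= carg (0 +i* be) <= be by rewrite /carg /= ab lexx.
have [h2 _] := sub _ hb; have := h2 _ s1 tt; rewrite /carg /= => h3.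
by move: th2; rewrite le_max !leNgt h3 tt.
Qed.

End Stokes.

(** * The connection matrix *)

Section Connection.
Variables (R : realType) (n : nat).
Local Notation C := R[i].
Local Notation X := 'rV[C]_n.
Variables (TV : set X) (r1 ttau : R) (c0 : X).
Variables (Ah : nat -> X -> 'M[C]_n) (S : C * X -> 'M[C]_n).
Local Notation uu := (fun t : X => c0 + t).
Hypothesis nf : normal_form TV r1 uu Ah S.
Variables Phi Psi : C * X -> 'M[C]_n.
Hypothesis dPsi : forall p i j, dom (hplane (ln r1)) TV p -> differentiable (fun p => Psi p i j) p.
Hypothesis PsiPhi : forall t w, TV t -> hplane (ln r1) w -> Psi (w, t) *m Phi (w, t) = 1%:M.
Hypothesis Psi_const : forall t (D : set C) (y : C -> 'M[C]_n), TV t -> cconvex D ->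
  D `<=` hplane (ln r1) -> solves S t D y ->
  forall w w', D w -> D w' -> Psi (w, t) *m y w = Psi (w', t) *m y w'.

(** An open set, unlike the cells, that contains all of them; the connection matrix is constructed
    and shown to be holomorphic here. The condition at ttau also covers ttau - pi and forces the
    eigenvalues to be distinct. *)
Definition sepset : set X := [set t | TV t /\ forall a c, a != c ->
  complex.Re (((c0 + t) 0 a - (c0 + t) 0 c) * cis ttau) != 0].

Definition connects t (Cm : 'M[C]_n) : Prop :=
  good (fun w => Phi (w, t)) (c0 + t) (diag_part (Ah 1%N t)) ttau Cm.

Lemma eig_dist t t1 a c : nm (((c0 + t) 0 a - (c0 + t) 0 c) - ((c0 + t1) 0 a - (c0 + t1) 0 c)) <=
  2 * nm (t - t1).
Proof.
rewrite (_ : _ - _ = (t - t1) 0 a - (t - t1) 0 c); last by rewrite !mxE; ring.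
apply: le_trans (nmD _ _) _; rewrite nmN mulrDl mul1r.
by apply: lerD; exact: nm_entry.
Qed.

Lemma open_sepset : open sepset.
Proof.
apply/openC_nm => t1 [Tt1 h1].
have [r2 r20 H2] := (openC_nm TV).1 (nf_TV nf) _ Tt1.
have [||r3 r30 H3] := @fin_inf R ('I_n * 'I_n)%type (fun ac r => ac.1 != ac.2 ->
   2 * r <= `|complex.Re (((c0 + t1) 0 ac.1 - (c0 + t1) 0 ac.2) * cis ttau)|).
- by move=> ac x y hx _ yx /hx; apply: le_trans; rewrite ler_wpM2l.
- move=> [a c] /=; have [->|ac] := eqVneq a c; first by exists 1.
  exists (`|complex.Re (((c0 + t1) 0 a - (c0 + t1) 0 c) * cis ttau)| / 2).
    by rewrite divr_gt0 // normr_gt0 h1.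
  by move=> _; rewrite mulrC divfK.
exists (Num.min r2 r3); first by rewrite lt_min r20 r30.
move=> t; rewrite lt_min => /andP[t2 t3]; split; first exact: H2.
move=> a c ac; apply/eqP => h.
have := Re_le_nm ((((c0 + t1) 0 a - (c0 + t1) 0 c) - ((c0 + t) 0 a - (c0 + t) 0 c)) * cis ttau).
rewrite mulrBl Re_add Re_opp h subr0 -mulrBl nmM nm_cis mulr1.
have := eig_dist t t1 a c; rewrite nmB; have := H3 (a, c) ac => /= h3 h4 h5.
have := le_trans (le_trans h3 h5) h4; rewrite ler_pM2l // leNgt.
by rewrite t3.
Qed.

Lemma connects_unique t C1 C2 : sepset t -> connects t C1 -> connects t C2 -> C1 = C2.
Proof. by move=> [_ h]; exact: good_unique. Qed.

(** [Cf] is chosen pointwise without regard to t; uniqueness identifies it near each point with a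
    holomorphic local matrix. *)
Lemma ex_connection : exists Cf : X -> 'M[C]_n, forall t, sepset t ->
  connects t (Cf t) /\ forall i j, differentiable (fun t => Cf t i j) t.
Proof.
have loc t1 : sepset t1 -> exists2 rho : R, 0 < rho & exists C' : X -> 'M[C]_n,
    forall t, nm (t - t1) < rho -> connects t (C' t) /\ forall i j, differentiable (fun t => C' t i j) t.
  move=> [Tt1 h1]; have sep a c : a != c -> forall th, ttau - pi + pi <= th <= ttau ->
      complex.Re (((c0 + t1) 0 a - (c0 + t1) 0 c) * cis th) != 0.
    by move=> ac th; rewrite subrK => /le_anti <-; exact: h1.
  have [rho [M [Cc [rho0 rhoT H]]]] := local_solution nf dPsi PsiPhi Psi_const Tt1
    (lexx _) (lexx _) sep (isT : (0 < 1)%N) (ler01 : 0 <= (1 : R)).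
  exists rho => //; pose TW : set X := [set t | nm (t - t1) < rho].
  (* The truncation at order 1 is the identity matrix, trivially holomorphic in t; its defect of
     order 1 vanishes on the diagonal because b is the diagonal part of the z^(-1) term. *)
  pose F k (q : X) : 'M[C]_n := if k is 0%N then 1%:M else 0.
  have [|||||||C' [dC' HC']] := H X TW id F.
  - apply/openC_nm => x hx; exists (rho - nm (x - t1)); first by rewrite subr_gt0.
    move=> y hy; apply: le_lt_trans (nm_tri y x t1) _.
    by move: hy; rewrite ltrBrDr.
  - by move=> q hq; split=> //; exact: dif_id.
  - by move=> k i j q _; exact: dif_cst.
  - move=> [|k] i j q _; rewrite /F mxE ?nm0 //.
    by case: eqP; rewrite ?nm1 ?nm0.
  - by case=> [|k] q.
  - move=> [|//] q tq _; apply/matrixP => c a.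
    rewrite fdefE; last exact: (nf_A0 nf (rhoT _ tq)).
    rewrite big_mkcond big_ord1 /= !mxE addr0 subr0 addr0.
    by have [->|_] := eqVneq c a; rewrite ?mulr1n ?mulr0n ?mulr0 ?mul0r ?mulr1 ?mul1r subrr.
  - move=> q a tq; rewrite fdefE; last exact: (nf_A0 nf (rhoT _ tq)).
    rewrite (bigD1 (ord_max : 'I_2)) //= big1; last by move=> [[|[|]] ].
    rewrite addr0 mulmx1 /F !mxE eqxx mulr1n; ring.
  exists C' => t ht; split; last by move=> i j; exact: dC'.
  exists Cc, M => w hw Mw i j; have hw' : ttau - pi <= carg w <= ttau.
    have pp := pi_ge0 R.
    by case: hw => ->; rewrite ?lexx ?andbT ?andTb gerBl.
  have := HC' t w i j ht hw' Mw.
  have e : F 0%N t i j = (i == j)%:R by rewrite mxE.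
  by rewrite big_ord1 /= expr0 mulr1 expr1 e.
have exC t : exists Cm, sepset t -> connects t Cm.
  have [Ot|nO] := pselect (sepset t); last by exists 0.
  have [rho rho0 [C' HC']] := loc _ Ot; exists (C' t) => _.
  by have [|h _] := HC' t; first by rewrite subrr nm0.
have [Cf HCf] := choice exC.
exists Cf => t1 Ot1; split; first exact: HCf.
move=> i j; have [rho rho0 [C' HC']] := loc _ Ot1.
have [r2 r20 H2] := (openC_nm sepset).1 open_sepset _ Ot1.
have [|_ dC] := HC' t1; first by rewrite subrr nm0.
apply: (dif_congr _ (dC i j)); exists (Num.min rho r2); first by rewrite lt_min rho0.
move=> y; rewrite lt_min => /andP[y1 /H2 Oy].
by rewrite (connects_unique Oy (HC' y y1).1 (HCf y Oy)).
Qed.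

Section Asymptotics.
Variables (t1 : X) (al be : R).
Hypothesis (O1 : sepset t1).
Hypothesis sep : forall a c, a != c -> forall th,
  Num.min al (ttau - pi) + pi <= th <= Num.max be ttau ->
  complex.Re (((c0 + t1) 0 a - (c0 + t1) 0 c) * cis th) != 0.

Definition formal_at t (F : nat -> 'M[C]_n) : Prop :=
  F 0%N = 1%:M /\ forall k, fdef (Ah^~ t) (c0 + t) (diag_part (Ah 1%N t)) F k = 0.

(** [local_solution] is applied with [tau] constant equal to t, so no regularity of F in t enters
    and the constants depend on t1 only. The solution obtained connects t, hence by uniqueness it is
    the given one. *)
Let asym_pos m : (0 < m)%N -> exists rho M Cc : R, 0 < rho /\
  forall t F Cm, nm (t - t1) < rho -> sepset t -> formal_at t F -> connects t Cm ->
  forall w c a, al <= carg w <= be -> M <= cmod w ->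
  nm (nrm (fun w => Phi (w, t)) (c0 + t) (diag_part (Ah 1%N t)) Cm w c a -
      \sum_(k < m) F k c a * (cexp w)^-1 ^+ k) <= Cc / cmod w ^+ m.
Proof.
move=> m0; have [Tt1 h1] := O1.
have [||eta eta0 Heta] := @fin_inf R ('I_n * 'I_n)%type (fun ac r => ac.1 != ac.2 ->
   r <= nm ((c0 + t1) 0 ac.1 - (c0 + t1) 0 ac.2)).
- by move=> ac x y hx _ yx /hx; exact: le_trans.
- move=> [a c] /=; have [->|ac] := eqVneq a c; first by exists 1.
  exists (nm ((c0 + t1) 0 a - (c0 + t1) 0 c)) => //; rewrite nm_gt0; apply/eqP => h.
  by have := h1 a c ac; rewrite h mul0r eqxx.
have eta2 : 0 < eta / 2 by rewrite divr_gt0.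
have [Ab Ab0 HAb] := nf_S nf m.+1.
have [Fb Fb1 HFb] := coeff_bound n m eta2 Ab0.
have Fb0 : 0 <= Fb by apply: le_trans Fb1.
have al1 : Num.min al (ttau - pi) <= ttau - pi by rewrite ge_min lexx orbT.
have be1 : ttau <= Num.max be ttau by rewrite le_max lexx orbT.
have [rho [M [Cc [rho0 rhoT H]]]] := local_solution nf dPsi PsiPhi Psi_const Tt1 al1 be1 sep m0 Fb0.
(* Differences of eigenvalues move by at most 2 |t - t1|, so gaps of at least eta / 2 remain, as the
   bound on the coefficients requires. *)
exists (Num.min rho (eta / 4)), M, Cc; split; first by rewrite lt_min rho0 divr_gt0.
move=> t F Cm; rewrite lt_min => /andP[ht ht'] Ot [F0 Fd] cC w c a hw Mw.
have Tt := rhoT _ ht; have [hA _] := HAb _ Tt.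
have FB k i j : (k <= m)%N -> nm (F k i j) <= Fb.
  apply: (HFb (Ah^~ t) F (c0 + t)) => //; last exact: (nf_A0 nf Tt).
  move=> a' c' ac; have := Heta (a', c') ac => /= h2.
  have h3 := eig_dist t t1 a' c'.
  have h4 := nmBD ((c0 + t1) 0 a' - (c0 + t1) 0 c') ((c0 + t) 0 a' - (c0 + t) 0 c').
  move: h4 h3; rewrite nmB; move: h2 ht'; lra.
pose F' k (q : C) := if (k < m)%N then F k else 0.
have [d1 d2] := fdef_trunc m (nf_A0 nf Tt) Fd.
have [|||||||C' [_ HC']] := H C setT (fun=> t) F'.
- exact: openT.
- by move=> q _; split=> //; exact: dif_cst.
- by move=> k i j q _; exact: dif_cst.
- by move=> k i j q _; rewrite /F'; case: ifP => km; [exact/FB/ltnW|rewrite mxE nm0].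
- by move=> k q _ mk; rewrite /F' ltnNge mk.
- by move=> k q _; exact: d1.
- by move=> q a' _; exact: d2.
have FE w' c' a' : \sum_(k < m) F' k 0 c' a' * (cexp w')^-1 ^+ k = \sum_(k < m) F k c' a' * (cexp w')^-1 ^+ k.
  by apply: eq_bigr => k _; rewrite /F' ltn_ord.
(* Both rays lie in the enlarged sector; on them the terms of index 1 to m - 1 and the error of
   order m are all O(1/|z|). *)
have cC' : connects t (C' 0).
  exists (`|Cc| + m%:R * Fb), (Num.max M 1) => w' hw'; rewrite ge_max => /andP[w1 w2] i j.
  have w0 : 0 < cmod w' := lt_le_trans ltr01 w2.
  have sw : Num.min al (ttau - pi) <= carg w' <= Num.max be ttau.
    have pp := pi_ge0 R; have e : ttau - pi <= ttau by rewrite gerBl.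
    by case: hw' => ->; rewrite ge_min le_max ?lexx ?e ?orbT.
  have := HC' 0 w' i j I sw w1; rewrite FE => h2.
  have h3 : Cc / cmod w' ^+ m <= `|Cc| / cmod w'.
    apply: le_trans (_ : `|Cc| / cmod w' ^+ m <= _).
      by rewrite ler_wpM2r ?ler_norm // invr_ge0 exprn_ge0 // ltW.
    by rewrite ler_wpM2l // lef_pV2 ?posrE ?exprn_gt0 // ler_eXnr.
  have h4 : nm (\sum_(k < m) F k i j * (cexp w')^-1 ^+ k - (i == j)%:R) <= m%:R * Fb / cmod w'.
    case: (m) m0 FB => // m' _ FB; rewrite big_ord_recl /= F0 expr0 mulr1 mxE addrC addrA.
    rewrite [- _ + _]addrC subrr add0r; apply: le_trans (nm_sum _ _ _) _.
    apply: le_trans (_ : \sum_(k < m') Fb / cmod w' <= _); last first.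
      rewrite sumr_const card_ord -[_ *+ m']mulr_natl mulrA ler_wpM2r ?invr_ge0 ?(ltW w0) //.
      by rewrite ler_wpM2r // ler_nat.
    apply: ler_sum => k _; rewrite nmM nmX nmV nm_cexp -/(cmod w').
    rewrite ler_pM ?nm_ge0 ?exprn_ge0 ?invr_ge0 ?(ltW w0) //.
      by apply: FB; rewrite /bump /= add1n; exact: leqW (ltn_ord k).
    rewrite exprVn lef_pV2 ?posrE ?exprn_gt0 // /bump /= add1n.
    by rewrite ler_eXnr.
  rewrite mulrDl; apply: le_trans (nm_tri _ (\sum_(k < m) F k i j * (cexp w')^-1 ^+ k) _) _.
  by apply: lerD h4; exact: le_trans h3.
rewrite (connects_unique Ot cC cC') -FE; apply: HC' => //.
by have /andP[a1 a2] := hw; rewrite ge_min a1 le_max a2.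
Qed.

(** The case m = 0 states boundedness and follows from m = 1, the leading coefficient being the
    identity. *)
Lemma asym_local m : exists rho M Cc : R, 0 < rho /\
  forall t F Cm, nm (t - t1) < rho -> sepset t -> formal_at t F -> connects t Cm ->
  forall w c a, al <= carg w <= be -> M <= cmod w ->
  nm (nrm (fun w => Phi (w, t)) (c0 + t) (diag_part (Ah 1%N t)) Cm w c a -
      \sum_(k < m) F k c a * (cexp w)^-1 ^+ k) <= Cc / cmod w ^+ m.
Proof.
case: m => [|m]; last exact: asym_pos.
have [rho [M [Cc [rho0 H]]]] := @asym_pos 1 isT.
exists rho, (Num.max M 1), (1 + `|Cc|); split=> // t F Cm ht Ot fF cC w c a hw.
rewrite ge_max => /andP[w1 w2]; rewrite big_ord0 subr0 expr0 divr1.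
have := H t F Cm ht Ot fF cC w c a hw w1; rewrite big_ord1 /= expr0 mulr1 expr1.
have [F0 _] := fF; have e : F 0%N c a = (c == a)%:R by rewrite F0 mxE.
rewrite e => h.
have h2 : Cc / cmod w <= `|Cc|.
  have w0 : 0 < cmod w := lt_le_trans ltr01 w2.
  by rewrite ler_pdivrMr //; apply: le_trans (ler_norm _) _; rewrite ler_peMr.
have h3 : nm ((c == a)%:R : C) <= 1 by case: eqP; rewrite ?nm1 ?nm0.
have := nmBD (nrm (fun w => Phi (w, t)) (c0 + t) (diag_part (Ah 1%N t)) Cm w c a) ((c == a)%:R : C).
by move: h h2 h3; lra.
Qed.

End Asymptotics.
End Connection.

(** * The extension to the whole cell *)

Lemma formal_conj (R : realType) n (A : nat -> 'M[R[i]]_n) (G : 'M[R[i]]_n)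
    (lam b : 'rV[R[i]]_n) (F : nat -> 'M[R[i]]_n) : G \in unitmx ->
  formal_solution A G lam b F ->
  F 0%N = 1%:M /\ forall k, fdef (fun k => invmx G *m A k *m G) lam b F k = 0.
Proof.
move=> uG [F0 H]; split=> // k.
have := congr1 (mulmx (invmx G)) (H k); rewrite mulmxDr.
have -> : invmx G *m fs_deriv (fun k => G *m F k) k = fs_deriv F k.
  by case: k {H} => [|k] /=; rewrite ?mulmx0 // mulmxN -scalemxAr mulKmx.
have -> : invmx G *m fs_mul (fun k => G *m F k) (fs_exponent lam b) k = fs_mul F (fs_exponent lam b) k.
  by rewrite /fs_mul mulmx_sumr; apply: eq_bigr => j _; rewrite !mulmxA mulVmx // mul1mx.
have -> : invmx G *m fs_mul A (fun k => G *m F k) k = fs_mul (fun k => invmx G *m A k *m G) F k.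
  by rewrite /fs_mul mulmx_sumr; apply: eq_bigr => j _; rewrite !mulmxA.
by rewrite /fdef => <-; rewrite addrK subrr.
Qed.

Theorem corollary13p1 (R : realType) (n : nat) (hn : (0 < n)%N)
  (eps0 : R) (heps0 : 0 < eps0) (N0 : R) (hN0 : 0 < N0)
  (* the system *)
  (A : R[i] -> 'rV[R[i]]_n -> 'M[R[i]]_n)
  (Ak : nat -> 'rV[R[i]]_n -> 'M[R[i]]_n)
  (hA : holomorphic_on
     [set p : R[i] * 'rV[R[i]]_n | N0%:C <= `|p.1| /\ polydisc 0 eps0 p.2]
     (fun p => A p.1 p.2))
  (hAk : forall (z : R[i]) t, N0%:C <= `|z| -> polydisc 0 eps0 t ->
     series (fun j => z ^- j *: Ak j t) @ \oo --> A z t)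
  (* Assumption 1 *)
  (G0 : 'rV[R[i]]_n -> 'M[R[i]]_n)
  (u : 'rV[R[i]]_n -> 'rV[R[i]]_n)
  (hG0 : holomorphic_on (polydisc 0 eps0) G0)
  (hG0u : forall t, polydisc 0 eps0 t -> G0 t \in unitmx)
  (hG00 : G0 0 = 1%:M)
  (hdiag : forall t, polydisc 0 eps0 t ->
     invmx (G0 t) *m Ak 0%N t *m G0 t = diag_mx (u t))
  (* Lambda(0) = lambda_1 I_(p_1) + ... + lambda_s I_(p_s) in block form *)
  (s : nat) (lam : 'I_s -> R[i]) (blk : 'I_n -> 'I_s)
  (hlam : injective lam)
  (hblk : forall a b : 'I_n, (a <= b)%N -> (blk a <= blk b)%N)
  (hblks : forall i, exists a, blk a = i)
  (hu0 : forall a, u 0 0 a = lam (blk a))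
  (heps : forall t a b, polydisc 0 eps0 t ->
     u 0 0 a != u 0 0 b -> u t 0 a != u t 0 b)
  (* eigenvalues linear in t *)
  (hlin : forall t a, polydisc 0 eps0 t -> u t 0 a = u 0 0 a + t 0 a)
  (* coefficients of the formal solution, off the coalescence locus *)
  (b1 : 'rV[R[i]]_n -> 'rV[R[i]]_n)
  (hb1 : forall t, b1 t = diag_part (invmx (G0 t) *m Ak 1%N t *m G0 t))
  (F : nat -> 'rV[R[i]]_n -> 'M[R[i]]_n)
  (hF : forall t, polydisc 0 eps0 t -> ~ coalescence eps0 u t ->
     formal_solution (fun j => Ak j t) (G0 t) (u t) (b1 t) (fun k => F k t))
  (* tau_nu < ttau < tau_(nu+1), with ttau arbitrary if s = 1 *)
  (tau : int -> R) (nu : int) (ttau : R)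
  (htau : (1 < s)%N ->
     [/\ {homo tau : i j / i < j},
         range tau = [set theta | stokes_dir (u 0) theta]
       & tau nu < ttau < tau (nu + 1)])
  (cell : set 'rV[R[i]]_n) (hcell : is_cell eps0 u ttau cell)
  (* Y_nu near t0 *)
  (t0 : 'rV[R[i]]_n) (ht0 : cell t0)
  (r : R) (hr : 0 < r)
  (hP : polydisc t0 r `&` polydisc 0 eps0 `<=` cell)
  (N : R) (hN : N0 <= N)
  (Y0 : R[i] -> 'rV[R[i]]_n -> 'M[R[i]]_n)
  (hY0 : fundamental_solution A N (polydisc t0 r `&` polydisc 0 eps0) Y0)
  (hY0as : forall t, (polydisc t0 r `&` polydisc 0 eps0) t ->
     asymptotic_on [set t] (stokes_sector u ttau t) (normalized G0 u b1 Y0) F) :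
  exists Y : R[i] -> 'rV[R[i]]_n -> 'M[R[i]]_n,
    [/\ forall w t, N <= cmod w -> (polydisc t0 r `&` polydisc 0 eps0) t ->
          Y w t = Y0 w t,
        fundamental_solution A N cell Y,
        forall t, cell t ->
          asymptotic_on [set t] (stokes_sector u ttau t)
            (normalized G0 u b1 Y) F
      & forall K : set 'rV[R[i]]_n, compact K -> K `<=` cell ->
          asymptotic_on K (stokes_sector_on u ttau K)
            (normalized G0 u b1 Y) F].
Proof.
have [TV [r1 [gG [Ah [S [nf r1N PTV HG HP]]]]]] :=
  ex_normal_form hN0 hA hAk hG0 hG0u hdiag hlin.
have r10 := nf_r nf.
pose X := 'rV[R[i]]_n.
have hw1 : hplane (ln r1) (ln N0)%:C by rewrite /hplane /= ltr_ln ?posrE.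
have [Phi [Psi [dPP Psol PP Pconst]]] := ex_fund nf hw1.
have dPhi p i j hp := (dPP p i j hp).1; have dPsi p i j hp := (dPP p i j hp).2.
pose Om : set X := sepset TV ttau (u 0).
have [Cf HCf] := ex_connection ttau nf dPsi PP Pconst.
have uE t : polydisc 0 eps0 t -> u 0 + t = u t.
  by move=> Pt; apply/rowP => a; rewrite (hlin t a Pt) mxE.
have bE t : polydisc 0 eps0 t -> diag_part (Ah 1%N t) = b1 t.
  by move=> Pt; have [h _] := HP t Pt; rewrite hb1 h.
have cellW t : cell t -> [/\ polydisc 0 eps0 t, ~ coalescence eps0 u t & Om t].
  have [s0 Ws0 ->] := hcell => /connected_component_sub [Pt /not_orP[n1 n2]].
  split; [exact: Pt|exact: n1|split; first exact: PTV].
  by move=> a c ac; rewrite (uE t Pt); exact: crossing_sep Pt n1 n2 a c ac.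
have formal t : cell t -> formal_at (u 0) Ah t (F^~ t).
  move=> /cellW[Pt nco _]; have [h _] := HP t Pt.
  have [F0 Fd] := formal_conj (hG0u t Pt) (hF t Pt nco).
  have e : Ah^~ t = fun k => invmx (G0 t) *m Ak k t *m G0 t by apply/funext => j; exact: h.
  by split; [exact: F0|move=> k; rewrite (uE t Pt) (bE t Pt) e; exact: Fd].
(* Defined over the whole cell at once; what remains is to compare it with [Y0] and to read off its
   properties. *)
pose Y (w : R[i]) (t : X) := G0 t *m (Phi (w, t) *m Cf t).
have N0' : 0 < N := lt_le_trans hN0 hN.
have modN w : N <= cmod w -> hplane (ln r1) w.
  move=> h; rewrite /hplane /= -ltr_expR lnK ?posrE //.
  exact: lt_le_trans (lt_le_trans r1N hN) h.
have nrmY w t : cell t -> normalized G0 u b1 Y w t =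
    nrm (fun w => Phi (w, t)) (u 0 + t) (diag_part (Ah 1%N t)) (Cf t) w.
  move=> ct; have [Pt _ _] := cellW t ct; rewrite /normalized /nrm /Y (uE t Pt) (bE t Pt).
  by rewrite (mulKmx (hG0u t Pt)).
(* For |z| > N the matrix G0^(-1) Y0 is [Phi] times a constant [C0]. The asymptotics of order 1 on
   the closed sector from ttau - pi to ttau show that [C0] connects t, so it equals [Cf t]. *)
have eqY w t : N <= cmod w -> (polydisc t0 r `&` polydisc 0 eps0) t -> Y w t = Y0 w t.
  move=> hw Pt; have ct := hP _ Pt; have [Pt' nco Ot] := cellW t ct; have Tt := PTV _ Pt'.
  have [hol dY0 _] := hY0; have [U [g [oU subU dg gY]]] := hol.
  pose y w := invmx (G0 t) *m Y0 w t.
  have hplN w' : hplane (ln N) w' -> N < cmod w'.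
    by rewrite /hplane /= -ltr_expR lnK ?posrE.
  have sy : solves S t (hplane (ln N)) y.
    move=> w' i j /hplN hw'; have hd := dY0 w' t hw' Pt.
    rewrite /y; under eq_fun do rewrite mxE.
    have := isd_sum (index_enum 'I_n) (fun k => isdZ (invmx (G0 t) i k) (isd_mx_entry k j hd)).
    move/isd_eq; apply; have [_ hS] := HP t Pt'.
    rewrite hS; last by rewrite nm_cexp; exact: le_trans hN (ltW hw').
    rewrite -(mulmxA (invmx (G0 t) *m A (cexp w') t)) (mulKVmx (hG0u t Pt')) -mulmxA [in RHS]mxE big_distrr /=.
    by apply: eq_bigr => k _; rewrite mxE mulrCA.
  have subN : hplane (ln N) `<=` hplane (ln r1) by move=> w' /hplN /ltW; exact: modN.
  pose wN : R[i] := (ln (N + 1))%:C.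
  have hwN : hplane (ln N) wN by rewrite /hplane /= ltr_ln ?posrE ?ltrDl ?addr_gt0.
  pose C0 := Psi (wN, t) *m y wN.
  have yE w' : hplane (ln N) w' -> y w' = Phi (w', t) *m C0.
    move=> hw'; rewrite /C0 (Pconst t _ y Tt (@hplane_cconvex _ _) subN sy wN w' hwN hw').
    by rewrite mulmxA (mulmx1C (PP _ _ Tt (subN _ hw'))) mul1mx.
  have cC0 : connects ttau (u 0) Ah Phi t C0.
    have [|K [M HK]] := hY0as t Pt (ttau - pi) ttau _ 1%N.
      move=> w' /= /andP[w1 w2]; split=> th _ h; first exact: le_lt_trans h.
      exact: lt_le_trans w1.
    exists K, (Num.max M (N + 1)) => w' hw'; rewrite ge_max => /andP[m1 m2] i j.
    have hw2 : ttau - pi <= carg w' <= ttau.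
      by have pp := pi_ge0 R; case: hw' => ->; rewrite lexx ?andbT gerBl.
    have := HK w' t erefl hw2 m1; rewrite big_ord1 expr0 invr1 scale1r expr1 nm_leE.
    have [F0 _] := formal t ct; rewrite F0; apply: le_trans.
    have hwN' : hplane (ln N) w'.
      rewrite /hplane /= -ltr_expR lnK ?posrE //; apply: lt_le_trans m2.
      by rewrite ltrDl.
    have := nm_entry (normalized G0 u b1 Y0 w' t - 1%:M) i j.
    rewrite (_ : normalized G0 u b1 Y0 w' t = nrm (fun w => Phi (w, t)) (u 0 + t) (diag_part (Ah 1%N t)) C0 w').
      have e1 (M1 : 'M[R[i]]_n) : (M1 - 1%:M) i j = M1 i j - (i == j)%:R.
        by rewrite [LHS]mxE [X in _ + X]mxE [X in _ - X]mxE.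
      by rewrite e1.
    by rewrite /normalized /nrm -(yE w' hwN') (uE t Pt') (bE t Pt').
  have CE := connects_unique Ot cC0 (HCf t Ot).1.
  have YE w' : N < cmod w' -> Y w' t = Y0 w' t.
    move=> hw'; have hw2 : hplane (ln N) w' by rewrite /hplane /= -ltr_expR lnK ?posrE.
    by rewrite /Y -CE -yE // /y mulmxA mulmxV ?hG0u // mul1mx.
  have memw : [set p : R[i] * X | N <= cmod p.1 /\ (polydisc t0 r `&` polydisc 0 eps0) p.2] (w, t) by [].
  rewrite -(gY _ memw); apply/matrixP => i j; apply/subr0_eq.
  pose f (w' : R[i]) := Y w' t i j - g (w', t) i j.
  have df : differentiable f w.
    have d1 : differentiable (fun p => g p i j) (w, t) by apply/dif_entry/dg/subU.
    have hd : dom (hplane (ln r1)) TV (w, t) by split=> //; exact: modN.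
    have d2 : differentiable (fun w' => Y w' t i j) w.
      rewrite /Y; under eq_fun do rewrite mulmxA mxE; apply: dif_sum => k.
      apply: difM; last exact: dif_cst.
      under eq_fun do rewrite mxE; apply: dif_sum => l; apply: difM; first exact: dif_cst.
      exact: isd_dif (dif_slice (dPhi _ l k hd)).
    by apply: differentiableB d2 _; exact: isd_dif (dif_slice d1).
  (* The equation for [Y0] is given for |z| > N only; on the boundary |z| = N the equality follows
     by continuity from points slightly farther out. *)
  apply: (@nm_small_eq0 R R[i] (f w) 1) => // e e0; rewrite mulr1.
  have /cont_nmP/(_ e e0) [d d0 Hd] := differentiable_continuous df.
  have d2 : 0 < d / 2 by rewrite divr_gt0.
  have hw' : N < cmod (w + (d / 2)%:C).
    by apply: le_lt_trans hw _; rewrite /cmod ltr_expR Re_add ltrDl.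
  have memw' : [set p : R[i] * X | N <= cmod p.1 /\ (polydisc t0 r `&` polydisc 0 eps0) p.2] (w + (d / 2)%:C, t).
    by split=> //; exact: ltW.
  have := Hd (w + (d / 2)%:C); rewrite /f YE // (gY _ memw') /= subrr sub0r nmN; apply.
  by rewrite addrC addKr nmC ger0_norm ?(ltW d2) // ltr_pdivrMr // ltr_pMr // ltr1n.
have asymK (K : set X) : compact K -> K `<=` cell ->
    asymptotic_on K (stokes_sector_on u ttau K) (normalized G0 u b1 Y) F.
  move=> cK Kc al be sub m.
  (* The definition of asymptotics also quantifies over empty subsectors, where any constants do. *)
  have [ab|ba] := leP al be; last first.
    by exists 0, 0 => w t _ /andP[a1 a2] _; have := lt_le_trans ba (le_trans a1 a2); rewrite ltxx.
  (* One integer k is both the constant and the threshold for |z|, so Q is monotone in k. Membership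
     in the cell is a premise because the neighbourhoods in the compactness argument may leave
     it. *)
  pose Q (k : nat) (t : X) := cell t -> forall w, al <= carg w <= be -> k%:R <= cmod w ->
    nm (normalized G0 u b1 Y w t - \sum_(j < m) (cexp w) ^- j *: F j t) <= k%:R / cmod w ^+ m.
  have [||k Hk] := @compact_uniform R X K Q cK.
  - move=> k k' t kk Qk ct w hw wk'; have kk' : k%:R <= (k'%:R : R) by rewrite ler_nat.
    apply: le_trans (Qk ct w hw (le_trans kk' wk')) _.
    by rewrite ler_wpM2r // invr_ge0 exprn_ge0 // expR_ge0.
  - move=> t1 Kt1; have [Pt1 nco1 Ot1] := cellW _ (Kc _ Kt1).
    have sub1 : [set w : R[i] | al <= carg w <= be] `<=` stokes_sector u ttau t1.
      by move=> w hw; exact: (sub w hw t1 Kt1).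
    have sep1 a c (ac : a != c) : complex.Re ((u t1 0 a - u t1 0 c) * cis ttau) != 0.
      by have [_ h] := Ot1; rewrite -(uE t1 Pt1); exact: h.
    have sep a c (ac : a != c) th (hth : Num.min al (ttau - pi) + pi <= th <= Num.max be ttau) :
        complex.Re (((u 0 + t1) 0 a - (u 0 + t1) 0 c) * cis th) != 0.
      by rewrite (uE t1 Pt1); exact: (sector_sep ab sub1 sep1 ac hth).
    have [rho [M [Cc [rho0 H]]]] := asym_local nf dPsi PP Pconst Ot1 sep m.
    exists rho => //; exists (Num.truncn (Num.max (Num.max M Cc) 0)).+1 => t ht ct w hw wM.
    set k := (_.+1) in wM *.
    have hk : Num.max M Cc <= k%:R.
      by apply: le_trans (ltW (truncnS_gt _)); rewrite le_max lexx.
    move: hk; rewrite ge_max => /andP[Mk Ck].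
    have w0 : 0 < cmod w by exact: expR_gt0.
    have [Pt _ Ot] := cellW _ ct.
    apply: nm_mx_le => [|c a]; first by rewrite divr_ge0 // exprn_ge0 // ltW.
    apply: le_trans (_ : Cc / cmod w ^+ m <= _); last first.
      by rewrite ler_wpM2r // invr_ge0 exprn_ge0 // ltW.
    have := H t (F^~ t) (Cf t) ht Ot (formal t ct) (HCf t Ot).1 w c a hw (le_trans Mk wM).
    rewrite (nrmY w t ct) => h; apply: le_trans h; rewrite le_eqVlt; apply/orP; left; apply/eqP.
    congr nm; rewrite [LHS]mxE; congr (_ + _); rewrite mxE; congr (- _).
    by rewrite summxE; apply: eq_bigr => j _; rewrite mxE exprVn mulrC.
  exists k%:R, k%:R => w t Kt hw wk; rewrite nm_leE.
  by apply: (Hk t t Kt _ (Kc _ Kt)) => //; rewrite subrr nm0 invr_gt0.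
exists Y; split.
- exact: eqY.
- split.
  (* Off the closed polydisc [G0] is replaced by its holomorphic extension [gG]. *)
  + exists (dom (hplane (ln r1)) Om), (fun p => gG p.2 *m (Phi p *m Cf p.2)); split.
    * by apply: open_dom; [exact: open_hplane|exact: open_sepset nf].
    * by move=> [w t] [/= hw ct]; have [_ _ Ot] := cellW t ct; split=> //; exact: modN.
    * move=> [w t] [/= hw Ot]; have [Tt _] := Ot; have [d1 _ _] := HG t Tt.
      apply: dif_mx => i j; under eq_fun do rewrite mxE; apply: dif_sum => k; apply: difM.
        exact: (dif_comp (dif_snd (w, t)) (dif_entry i k d1)).
      under eq_fun do rewrite mxE; apply: dif_sum => l; apply: difM.
        by apply: dPhi.
      exact: (dif_comp (dif_snd (w, t)) ((HCf t Ot).2 l j)).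
    * move=> [w t] [/= hw ct]; have [Pt _ [Tt _]] := cellW t ct.
      by have [_ _ e] := HG t Tt; rewrite e.
  + move=> w t hw ct; have [Pt _ [Tt _]] := cellW t ct; have hpw := modN w (ltW hw).
    have [_ hS] := HP t Pt.
    apply: isd_mx => i j; rewrite /Y; under eq_fun do rewrite mulmxA mxE.
    have E : cexp w *: (A (cexp w) t *m (G0 t *m (Phi (w, t) *m Cf t))) =
        G0 t *m (cexp w *: (S (cexp w, t) *m Phi (w, t))) *m Cf t.
      rewrite hS; last by rewrite nm_cexp; exact: le_trans hN (ltW hw).
      by rewrite -scalemxAr -scalemxAl -!mulmxA (mulKVmx (hG0u t Pt)).
    rewrite E mxE.
    apply: (@isd_sum _ _ _ (fun k w' => (G0 t *m Phi (w', t)) i k * Cf t k j)) => k.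
    have h1 : is_derive w (1 : R[i]) (fun w' => (G0 t *m Phi (w', t)) i k)
        ((G0 t *m (cexp w *: (S (cexp w, t) *m Phi (w, t)))) i k).
      under eq_fun do rewrite mxE; rewrite mxE.
      apply: (@isd_sum _ _ _ (fun l w' => G0 t i l * Phi (w', t) l k)) => l.
      by apply: isdZ; rewrite mxE; exact: (Psol t Tt).
    by have := isdM h1 (isd_cst (Cf t k j) w) => /isd_eq; apply; rewrite mulr0 addr0.
  + move=> w t hw ct; have [Pt _ Ot] := cellW t ct; have [Tt _] := Ot.
    rewrite /Y !unitmx_mul hG0u //= (good_unit (HCf t Ot).1) andbT.
    by have /mulmx1_unit[] := PP t w Tt (modN w hw).
(* Pointwise asymptotics are the uniform ones on a one-point compact set. *)
- move=> t ct; have := asymK [set t] (@compact_set1 _ t).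
  by rewrite /stokes_sector_on bigcap_set1; apply=> _ ->.
- exact: asymK.
Qed.
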